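(* Let $K, L$ be unconditional convex bodies (with respect to the same orthonormal basis) in $\mathbb{R}^n$ and let $\lambda\in(0,1)$. Then $$V(\lambda\cdot K+_o(1-\lambda)\cdot L)\geq V(K)^{\lambda}V(L)^{1-\lambda}.$$ Equality holds if and only if the following condition is satisfied: whenever $K=K_1\times\dots\times K_m$ for some irreducible unconditional convex bodies $K_1,\dots,K_m$, there exist positive numbers $c_1,\dots,c_m$ such that $$L=c_1K_1\times\dots\times c_mK_m.$$
   Context: A convex body in $\mathbb{R}^n$ is a compact convex set with non-empty interior; $V$ denotes $n$-dimensional volume (Lebesgue measure). The support function of $K$ is $h_K(x)=\max\{x\cdot y : y\in K\}$. The 0-convex combination of $K$ and $L$ is $$\lambda\cdot K+_o(1-\lambda)\cdot L=\{x\in\mathbb{R}^n : x\cdot u\le h_K^{\lambda}(u)h_L^{1-\lambda}(u)\text{ for all }u\in S^{n-1}\}.$$ A convex body is unconditional if it is symmetric with respect to the coordinate hyperplanes (of a prefixed orthonormal basis). Cartesian products are taken with respect to the coordinates: for a partition $\{1,\dots,n\}=I_1\sqcup\dots\sqcup I_m$ into non-empty sets and unconditional convex bodies $K_j\subset\mathbb{R}^{I_j}$, $K_1\times\dots\times K_m=\{x\in\mathbb{R}^n : (x_i)_{i\in I_j}\in K_j,\ j=1,\dots,m\}$; in $c_1K_1\times\dots\times c_mK_m$ the same partition is used. An unconditional convex body is irreducible if it cannot be written as the Cartesian product of ($m\geq 2$) unconditional convex bodies in this sense. *)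

(* Defs.v *)
From HB Require Import structures.
From mathcomp Require Import all_boot all_order all_algebra.
From mathcomp Require Import all_classical all_reals all_analysis.

Set Implicit Arguments.
Unset Strict Implicit.
Unset Printing Implicit Defensive.

Import Order.TTheory GRing.Theory Num.Theory.
Import numFieldNormedType.Exports.

Local Open Scope classical_set_scope.
Local Open Scope ring_scope.

(* The library has Lebesgue measure on R and binary product measures, but no
   Lebesgue measure on R^n; it is obtained here as the n-fold product measure,
   carried by n.-tuple R with the library's product sigma-algebra. *)
Section lebesgue_tuple.
Context (R : realType).
Local Notation borelR := (measurableTypeR R).
Local Open Scope ereal_scope.

Definition tuple_of_pair (n : nat) (p : borelR * n.-tuple borelR) :
  n.+1.-tuple borelR := [tuple of p.1 :: p.2].

Lemma measurable_tuple_of_pair (n : nat) :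
  measurable_fun [set: borelR * n.-tuple borelR] (@tuple_of_pair n).
Proof.
exact: (@measurable_cons _ _ (borelR * n.-tuple borelR)%type borelR fst n snd
  measurable_fst measurable_snd).
Qed.

Section step.
Context (n : nat) (mu : {sigma_finite_measure set (n.-tuple borelR) -> \bar R}).

Definition lebesgue_tuple_step : set (n.+1.-tuple borelR) -> \bar R :=
  pushforward (@lebesgue_measure R \x mu) (@tuple_of_pair n).

Let step0 : lebesgue_tuple_step set0 = 0.
Proof. by have mf := @measurable_tuple_of_pair n; exact: measure0. Qed.

Let step_ge0 A : 0 <= lebesgue_tuple_step A.
Proof. by have mf := @measurable_tuple_of_pair n; exact: measure_ge0. Qed.

Let step_sigma_additive : semi_sigma_additive lebesgue_tuple_step.
Proof.
by have mf := @measurable_tuple_of_pair n; exact: measure_semi_sigma_additive.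
Qed.

HB.instance Definition _ := isMeasure.Build _ _ _ lebesgue_tuple_step
  step0 step_ge0 step_sigma_additive.

Let step_sigma_finite : sigma_finite setT lebesgue_tuple_step.
Proof.
have /sigma_finiteP[F [FT ndF Foo]] := sigma_finiteT (@lebesgue_measure R).
have /sigma_finiteP[G [GT ndG Goo]] := sigma_finiteT mu.
pose g (t : n.+1.-tuple borelR) : borelR * n.-tuple borelR :=
  (tnth t ord0, [tuple of behead t]).
have gK p : g (tuple_of_pair p) = p.
  by case: p => x t; congr pair => //; exact: val_inj.
have mg : measurable_fun setT g.
  by apply: measurable_fun_pair; [exact: measurable_tnth|exact: measurable_behead].
exists (fun k => g @^-1` (F k `*` G k)).
  rewrite predeqE => t; split=> // _.
  have [i _ Fi] : (\bigcup_i F i) (g t).1 by rewrite -FT.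
  have [j _ Gj] : (\bigcup_i G i) (g t).2 by rewrite -GT.
  exists (maxn i j) => //; split => /=.
  - by move: Fi; exact/subsetPset/ndF/leq_maxl.
  - by move: Gj; exact/subsetPset/ndG/leq_maxr.
move=> k; have [mF Fk] := Foo k; have [mG Gk] := Goo k; split.
  by rewrite -[X in measurable X]setTI; apply: mg => //; exact: measurableX.
rewrite /lebesgue_tuple_step /pushforward (_ : _ @^-1` _ = F k `*` G k).
  by rewrite product_measure1E// lte_mul_pinfty// ge0_fin_numE.
by apply/seteqP; split => p; rewrite /preimage /mkset gK.
Qed.

HB.instance Definition _ := Measure_isSigmaFinite.Build _ _ _
  lebesgue_tuple_step step_sigma_finite.

End step.

Fixpoint lebesgue_tuple (n : nat) :
    {sigma_finite_measure set (n.-tuple borelR) -> \bar R} :=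
  match n with
  | 0 => \d_([tuple] : 0.-tuple borelR)
  | n'.+1 => lebesgue_tuple_step (lebesgue_tuple n')
  end.

Lemma lebesgue_tuple_box (n : nat) (F : nat -> set borelR) :
  (forall i, measurable (F i)) ->
  lebesgue_tuple n [set t | forall i : 'I_n, F i (tnth t i)] =
  \prod_(i < n) lebesgue_measure (F i).
Proof.
elim: n F => [|n IH] F mF.
  by rewrite big_ord0 /= diracE mem_set //= => -[].
rewrite big_ord_recl /= -(IH (fun i => F i.+1)) //.
rewrite /lebesgue_tuple_step /pushforward -product_measure1E //.
- congr (_ _); apply/seteqP; split => [[x t] H|[x t] [/= H1 H2] i] /=.
    split; first by have := H ord0.
    by move=> i /=; have := H (lift ord0 i); rewrite /tuple_of_pair tnthS.
  case: (unliftP ord0 i) => [j ->|->] //.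
  by rewrite /tuple_of_pair tnthS; exact: H2.
- rewrite [X in measurable X](_ : _ =
    \bigcap_(i in [set: 'I_n]) ((@tnth n _)^~ i @^-1` F i.+1)).
    apply: fin_bigcap_measurable => // i _.
    by rewrite -[X in measurable X]setTI; exact: measurable_tnth.
  by apply/seteqP; split => t H i; [move=> _|]; apply: H.
Qed.

End lebesgue_tuple.

Section bodies.
Context (R : realType).

Section dimension_n.
Context (n : nat).
Implicit Types (x y u : 'rV[R]_n) (K L : set 'rV[R]_n) (a : R).

Definition volume K : \bar R :=
  lebesgue_tuple R n [set t | K (\row_i tnth t i)].

Definition convex_body K : Prop :=
  [/\ compact K, convex_set (K : set (convex_lmodType 'rV[R]_n)) &
      K° !=set0].

Definition dotv x y : R := \sum_i x 0 i * y 0 i.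

(* Euclidean norm: the library's norm on 'rV[R]_n is the sup norm. *)
Definition unit_sphere : set 'rV[R]_n :=
  [set u | Num.sqrt (dotv u u) = 1].

Definition support_function K u : R := sup [set dotv u y | y in K].

Definition zero_convex_combination a K L : set 'rV[R]_n :=
  [set x | forall u, unit_sphere u ->
    dotv x u <= support_function K u `^ a * support_function L u `^ (1 - a)].

Definition reflect_coord (i : 'I_n) x : 'rV[R]_n :=
  \row_j (if j == i then - x 0 j else x 0 j).

Definition unconditional K : Prop :=
  forall i : 'I_n, reflect_coord i @` K = K.

Definition unconditional_convex_body K : Prop :=
  convex_body K /\ unconditional K.

Definition dilate a K : set 'rV[R]_n := [set a *: x | x in K].

(* R^I is 'rV[R]_#|I|, the coordinates being listed in increasing order. *)
Definition proj_coords (I : {set 'I_n}) x : 'rV[R]_#|I| :=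
  \row_k x 0 (enum_val k).

(* The factors are indexed by the blocks of the partition P; the values of F
   outside P are irrelevant. *)
Definition cartesian_product (P : {set {set 'I_n}})
    (F : forall I : {set 'I_n}, set 'rV[R]_#|I|) : set 'rV[R]_n :=
  [set x | forall I : {set 'I_n}, I \in P -> F I (proj_coords I x)].

End dimension_n.

Definition irreducible (n : nat) (K : set 'rV[R]_n) : Prop :=
  ~ exists (P : {set {set 'I_n}}) (F : forall I : {set 'I_n}, set 'rV[R]_#|I|),
    [/\ finset.partition P [set: 'I_n]%SET, (1 < #|P|)%N,
        (forall I, I \in P -> unconditional_convex_body (F I)) &
        K = cartesian_product P F].

End bodies.

(* Main.v *)
Require Import Defs.
From mathcomp Require Import all_boot all_order all_algebra all_fingroup.
From mathcomp Require Import all_classical all_reals all_analysis.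
From mathcomp Require Import measurable_realfun ring lra.

(** The inequality.  The 0-convex combination of K and L contains all coordinatewise
    geometric means of K and L, that is, all z with
    |z_i| = |x_i|^lambda |y_i|^(1 - lambda) for some x in K and y in L
    ([zero_combination_contains], from Hoelder's inequality).  So it suffices to
    prove a multiplicative Prekopa-Leindler inequality for sets containing these
    means ([prekopa_leindler]).  This is done by induction on the dimension: the
    volumes f(s) and g(t) of the slices of K and L are decreasing functions of the
    height, the slice of Z at height s^lambda t^(1 - lambda) has volume at least
    f(s)^lambda g(t)^(1 - lambda), and a transport argument on the line, comparing
    the heights s(m) and t(m) that cut off the same fraction m of the two volumes,
    gives the inequality ([line_inequality]).

    The equality case, first step.  Equality forces the transport t(s) to satisfy
    t'/t = 1/s, so t is linear ([line_equality]).  Hence for every coordinate i the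
    truncation of K at |x_i| <= s and the truncation of L at |x_i| <= d_i s have
    volumes in the ratio of the volumes of K and L, and equality persists for the
    truncated sets.  Since d_i is the ratio of the axes of L and K, which do not
    change when another coordinate is truncated, all coordinates can be truncated
    in turn: K and the image of L under d^(-1) have proportional volumes in all
    boxes centred at 0, and it follows that L = d K for the diagonal map d
    ([gmean_equality_diagonal]).

    The equality case, second step.  For L = d K the body d^(1 - lambda) K lies in
    the 0-convex combination and has the volume of the right-hand side, so equality
    means that the 0-convex combination is d^(1 - lambda) K
    ([zero_combination_equalityP]).  If x is a boundary point of K with positive
    coordinates, some constraint of the 0-convex combination is tight at
    d^(1 - lambda) x, and the equality case of Hoelder's inequality turns it into a
    normal vector of K at x whose support lies in a single level set of d
    ([normal_in_level]).  Normal vectors of this kind see the level sets of d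
    separately, so K is the product of its projections to them ([level_product]).
    An irreducible factor of K cannot be split, so d is constant on it
    ([irreducible_factor_level]).

    Conversely, if d is constant on the blocks of a decomposition of K, the
    constraints given by vectors supported in one block, together with the
    separation theorem, show that the 0-convex combination of K and d K is
    contained in d^(1 - lambda) K ([zero_combination_product]).  The condition of the
    theorem provides such a d because a decomposition into irreducible factors
    exists ([irreducible_decomposition]). *)

Set Implicit Arguments.
Unset Strict Implicit.
Unset Printing Implicit Defensive.

Import Order.TTheory GRing.Theory Num.Theory.
Import numFieldNormedType.Exports.

Local Open Scope classical_set_scope.
Local Open Scope ring_scope.

(** * Weighted geometric means *)

Section weighted_geometric_mean.
Context (R : realType) (l : R).
Hypotheses (l0 : 0 < l) (l1 : l < 1).
Implicit Types a b c d x y : R.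

Definition gmean (w a b : R) : R := a `^ w * b `^ (1 - w).

Let l1' : 0 < 1 - l. Proof. by rewrite subr_gt0. Qed.

Lemma gmean_ge0 a b : 0 <= gmean l a b.
Proof. by rewrite mulr_ge0 ?powR_ge0. Qed.

Lemma gmean_gt0 a b : 0 < a -> 0 < b -> 0 < gmean l a b.
Proof. by move=> *; rewrite mulr_gt0 ?powR_gt0. Qed.

Lemma gmean0l b : gmean l 0 b = 0.
Proof. by rewrite /gmean powR0 ?mul0r ?gt_eqF. Qed.

Lemma gmean0r a : gmean l a 0 = 0.
Proof. by rewrite /gmean (@powR0 _ (1 - l)) ?mulr0 ?gt_eqF. Qed.

Lemma gmean_id a : 0 <= a -> gmean l a a = a.
Proof.
move=> a0; rewrite /gmean -powRD ?subrKC ?powRr1 //.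
by rewrite oner_eq0.
Qed.

Lemma gmeanM a b c d : 0 <= a -> 0 <= b -> 0 <= c -> 0 <= d ->
  gmean l (a * c) (b * d) = gmean l a b * gmean l c d.
Proof. by move=> *; rewrite /gmean !powRM // mulrACA. Qed.

Lemma gmeanZ c a b : 0 <= a -> 0 <= b -> 0 <= c ->
  gmean l (c * a) (c * b) = c * gmean l a b.
Proof. by move=> *; rewrite gmeanM // gmean_id. Qed.

Lemma gmean_le a b c d : 0 <= a -> 0 <= b -> a <= c -> b <= d ->
  gmean l a b <= gmean l c d.
Proof.
move=> a0 b0 ac bd; have c0 : c \is Num.nneg by rewrite nnegrE (le_trans a0).
have d0 : d \is Num.nneg by rewrite nnegrE (le_trans b0).
rewrite /gmean ler_pM ?powR_ge0 //.
- by apply: (ge0_ler_powR (ltW l0)).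
- by apply: (ge0_ler_powR (ltW l1')).
Qed.

Lemma gmean_lt a b c d : 0 <= a -> 0 <= b -> a < c -> b < d ->
  gmean l a b < gmean l c d.
Proof.
move=> a0 b0 ac bd; rewrite /gmean ltr_pM ?powR_ge0 //.
- by apply: gt0_ltr_powR => //; rewrite nnegrE (le_trans a0) // ltW.
- by apply: gt0_ltr_powR => //; rewrite nnegrE (le_trans b0) // ltW.
Qed.

Lemma ln_gmean a b : 0 < a -> 0 < b ->
  ln (gmean l a b) = l * ln a + (1 - l) * ln b.
Proof.
by move=> a0 b0; rewrite /gmean lnM ?posrE ?powR_gt0 // !ln_powR.
Qed.

Lemma ln_lt_sub1 x : 0 < x -> x != 1 -> ln x < x - 1.
Proof.
move=> x0 x1; have := @expR_gt1Dx _ (ln x).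
rewrite ln_eq0 // lnK ?posrE // => /(_ x1) h; lra.
Qed.

Lemma ln_le_sub1 x : 0 < x -> ln x <= x - 1.
Proof.
move=> x0; have := @expR_ge1Dx _ (ln x); rewrite lnK ?posrE // => h; lra.
Qed.

(** Dividing by the geometric mean m reduces the inequality to [ln x <= x - 1] at
    a / m and b / m, because the weighted logarithms of these two numbers add up
    to 0; the inequality is strict at a number different from 1. *)
Lemma gmean_lt_amean a b : 0 < a -> 0 < b -> a != b ->
  gmean l a b < l * a + (1 - l) * b.
Proof.
move=> a0 b0 ab; set m := gmean l a b.
have m0 : 0 < m by exact: gmean_gt0.
have am0 : 0 < a / m by rewrite divr_gt0.
have bm0 : 0 < b / m by rewrite divr_gt0.
have lnm : l * ln (a / m) + (1 - l) * ln (b / m) = 0.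
  by rewrite -ln_gmean // gmeanM ?invr_ge0 ?ltW // gmean_id ?invr_ge0 ?ltW //
     -/m divff ?gt_eqF // ln1.
have la := ln_le_sub1 am0; have lb := ln_le_sub1 bm0.
suff : 1 < (l * a + (1 - l) * b) / m by rewrite ltr_pdivlMr // mul1r.
rewrite mulrDl -!mulrA.
have [am1|am1] := eqVneq (a / m) 1; last first.
  have {}la := ln_lt_sub1 am0 am1.
  have h1 : l * ln (a / m) < l * (a / m - 1) by rewrite ltr_pM2l.
  have h2 : (1 - l) * ln (b / m) <= (1 - l) * (b / m - 1) by rewrite ler_pM2l.
  lra.
have [bm1|bm1] := eqVneq (b / m) 1.
  by move: ab; rewrite -(divfK (lt0r_neq0 m0) a) -(divfK (lt0r_neq0 m0) b) am1 bm1 eqxx.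
have {}lb := ln_lt_sub1 bm0 bm1.
have h1 : l * ln (a / m) <= l * (a / m - 1) by rewrite ler_pM2l.
have h2 : (1 - l) * ln (b / m) < (1 - l) * (b / m - 1) by rewrite ltr_pM2l.
lra.
Qed.

Lemma gmean_le_amean a b : 0 <= a -> 0 <= b ->
  gmean l a b <= l * a + (1 - l) * b.
Proof.
rewrite le_eqVlt => /predU1P[<-|a0].
  by move=> b0; rewrite gmean0l mulr0 add0r mulr_ge0 // ltW.
rewrite le_eqVlt => /predU1P[<-|b0].
  by rewrite gmean0r mulr0 addr0 mulr_ge0 // ltW.
have [->|ab] := eqVneq a b; last exact/ltW/gmean_lt_amean.
by rewrite gmean_id ?(ltW b0) // -mulrDl subrKC mul1r.
Qed.

Lemma amean_le_gmean_eq a b : 0 < a -> 0 < b ->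
  l * a + (1 - l) * b <= gmean l a b -> a = b.
Proof.
move=> a0 b0 h; apply/eqP/negP => /negP ab.
by have := gmean_lt_amean a0 b0 ab; rewrite ltNge h.
Qed.

(** By homogeneity, both arguments may be shrunk by the same factor. *)
Lemma gmean_between s t w : 0 < s -> 0 < t -> 0 < w < gmean l s t ->
  exists s' t', [/\ 0 < s' < s, 0 < t' < t & gmean l s' t' = w].
Proof.
move=> s0 t0 /andP[w0 wu]; set u := gmean l s t in wu *.
have u0 : 0 < u by exact: gmean_gt0.
have c1 : w / u < 1 by rewrite ltr_pdivrMr // mul1r.
have c0 : 0 < w / u by rewrite divr_gt0.
exists (w / u * s), (w / u * t); split.
- by rewrite mulr_gt0 //= -[X in _ < X]mul1r ltr_pM2r.
- by rewrite mulr_gt0 //= -[X in _ < X]mul1r ltr_pM2r.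
- by rewrite gmeanZ ?ltW // -/u divfK // gt_eqF.
Qed.

Section hoelder.
Context (I : finType).
Implicit Types p q : I -> R.

(** Hoelder's inequality for the exponents 1 / l and 1 / (1 - l): normalize both
    sums to 1 and add up the arithmetic-geometric inequalities of the terms. *)
Lemma gmean_sum_le p q : (forall i, 0 <= p i) -> (forall i, 0 <= q i) ->
  \sum_i gmean l (p i) (q i) <= gmean l (\sum_i p i) (\sum_i q i).
Proof.
move=> p0 q0; set P := \sum_i p i; set Q := \sum_i q i.
have P0 : 0 <= P by exact: sumr_ge0.
have Q0 : 0 <= Q by exact: sumr_ge0.
have [PE|PN] := eqVneq P 0.
  rewrite big1 ?gmean_ge0 // => i _.
  by have /psumr_eq0P h := PE; rewrite h ?gmean0l.
have [QE|QN] := eqVneq Q 0.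
  rewrite big1 ?gmean_ge0 // => i _.
  by have /psumr_eq0P h := QE; rewrite h ?gmean0r.
have {PN P0} P0 : 0 < P by rewrite lt0r PN.
have {QN Q0} Q0 : 0 < Q by rewrite lt0r QN.
have P0' := ltW P0; have Q0' := ltW Q0.
have -> : \sum_i gmean l (p i) (q i) =
    gmean l P Q * \sum_i gmean l (p i / P) (q i / Q).
  rewrite mulr_sumr; apply: eq_bigr => i _.
  rewrite -gmeanM ?divr_ge0 //.
  by rewrite [P * _]mulrC [Q * _]mulrC !divfK ?gt_eqF.
rewrite ler_piMr ?gmean_ge0 //.
apply: (@le_trans _ _ (\sum_i (l * (p i / P) + (1 - l) * (q i / Q)))).
  by apply: ler_sum => i _; apply: gmean_le_amean; rewrite divr_ge0.
rewrite big_split /= -!mulr_sumr -!mulr_suml divff ?gt_eqF // divff ?gt_eqF //.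
by rewrite !mulr1 subrKC.
Qed.

(** The equality case of Hoelder's inequality: once both sums are normalized,
    every term must be an equality of the arithmetic-geometric inequality, so
    the two normalized families coincide. *)
Lemma gmean_sum_eq p q : (forall i, 0 <= p i) -> (forall i, 0 <= q i) ->
  (forall i, 0 < p i <-> 0 < q i) ->
  gmean l (\sum_i p i) (\sum_i q i) <= \sum_i gmean l (p i) (q i) ->
  forall i j, 0 < p i -> 0 < p j -> q i / p i = q j / p j.
Proof.
move=> p0 q0 pq.
set P := \sum_i p i; set Q := \sum_i q i => hle.
suff H i : 0 < p i -> p i / P = q i / Q /\ 0 < P /\ 0 < Q.
  move=> i j pi pj; have [ei [P0 Q0]] := H _ pi; have [ej _] := H _ pj.
  have E k : 0 < p k -> p k / P = q k / Q -> q k / p k = Q / P.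
    move=> pk ek; apply/eqP; rewrite eqr_div ?lt0r_neq0 //.
    by move/eqP: ek; rewrite eqr_div ?lt0r_neq0 // => /eqP ek; rewrite -ek mulrC.
  by rewrite !E.
move=> pi; have P0 : 0 < P.
  rewrite /P (bigD1 i) //= (lt_le_trans pi) // lerDl.
  by apply: sumr_ge0.
have Q0 : 0 < Q.
  have qi : 0 < q i by apply/pq.
  rewrite /Q (bigD1 i) //= (lt_le_trans qi) // lerDl.
  by apply: sumr_ge0.
have P0' := ltW P0; have Q0' := ltW Q0.
split=> //; apply: contrapT => /eqP ne.
have : \sum_i gmean l (p i / P) (q i / Q) < 1.
  have -> : 1 = \sum_i (l * (p i / P) + (1 - l) * (q i / Q)).
    rewrite big_split /= -!mulr_sumr -!mulr_suml divff ?gt_eqF //.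
    by rewrite divff ?gt_eqF // !mulr1 subrKC.
  rewrite (bigD1 i) //= [ltRHS](bigD1 i) //= ltr_leD //.
    apply: gmean_lt_amean => //; rewrite divr_gt0 //; exact/pq.
  by apply: ler_sum => k _; apply: gmean_le_amean; rewrite divr_ge0.
rewrite ltNge => /negP; apply.
rewrite -(ler_pM2l (gmean_gt0 P0 Q0)) mulr1 (le_trans hle) //.
rewrite mulr_sumr; apply: ler_sum => k _.
rewrite -gmeanM ?divr_ge0 //.
by rewrite [P * _]mulrC [Q * _]mulrC !divfK ?gt_eqF.
Qed.

End hoelder.

End weighted_geometric_mean.

(** * Monotonicity from small steps *)

Section limits.
Context (R : realType).
Implicit Types x y : R.

Lemma le_of_shrink x y : 0 <= x ->
  (forall e, 0 < e -> e < 1 -> (1 - e) * x <= y) -> x <= y.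
Proof.
move=> x0 h; rewrite leNgt; apply/negP => yx.
have y0 : 0 <= y by apply: le_trans (h (2^-1) _ _); [apply: mulr_ge0|..]; lra.
have x0' : 0 < x by apply: le_lt_trans yx.
have e0 : 0 < (x - y) / (2 * x) by rewrite divr_gt0 //; lra.
have e1 : (x - y) / (2 * x) < 1 by rewrite ltr_pdivrMr; lra.
have := h _ e0 e1.
have -> : (1 - (x - y) / (2 * x)) * x = (x + y) / 2 by field; apply: lt0r_neq0.
lra.
Qed.

Lemma le_of_shrink2 x y : 0 <= x ->
  (forall e, 0 < e -> e < 1 -> (1 - e) ^+ 2 * x <= y) -> x <= y.
Proof.
move=> x0 h; apply: le_of_shrink => // e e0 e1.
apply: (@le_trans _ _ ((1 - e / 2) ^+ 2 * x)); last by apply: h; lra.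
by apply: ler_wpM2r => //; nra.
Qed.

(** Cutting an interval into pieces shorter than [del] replaces differentiation in
    the sequel: an inequality between increments that holds up to a factor 1 - e
    on all short steps holds on the whole interval, and then e tends to 0. *)
Lemma local_nondecreasing (Phi : R -> R) (al be del : R) : 0 < del ->
  (forall m0 m1, al <= m0 -> m0 < m1 -> m1 <= be -> m1 - m0 < del ->
    Phi m0 <= Phi m1) ->
  al <= be -> Phi al <= Phi be.
Proof.
move=> del0 h ab.
pose N := (Num.trunc ((be - al) / del)).+1.
have N0 : 0 < N%:R :> R by rewrite ltr0n.
have hN : (be - al) / N%:R < del.
  rewrite ltr_pdivrMr // mulrC -ltr_pdivrMr // /N.
  by apply: truncnS_gt.
pose pt (i : nat) := al + (be - al) / N%:R * i%:R.
have st0 : 0 <= (be - al) / N%:R by rewrite divr_ge0 ?subr_ge0.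
have ptN : pt N = be by rewrite /pt divfK ?gt_eqF // subrKC.
suff H i : (i <= N)%N -> Phi al <= Phi (pt i) by rewrite -[be in leRHS]ptN; apply: H.
elim: i => [_|i IH iN]; first by rewrite /pt mulr0 addr0.
apply: le_trans (IH (ltnW iN)) _.
have ptS : pt i.+1 = pt i + (be - al) / N%:R by rewrite /pt -natr1; ring.
have [st1|st1] := eqVneq ((be - al) / N%:R) 0; first by rewrite ptS st1 addr0.
apply: h.
- by rewrite /pt lerDl mulr_ge0.
- by rewrite ptS ltrDl lt0r st1.
- by rewrite -ptN /pt lerD2l ler_wpM2l // ler_nat.
- by rewrite ptS addrC addKr.
Qed.

Lemma bernoulli_sub x (k : nat) : 0 <= x -> x <= 1 -> 1 - k%:R * x <= (1 - x) ^+ k.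
Proof.
move=> x0 x1; elim: k => [|k IH]; first by rewrite mul0r subr0 expr0.
rewrite exprS -natr1.
apply: (@le_trans _ _ ((1 - x) * (1 - k%:R * x))); last by rewrite ler_wpM2l // subr_ge0.
have : 0 <= k%:R * (x * x) by rewrite !mulr_ge0.
by lra.
Qed.

End limits.

(** * Profiles and quantiles *)

Section profiles.
Context (R : realType).

(** [F s] stands for the volume of the part of a body at distance at most s from a
    coordinate hyperplane, [f s] for its derivative, twice the volume of the slice
    at height s, and a for the height of the body.  That F is the integral of f is
    recorded by two-sided bounds of the increments, which slices of nested shape
    give directly.  The last field compares a slice with the cone over it whose
    apex is at height a; it makes f continuous on [0, a), with explicit bounds. *)
Record profile (k : nat) (a : R) (F f : R -> R) : Prop := Profile {
  profile_gt0 : 0 < a;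
  profile0 : F 0 = 0;
  profile_ge : forall s, 0 <= f s;
  profile_pos : forall s, 0 <= s -> s < a -> 0 < f s;
  profile_lb : forall s s', 0 <= s -> s < s' -> f s' * (s' - s) <= F s' - F s;
  profile_ub : forall s s', 0 <= s -> s < s' -> F s' - F s <= f s * (s' - s);
  profile_ratio : forall s s', 0 <= s -> s < s' -> s' < a ->
    ((a - s') / (a - s)) ^+ k * f s <= f s' }.

Section one.
Context (k : nat) (a : R) (F f : R -> R) (P : profile k a F f).
Let a0 := profile_gt0 P.

Lemma profile_noninc s s' : 0 <= s -> s < s' -> f s' <= f s.
Proof.
move=> s0 ss; rewrite -(@ler_pM2r _ (s' - s)) ?subr_gt0 //.
by apply: le_trans (profile_lb P s0 ss) (profile_ub P s0 ss).
Qed.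

Lemma profile_incr s s' : 0 <= s -> s < s' -> s' <= a -> F s < F s'.
Proof.
move=> s0 ss sa; pose m := (s + s') / 2.
have sm : s < m by rewrite /m; lra.
have ms : m < s' by rewrite /m; lra.
have h1 := profile_lb P s0 sm.
have m0 : 0 <= m by lra.
have h2 := profile_lb P m0 ms.
have h3 : 0 < f m * (m - s).
  by apply: mulr_gt0; [apply: (profile_pos P); lra|lra].
have h4 : 0 <= f s' * (s' - m) by apply: mulr_ge0; [apply: (profile_ge P)|lra].
lra.
Qed.

Lemma profile_incrP s s' : 0 <= s -> s <= a -> 0 <= s' -> s' <= a ->
  F s < F s' -> s < s'.
Proof.
move=> s0 sa s'0 s'a h; rewrite ltNge; apply/negP; rewrite le_eqVlt => /predU1P[e|e].
  by move: h; rewrite e ltxx.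
by have := profile_incr s'0 e sa; rewrite ltNge ltW.
Qed.

Lemma profile_inj s s' : 0 <= s -> s <= a -> 0 <= s' -> s' <= a ->
  F s = F s' -> s = s'.
Proof.
move=> s0 sa s'0 s'a h; case: (ltgtP s s') => // hs.
  by have := profile_incr s0 hs s'a; rewrite h ltxx.
by have := profile_incr s'0 hs sa; rewrite h ltxx.
Qed.

Lemma profile_mass_gt0 : 0 < F a.
Proof. by rewrite -(profile0 P); apply: profile_incr. Qed.

(** F is Lipschitz with constant f 0, so the supremum of the heights of mass at most
    the prescribed one has exactly this mass. *)
Lemma profile_quantile m : 0 <= m -> m < 1 ->
  exists s, [/\ 0 <= s, s < a & F s = m * F a].
Proof.
move=> m0 m1; have M0 := profile_mass_gt0; set M := m * F a.
have MF : M < F a by rewrite /M -[ltRHS]mul1r ltr_pM2r.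
have M0' : 0 <= M by rewrite mulr_ge0 // ltW.
pose E := [set s | 0 <= s <= a /\ F s <= M].
have E0 : E 0 by rewrite /E /= lexx (ltW a0) (profile0 P).
have supE : has_sup E by split; [exists 0|exists a => x [/andP[]]].
pose s := sup E.
have s0 : 0 <= s by apply: ub_le_sup => //; case: supE.
have sa : s <= a by apply: sup_le_ub; [exists 0|move=> x [/andP[]]].
have f0 : 0 < f 0 by apply: (profile_pos P).
have lip x y : 0 <= x -> x < y -> F y - F x <= f 0 * (y - x).
  move=> x0 xy; apply: le_trans (profile_ub P x0 xy) _.
  rewrite ler_wpM2r ?subr_ge0 ?(ltW xy) //.
  move: x0; rewrite le_eqVlt => /predU1P[<-//|x0].
  exact: profile_noninc.
have h1 : F s <= M.
  apply/ler_addgt0Pr => e e0.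
  have e0' : 0 < e / f 0 by rewrite divr_gt0.
  have [x Ex xs] := sup_adherent e0' supE.
  have [/andP[x0 xa] Fx] := Ex; rewrite -/s in xs.
  have := ub_le_sup (proj2 supE) Ex; rewrite -/s le_eqVlt => /predU1P[<-|xs'].
    by apply: le_trans Fx _; rewrite lerDl ltW.
  have := lip _ _ x0 xs'.
  have : f 0 * (s - x) < f 0 * (e / f 0) by rewrite ltr_pM2l //; lra.
  have -> : f 0 * (e / f 0) = e by field; apply: lt0r_neq0.
  lra.
have sa' : s < a.
  rewrite lt_neqAle sa andbT; apply/eqP => e; move: h1; rewrite e; lra.
exists s; split => //; apply/eqP; rewrite eq_le h1 /=.
apply/ler_addgt0Pr => e e0.
pose x := s + Order.min (e / f 0) (a - s).
have xs : s < x by rewrite /x ltrDl lt_min divr_gt0 //= subr_gt0.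
have xa : x <= a.
  have : Order.min (e / f 0) (a - s) <= a - s by rewrite ge_min lexx orbT.
  by rewrite /x; lra.
have xe : f 0 * (x - s) <= e.
  have : Order.min (e / f 0) (a - s) <= e / f 0 by rewrite ge_min lexx.
  rewrite -(ler_pM2l f0) => h.
  have -> : x - s = Order.min (e / f 0) (a - s) by rewrite /x; lra.
  apply: le_trans h _; have -> // : f 0 * (e / f 0) = e by field; apply: lt0r_neq0.
have Fx : M < F x.
  rewrite ltNge; apply/negP => Fx.
  have /(ub_le_sup (proj2 supE)) : E x by split => //; rewrite xa andbT; lra.
  by rewrite -/s leNgt xs.
by have := lip _ _ s0 xs; lra.
Qed.

End one.

(** [s m] is the height below which the fraction m of the total mass lies.  Two
    bodies are compared at the heights that belong to the same fraction m; this is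
    the monotone transport map between the two profiles. *)
Record quantile (a : R) (F s : R -> R) : Prop := Quantile {
  quantile_ge0 : forall m, 0 <= m -> m < 1 -> 0 <= s m;
  quantile_lt : forall m, 0 <= m -> m < 1 -> s m < a;
  quantileE : forall m, 0 <= m -> m < 1 -> F (s m) = m * F a }.

Lemma exists_quantile k a F f : profile k a F f -> exists s, quantile a F s.
Proof.
move=> P.
have /choice[s hs] : forall m, exists s, 0 <= m -> m < 1 ->
    [/\ 0 <= s, s < a & F s = m * F a].
  move=> m; have [m0|m0] := boolP (0 <= m); last by exists 0.
  have [m1|m1] := boolP (m < 1); last by exists 0.
  by have [s hs] := profile_quantile P m0 m1; exists s.
by exists s; split => m m0 m1; have [] := hs m m0 m1.
Qed.

Section quantile_theory.
Context (k : nat) (a : R) (F f s : R -> R).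
Context (P : profile k a F f) (Q : quantile a F s).

Let FA := profile_mass_gt0 P.

Lemma quantile_incr m0 m1 : 0 <= m0 -> m0 < m1 -> m1 < 1 -> s m0 < s m1.
Proof.
move=> m00 m01 m11; have m01' := lt_trans m01 m11.
have m10 : 0 <= m1 by lra.
have [[h1 h2] h3] := (quantile_ge0 Q m00 m01', quantile_lt Q m00 m01', quantileE Q m00 m01').
have [[h4 h5] h6] := (quantile_ge0 Q m10 m11, quantile_lt Q m10 m11, quantileE Q m10 m11).
apply: (profile_incrP P) => //; rewrite ?(ltW h2) ?(ltW h5) //.
by rewrite h3 h6 ltr_pM2r.
Qed.

Lemma quantile_gt0 m : 0 < m -> m < 1 -> 0 < s m.
Proof.
move=> m0 m1; apply: le_lt_trans (quantile_incr (lexx _) m0 m1).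
exact: (quantile_ge0 Q).
Qed.

Lemma quantileK x : 0 < x -> x < a ->
  [/\ 0 < F x / F a, F x / F a < 1 & s (F x / F a) = x].
Proof.
move=> x0 xa.
have h0 : 0 < F x / F a.
  by rewrite divr_gt0 // -(profile0 P); apply: (profile_incr P) => //; exact: ltW.
have h1 : F x / F a < 1.
  by rewrite ltr_pdivrMr // mul1r; apply: (profile_incr P) => //; exact: ltW.
split=> //; have h0' := ltW h0.
have [[h2 h3] h4] := (quantile_ge0 Q h0' h1, quantile_lt Q h0' h1, quantileE Q h0' h1).
apply: (profile_inj P) => //; rewrite ?ltW //.
by rewrite h4 divfK // gt_eqF.
Qed.

Lemma quantile_lb m0 m1 : 0 <= m0 -> m0 < m1 -> m1 < 1 ->
  f (s m1) * (s m1 - s m0) <= (m1 - m0) * F a.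
Proof.
move=> m00 m01 m11; have m01' := lt_trans m01 m11.
have m10 : 0 <= m1 by lra.
rewrite mulrBl -(quantileE Q m00) // -(quantileE Q m10) //.
by apply: (profile_lb P); [exact: (quantile_ge0 Q)|exact: quantile_incr].
Qed.

Lemma quantile_ub m0 m1 : 0 <= m0 -> m0 < m1 -> m1 < 1 ->
  (m1 - m0) * F a <= f (s m0) * (s m1 - s m0).
Proof.
move=> m00 m01 m11; have m01' := lt_trans m01 m11.
have m10 : 0 <= m1 by lra.
rewrite mulrBl -(quantileE Q m00) // -(quantileE Q m10) //.
by apply: (profile_ub P); [exact: (quantile_ge0 Q)|exact: quantile_incr].
Qed.

Lemma quantile_pos m : 0 <= m -> m < 1 -> 0 < f (s m).
Proof.
by move=> m0 m1; apply: (profile_pos P);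
  [exact: (quantile_ge0 Q)|exact: (quantile_lt Q)].
Qed.

(** Both f and the height vary by a factor close to 1 between nearby fractions.  The
    bound on f needs the step of the height to be small compared with the remaining
    height a - s be (Bernoulli's inequality for the exponent k), the bound on the
    height needs it to be small compared with s al; d below is chosen accordingly. *)
Lemma quantile_unif al be e : 0 < al -> al < be -> be < 1 -> 0 < e -> e < 1 ->
  exists2 del, 0 < del &
  forall m0 m1, al <= m0 -> m0 < m1 -> m1 <= be -> m1 - m0 < del ->
    (1 - e) * f (s m0) <= f (s m1) /\ (1 - e) * s m1 <= s m0.
Proof.
move=> al0 alb be1 e0 e1.
have be0 := lt_trans al0 alb; have al1 := lt_trans alb be1.
have sal := quantile_gt0 al0 al1.
have sbe := quantile_lt Q (ltW be0) be1.
have fbe := quantile_pos (ltW be0) be1.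
pose d := e * Order.min (s al) ((a - s be) / k.+1%:R).
have k0 : 0 < k.+1%:R :> R by rewrite ltr0n.
have d0 : 0 < d.
  by rewrite mulr_gt0 // lt_min sal /= divr_gt0 // subr_gt0.
have d1 : d <= e * s al by rewrite ler_pM2l // ge_min lexx.
have d2 : d * k.+1%:R <= e * (a - s be).
  by rewrite /d -mulrA ler_pM2l // -ler_pdivlMr // ge_min lexx orbT.
exists (d * f (s be) / F a); first by rewrite divr_gt0 // mulr_gt0.
move=> m0 m1 m0al m01 m1be; rewrite ltr_pdivlMr // => hd.
have m00 : 0 < m0 by lra.
have m11 : m1 < 1 by lra.
have m01' : m0 < 1 by lra.
have m10 : 0 < m1 by lra.
have s01 := quantile_incr (ltW m00) m01 m11.
have s1b : s m1 <= s be.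
  move: m1be; rewrite le_eqVlt => /predU1P[->//|h].
  by rewrite ltW // quantile_incr // ltW.
have s0a : s al <= s m0.
  move: m0al; rewrite le_eqVlt => /predU1P[->//|h].
  by rewrite ltW // quantile_incr // ltW.
have fb1 : f (s be) <= f (s m1).
  move: s1b; rewrite le_eqVlt => /predU1P[->//|h].
  by apply: (profile_noninc P) => //; apply: ltW; apply: quantile_gt0.
have sd : s m1 - s m0 < d.
  have := quantile_lb (ltW m00) m01 m11.
  have : f (s be) * (s m1 - s m0) <= f (s m1) * (s m1 - s m0).
    by rewrite ler_wpM2r // subr_ge0 ltW.
  move=> h1 h2; rewrite -(ltr_pM2l fbe) mulrC; lra.
have s00 := quantile_gt0 m00 m01'.
split.
  apply: le_trans _ (profile_ratio P (ltW s00) s01 (le_lt_trans s1b sbe)).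
  rewrite ler_wpM2r ?(profile_ge P) //.
  have as0 : 0 < a - s m0 by lra.
  have -> : (a - s m1) / (a - s m0) = 1 - (s m1 - s m0) / (a - s m0).
    by field; apply: lt0r_neq0.
  set x := (s m1 - s m0) / (a - s m0).
  have x0 : 0 <= x by rewrite divr_ge0 // ltW // subr_gt0.
  have kx : k.+1%:R * x <= e.
    rewrite /x mulrA ler_pdivrMr //.
    apply: (@le_trans _ _ (k.+1%:R * d)).
      by rewrite ler_pM2l // ltW.
    rewrite mulrC; apply: le_trans d2 _.
    by rewrite ler_pM2l //; lra.
  have kx' : k%:R * x <= e.
    by apply: le_trans kx; rewrite ler_wpM2r // ler_nat.
  have x1 : x <= 1.
    have : x <= k.+1%:R * x by rewrite ler_peMl // ler1n.
    lra.
  by apply: le_trans _ (bernoulli_sub k x0 x1); lra.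
have : e * s al <= e * s m1 by rewrite ler_pM2l //; lra.
lra.
Qed.

End quantile_theory.

End profiles.

(** * The one-dimensional inequality and its equality case *)

Section ln_bounds.
Context (R : realType).
Implicit Types x y : R.

Lemma ln_diff_le x y : 0 < x -> 0 < y -> ln y - ln x <= (y - x) / x.
Proof.
move=> x0 y0; rewrite -ln_div ?posrE //.
have -> : (y - x) / x = y / x - 1 by field; apply: lt0r_neq0.
by apply: ln_le_sub1; rewrite divr_gt0.
Qed.

Lemma ln_diff_ge x y : 0 < x -> 0 < y -> (y - x) / y <= ln y - ln x.
Proof.
move=> x0 y0; rewrite -lerN2 opprB.
by apply: le_trans (ln_diff_le y0 x0) _; rewrite -mulNr opprB.
Qed.

(** Superadditivity of the geometric mean is Hoelder's inequality for two terms. *)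
Lemma gmeanD_ge l a b c d : 0 < l -> l < 1 ->
  0 <= a -> 0 <= b -> 0 <= c -> 0 <= d ->
  gmean l a c + gmean l b d <= gmean l (a + b) (c + d) :> R.
Proof.
move=> l0 l1 a0 b0 c0 d0.
have := @gmean_sum_le R l l0 l1 bool (fun i => if i then a else b)
  (fun i => if i then c else d).
by rewrite !big_bool /=; apply; case.
Qed.

End ln_bounds.

Section same_log_speed.
Context (R : realType) (ka kb : nat) (a b : R) (F f G g s t : R -> R).
Context (PF : profile ka a F f) (PG : profile kb b G g).
Context (QF : quantile a F s) (QG : quantile b G t).
Hypothesis speed : forall m, 0 < m -> m < 1 ->
  F a / (f (s m) * s m) = G b / (g (t m) * t m).

(** The hypothesis [speed] says that ln s and ln t have the same derivative with
    respect to the fraction m.  On short steps the increments of the two logarithms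
    are therefore comparable up to the factor (1 - e)^2. *)
Lemma quantile_ln_le al be : 0 < al -> al < be -> be < 1 ->
  ln (t be) - ln (t al) <= ln (s be) - ln (s al).
Proof.
move=> al0 ab be1; have be0 := lt_trans al0 ab; have al1 := lt_trans ab be1.
apply: le_of_shrink2.
  rewrite subr_ge0 ler_ln ?posrE ?(quantile_gt0 PG QG) //.
  by rewrite ltW // (quantile_incr PG QG) // ltW.
move=> e e0 e1.
have [d1 d10 hd1] := quantile_unif PF QF al0 ab be1 e0 e1.
have [d2 d20 hd2] := quantile_unif PG QG al0 ab be1 e0 e1.
pose Phi m := ln (s m) - (1 - e) ^+ 2 * ln (t m).
suff : Phi al <= Phi be by rewrite /Phi; lra.
apply: (@local_nondecreasing _ _ _ _ (Order.min d1 d2)); last exact: ltW.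
  by rewrite lt_min d10.
move=> m0 m1 am m01 mb; rewrite lt_min => /andP[md1 md2].
have m00 : 0 < m0 by lra.
have m11 : m1 < 1 by lra.
have m01' : m0 < 1 by lra.
have m10 : 0 < m1 by lra.
have [f1 s1] := hd1 _ _ am m01 mb md1.
have [g1 t1] := hd2 _ _ am m01 mb md2.
have s00 := quantile_gt0 PF QF m00 m01'; have s10 := quantile_gt0 PF QF m10 m11.
have t00 := quantile_gt0 PG QG m00 m01'; have t10 := quantile_gt0 PG QG m10 m11.
have f00 := quantile_pos PF QF (ltW m00) m01'.
have g00 := quantile_pos PG QG (ltW m00) m01'.
have g10 := quantile_pos PG QG (ltW m10) m11.
have ls := ln_diff_ge s00 s10.
have lt' := ln_diff_le t00 t10.
have hs := quantile_ub PF QF (ltW m00) m01 m11.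
have ht := quantile_lb PG QG (ltW m00) m01 m11.
set p := F a / (f (s m0) * s m0).
have pE : p * (f (s m0) * s m0) = F a by rewrite divfK // mulf_neq0 ?lt0r_neq0.
have qE : p * (g (t m0) * t m0) = G b.
  by rewrite /p speed // divfK // mulf_neq0 ?lt0r_neq0.
have p0 : 0 < p by rewrite divr_gt0 ?(profile_mass_gt0 PF) // mulr_gt0.
have es : (m1 - m0) * (p * s m0) <= s m1 - s m0.
  rewrite -(ler_pM2l f00); apply: le_trans hs; rewrite -pE le_eqVlt; apply/orP; left.
  by apply/eqP; ring.
have et : (1 - e) * (t m1 - t m0) <= (m1 - m0) * (p * t m0).
  rewrite -(ler_pM2l g00); apply: (@le_trans _ _ (g (t m1) * (t m1 - t m0))).
    rewrite mulrA [_ * (1 - e)]mulrC ler_wpM2r // subr_ge0 ltW //.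
    exact: (quantile_incr PG QG (ltW m00)).
  apply: le_trans ht _; rewrite -qE le_eqVlt; apply/orP; left.
  by apply/eqP; ring.
have es' : (1 - e) * ((m1 - m0) * p) <= (s m1 - s m0) / s m1.
  rewrite ler_pdivlMr //; apply: le_trans es.
  have : 0 <= (m1 - m0) * p by rewrite mulr_ge0 ?ltW // subr_gt0.
  move=> h; have := ler_wpM2l h s1; lra.
have et' : (1 - e) * ((t m1 - t m0) / t m0) <= (m1 - m0) * p.
  by rewrite mulrA ler_pdivrMr // -mulrA.
have e1' : 0 < 1 - e by lra.
rewrite /Phi.
have h1 := le_trans es' ls.
have h2 : (1 - e) ^+ 2 * (ln (t m1) - ln (t m0)) <= (1 - e) * ((m1 - m0) * p).
  rewrite expr2 -mulrA ler_pM2l //; apply: le_trans et'.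
  by rewrite ler_pM2l.
lra.
Qed.

End same_log_speed.

Section prekopa_leindler_line.
Context (R : realType) (l : R) (l0 : 0 < l) (l1 : l < 1).
Context (ka kb : nat) (a b : R) (F f G g : R -> R).
Context (PF : profile ka a F f) (PG : profile kb b G g).
Context (H : R -> R) (top : R).
Hypothesis H_ge0 : forall v, 0 <= v -> 0 <= H v.
Hypothesis H_le : forall v, 0 <= v -> H v <= top.
Hypothesis H_lb : forall x y v, 0 < x -> x < a -> 0 < y -> y < b ->
  0 <= v -> v < gmean l x y ->
  (gmean l x y - v) * gmean l (f x) (g y) <= H (gmean l x y) - H v.

Local Notation tot := (gmean l (F a) (G b)).

Section with_quantiles.
Context (s t : R -> R).
Context (QF : quantile a F s) (QG : quantile b G t).
Let u m := gmean l (s m) (t m).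

Let u_incr m0 m1 : 0 <= m0 -> m0 < m1 -> m1 < 1 -> u m0 < u m1.
Proof.
move=> m00 m01 m11; have m01' := lt_trans m01 m11.
apply: gmean_lt => //; first exact: (quantile_ge0 QF).
- exact: (quantile_ge0 QG).
- exact: (quantile_incr PF QF).
- exact: (quantile_incr PG QG).
Qed.

Let u_gt0 m : 0 < m -> m < 1 -> 0 < u m.
Proof.
by move=> m0 m1; apply: gmean_gt0; [exact: (quantile_gt0 PF QF)|exact: (quantile_gt0 PG QG)].
Qed.

Let H_step m0 m1 : 0 < m0 -> m0 < m1 -> m1 < 1 ->
  (u m1 - u m0) * gmean l (f (s m1)) (g (t m1)) <= H (u m1) - H (u m0).
Proof.
move=> m00 m01 m11; have m10 := lt_trans m00 m01; have m01' := lt_trans m01 m11.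
apply: H_lb.
- exact: (quantile_gt0 PF QF).
- exact: (quantile_lt QF (ltW m10)).
- exact: (quantile_gt0 PG QG).
- exact: (quantile_lt QG (ltW m10)).
- by apply: ltW; apply: u_gt0.
- by apply: u_incr => //; exact: ltW.
Qed.

Let tot_gt0 : 0 < tot.
Proof. by apply: gmean_gt0; [exact: profile_mass_gt0 PF|exact: profile_mass_gt0 PG]. Qed.

(** On a short step from m0 to m1 the increment of u is at least the geometric mean
    of the increments of s and t, and the densities are almost constant; the
    product of the two geometric means is the geometric mean of the masses, which
    are (m1 - m0) F a and (m1 - m0) G b. *)
Lemma line_increment al be : 0 < al -> al < be -> be < 1 ->
  (be - al) * tot <= H (u be) - H (u al).
Proof.
move=> al0 ab be1.
apply: le_of_shrink.
  by rewrite mulr_ge0 ?ltW // subr_gt0.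
move=> e e0 e1.
have [d1 d10 hd1] := quantile_unif PF QF al0 ab be1 e0 e1.
have [d2 d20 hd2] := quantile_unif PG QG al0 ab be1 e0 e1.
pose Phi m := H (u m) - (1 - e) * (m * tot).
suff : Phi al <= Phi be by rewrite /Phi; lra.
apply: (@local_nondecreasing _ _ _ _ (Order.min d1 d2)); last exact: ltW.
  by rewrite lt_min d10.
move=> m0 m1 am m01 mb; rewrite lt_min => /andP[md1 md2].
have m00 : 0 < m0 by lra.
have m11 : m1 < 1 by lra.
have m01' : m0 < 1 by lra.
have m10 : 0 < m1 by lra.
have [f1 _] := hd1 _ _ am m01 mb md1.
have [g1 _] := hd2 _ _ am m01 mb md2.
have f00 := quantile_pos PF QF (ltW m00) m01'.
have g00 := quantile_pos PG QG (ltW m00) m01'.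
have s01 := quantile_incr PF QF (ltW m00) m01 m11.
have t01 := quantile_incr PG QG (ltW m00) m01 m11.
have s00 := quantile_gt0 PF QF m00 m01'; have t00 := quantile_gt0 PG QG m00 m01'.
have e1' : 0 <= 1 - e by lra.
have h1 : (1 - e) * gmean l (f (s m0)) (g (t m0)) <= gmean l (f (s m1)) (g (t m1)).
  by rewrite -gmeanZ ?(ltW f00) ?(ltW g00) //; apply: gmean_le => //;
    apply: mulr_ge0 => //; apply: ltW.
have ds : 0 <= s m1 - s m0 by rewrite subr_ge0 ltW.
have dt : 0 <= t m1 - t m0 by rewrite subr_ge0 ltW.
have h2 : gmean l (s m1 - s m0) (t m1 - t m0) <= u m1 - u m0.
  have := gmeanD_ge l0 l1 (ltW s00) ds (ltW t00) dt.
  by rewrite !subrKC -/(u m0) -/(u m1); lra.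
have dm : 0 <= m1 - m0 by lra.
have FA := ltW (profile_mass_gt0 PF); have GB := ltW (profile_mass_gt0 PG).
have h3 : (m1 - m0) * tot <=
    gmean l (f (s m0)) (g (t m0)) * gmean l (s m1 - s m0) (t m1 - t m0).
  rewrite -gmeanZ // -gmeanM ?(ltW f00) ?(ltW g00) //.
  apply: gmean_le; rewrite ?mulr_ge0 //.
    exact: (quantile_ub PF QF (ltW m00)).
  exact: (quantile_ub PG QG (ltW m00)).
have h4 := H_step m00 m01 m11.
have g0 : 0 < gmean l (f (s m0)) (g (t m0)) by exact: gmean_gt0.
have h5 : (1 - e) * ((m1 - m0) * tot) <= H (u m1) - H (u m0).
  apply: le_trans h4.
  apply: (@le_trans _ _ ((u m1 - u m0) * ((1 - e) * gmean l (f (s m0)) (g (t m0))))).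
    rewrite [X in _ <= X]mulrCA ler_wpM2l //; apply: le_trans h3 _.
    by rewrite mulrC ler_pM2r.
  rewrite ler_wpM2l // subr_ge0 ltW // u_incr //.
  exact: ltW.
by rewrite /Phi; lra.
Qed.

Lemma line_inequality_quantile : tot <= top.
Proof.
apply: le_of_shrink => [|e e0 e1]; first exact: ltW.
have h : (1 - e / 2 - e / 2) * tot <= H (u (1 - e / 2)) - H (u (e / 2)).
  by apply: line_increment; lra.
have p1 : 0 < u (e / 2) by apply: u_gt0; lra.
have p2 : 0 < u (1 - e / 2) by apply: u_gt0; lra.
have := H_le (ltW p2); have := H_ge0 (ltW p1).
have -> : 1 - e = 1 - e / 2 - e / 2 by field.
lra.
Qed.

Hypothesis top_le : top <= tot.

Let H_quantile m : 0 < m -> m < 1 -> H (u m) = m * tot.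
Proof.
move=> m0 m1; apply/eqP; rewrite eq_le; apply/andP; split.
  suff : (1 - m) * tot <= top - H (u m) by have := top_le; rewrite mulrBl mul1r; lra.
  apply: le_of_shrink => [|e e0 e1]; first by rewrite mulr_ge0 ?ltW // subr_gt0.
  have h1 : 0 < (1 - m) * (1 - e) by rewrite mulr_gt0 // subr_gt0.
  have h2 : 0 < (1 - m) * e by rewrite mulr_gt0 // subr_gt0.
  have b1 : m < 1 - (1 - m) * e by lra.
  have b2 : 1 - (1 - m) * e < 1 by lra.
  have := line_increment m0 b1 b2.
  have := H_le (ltW (u_gt0 (lt_trans m0 b1) b2)).
  have -> : 1 - (1 - m) * e - m = (1 - e) * (1 - m) by ring.
  rewrite -mulrA; lra.
apply: le_of_shrink => [|e e0 e1]; first by rewrite mulr_ge0 ?ltW.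
have b1 : 0 < m * e by rewrite mulr_gt0.
have b2 : m * e < m by rewrite -[ltRHS]mulr1 ltr_pM2l.
have := line_increment b1 b2 m1; have := H_ge0 (ltW (u_gt0 b1 (lt_trans b2 m1))).
have -> : m - m * e = (1 - e) * m by ring.
by rewrite -mulrA; lra.
Qed.

(** In the case of equality the lower bound for H is attained on every step.
    Dividing by the length of the step gives, in the limit, l p + (1 - l) q <=
    gmean l p q for the logarithmic derivatives p and q of s and t; here u is
    bounded below through ln u, which is the arithmetic mean of ln s and ln t.
    The arithmetic-geometric inequality forces p = q. *)
Let speed m : 0 < m -> m < 1 ->
  F a / (f (s m) * s m) = G b / (g (t m) * t m).
Proof.
move=> m00 m01.
have s00 := quantile_gt0 PF QF m00 m01; have t00 := quantile_gt0 PG QG m00 m01.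
have f00 := quantile_pos PF QF (ltW m00) m01.
have g00 := quantile_pos PG QG (ltW m00) m01.
have FA := profile_mass_gt0 PF; have GB := profile_mass_gt0 PG.
set p := F a / _; set q := G b / _.
have fs : 0 < f (s m) * s m by rewrite mulr_gt0.
have gt : 0 < g (t m) * t m by rewrite mulr_gt0.
have p0 : 0 < p by rewrite divr_gt0.
have q0 : 0 < q by rewrite divr_gt0.
have pE : p * (f (s m) * s m) = F a by rewrite divfK // lt0r_neq0.
have qE : q * (g (t m) * t m) = G b by rewrite divfK // lt0r_neq0.
apply: (amean_le_gmean_eq l0 l1 p0 q0).
have l1' : 0 < 1 - l by rewrite subr_gt0.
apply: le_of_shrink2; first by rewrite addr_ge0 // mulr_ge0 // ltW.
move=> e e0 e1.
(* Any upper end in (m, 1) would do: it only serves to make the bounds uniform. *)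
pose be := (1 + m) / 2.
have mbe : m < be by rewrite /be; lra.
have be1 : be < 1 by rewrite /be; lra.
have [d1 d10 hd1] := quantile_unif PF QF m00 mbe be1 e0 e1.
have [d2 d20 hd2] := quantile_unif PG QG m00 mbe be1 e0 e1.
pose m1 := m + Order.min (be - m) (Order.min (d1 / 2) (d2 / 2)).
have i1 : Order.min (be - m) (Order.min (d1 / 2) (d2 / 2)) <= be - m.
  by rewrite ge_min lexx.
have i2 : Order.min (be - m) (Order.min (d1 / 2) (d2 / 2)) <= d1 / 2.
  by rewrite !ge_min lexx orbT.
have i3 : Order.min (be - m) (Order.min (d1 / 2) (d2 / 2)) <= d2 / 2.
  by rewrite !ge_min lexx !orbT.
have i4 : m < m1 by rewrite /m1 ltrDl !lt_min subr_gt0 mbe /= !divr_gt0.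
have m1b : m1 <= be by rewrite /m1; lra.
have m11 : m1 < 1 by lra.
have m10 : 0 < m1 by lra.
have m1d1 : m1 - m < d1 by rewrite /m1; lra.
have m1d2 : m1 - m < d2 by rewrite /m1; lra.
have [f1 s1] := hd1 _ _ (lexx _) i4 m1b m1d1.
have [g1 t1] := hd2 _ _ (lexx _) i4 m1b m1d2.
have s10 := quantile_gt0 PF QF m10 m11; have t10 := quantile_gt0 PG QG m10 m11.
have hs := quantile_ub PF QF (ltW m00) i4 m11.
have ht := quantile_ub PG QG (ltW m00) i4 m11.
have dm : 0 < m1 - m by lra.
have log_step (x r : R) : 0 < x -> 0 < r -> forall (y M w : R), 0 < y ->
    w * (r * x) = M -> 0 < w -> (1 - e) * y <= x ->
    (m1 - m) * M <= r * (y - x) -> (1 - e) * ((m1 - m) * w) <= ln y - ln x.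
  move=> x0 r0 y M w y0 wE w0 yx hM; apply: le_trans (ln_diff_ge x0 y0).
  rewrite ler_pdivlMr //.
  have h1 : (m1 - m) * w * x <= y - x.
    rewrite -(ler_pM2l r0); apply: le_trans hM.
    by rewrite -wE le_eqVlt; apply/orP; left; apply/eqP; ring.
  have h2 : 0 <= (m1 - m) * w by rewrite mulr_ge0 // ltW.
  have := ler_wpM2l h2 yx; lra.
have lns := log_step _ _ s00 f00 _ _ _ s10 pE p0 s1 hs.
have lnt := log_step _ _ t00 g00 _ _ _ t10 qE q0 t1 ht.
have u00 := u_gt0 m00 m01; have u10 := u_gt0 m10 m11.
have lnu : (1 - e) * ((m1 - m) * (l * p + (1 - l) * q)) <= ln (u m1) - ln (u m).
  rewrite !ln_gmean //.
  have h1 := ler_wpM2l (ltW l0) lns; have h2 := ler_wpM2l (ltW l1') lnt.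
  lra.
have du : (1 - e) * ((m1 - m) * (l * p + (1 - l) * q)) * u m <= u m1 - u m.
  by rewrite -ler_pdivlMr //; apply: le_trans lnu (ln_diff_le u00 u10).
have e1' : 0 <= 1 - e by lra.
have gf : (1 - e) * gmean l (f (s m)) (g (t m)) <= gmean l (f (s m1)) (g (t m1)).
  by rewrite -gmeanZ ?(ltW f00) ?(ltW g00) //; apply: gmean_le => //;
    apply: mulr_ge0 => //; apply: ltW.
have hH : (u m1 - u m) * gmean l (f (s m1)) (g (t m1)) <= (m1 - m) * tot.
  apply: le_trans (H_step m00 i4 m11) _.
  by rewrite !H_quantile // mulrBl.
have totE : tot = gmean l p q * (gmean l (f (s m)) (g (t m)) * u m).
  have [f0' s0' g0' t0'] := And4 (ltW f00) (ltW s00) (ltW g00) (ltW t00).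
  rewrite -pE -qE gmeanM ?(ltW p0) ?(ltW q0) ?(ltW fs) ?(ltW gt) //.
  by rewrite (gmeanM l f0' g0' s0' t0').
have g0 : 0 < gmean l (f (s m)) (g (t m)) by exact: gmean_gt0.
have pq0 : 0 < l * p + (1 - l) * q by rewrite addr_gt0 // mulr_gt0.
have du0 : 0 <= u m1 - u m by rewrite subr_ge0 ltW // u_incr // ltW.
have key : (1 - e) * ((m1 - m) * (l * p + (1 - l) * q)) * u m *
    ((1 - e) * gmean l (f (s m)) (g (t m))) <= (m1 - m) * tot.
  apply: le_trans hH; apply: ler_pM => //.
    by apply: mulr_ge0 (ltW u00); apply: mulr_ge0 => //; apply: mulr_ge0 (ltW dm) (ltW pq0).
  by rewrite mulr_ge0 // ltW.
have c0 : 0 < (m1 - m) * (gmean l (f (s m)) (g (t m)) * u m).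
  exact: mulr_gt0 dm (mulr_gt0 g0 u00).
rewrite -(ler_pM2r c0); move: key; rewrite totE.
set gg := gmean _ (f _) _; set pq := gmean _ p q; move=> key.
have -> : (1 - e) ^+ 2 * (l * p + (1 - l) * q) * ((m1 - m) * (gg * u m)) =
   (1 - e) * ((m1 - m) * (l * p + (1 - l) * q)) * u m * ((1 - e) * gg) by ring.
by apply: le_trans key _; rewrite le_eqVlt; apply/orP; left; apply/eqP; ring.
Qed.

Let quantile_ratio m : 0 < m -> m < 1 -> t m / s m = t 2^-1 / s 2^-1.
Proof.
have key x y : 0 < x -> x < y -> y < 1 -> t x / s x = t y / s y.
  move=> x0 xy y1; have y0 := lt_trans x0 xy; have x1 := lt_trans xy y1.
  have sx := quantile_gt0 PF QF x0 x1; have sy := quantile_gt0 PF QF y0 y1.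
  have tx := quantile_gt0 PG QG x0 x1; have ty := quantile_gt0 PG QG y0 y1.
  apply: ln_inj; rewrite ?posrE ?divr_gt0 // !ln_div ?posrE //.
  have h1 := quantile_ln_le PF PG QF QG speed x0 xy y1.
  have h2 := quantile_ln_le PG PF QG QF (fun m m0 m1 => esym (speed m0 m1)) x0 xy y1.
  lra.
have h0 : (0 : R) < 2^-1 by lra.
have h1 : (2^-1 : R) < 1 by lra.
move=> m0 m1; case: (ltgtP m 2^-1) => [hm|hm|->//]; first exact: key.
by apply/esym/key.
Qed.

(** Since the logarithmic derivatives agree, t is a constant multiple of s; the
    multiple is the ratio of the heights because the quantiles exhaust them. *)
Lemma line_equality_quantile :
  b / a = t 2^-1 / s 2^-1 /\
  forall x, 0 < x -> x < a ->
    G (b / a * x) = F x / F a * G b /\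
    H (gmean l x (b / a * x)) = F x / F a * tot.
Proof.
set d := t _ / s _.
have h0 : (0 : R) < 2^-1 by lra.
have h1 : (2^-1 : R) < 1 by lra.
have d0 : 0 < d by rewrite divr_gt0 ?(quantile_gt0 PF QF) ?(quantile_gt0 PG QG).
have a0 := profile_gt0 PF; have b0 := profile_gt0 PG.
have tE m : 0 < m -> m < 1 -> t m = d * s m.
  move=> m0 m1; have := quantile_ratio m0 m1; rewrite -/d => <-.
  rewrite divfK // lt0r_neq0 //; exact: (quantile_gt0 PF QF).
have dE : b / a = d.
  apply/eqP; rewrite eq_le; apply/andP; split.
    apply: le_of_shrink; first by rewrite divr_ge0 // ltW.
    move=> e e0 e1; have y0 : 0 < (1 - e) * b by rewrite mulr_gt0 // subr_gt0.
    have yb : (1 - e) * b < b by rewrite -[ltRHS]mul1r ltr_pM2r //; lra.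
    have [m0 m1 tm] := quantileK PG QG y0 yb.
    have := quantile_lt QF (ltW m0) m1; set m := _ / _ in m0 m1 tm *.
    rewrite mulrA ler_pdivrMr // -tm tE // => h.
    by rewrite ler_pM2l // ltW.
  apply: le_of_shrink; first exact: ltW.
  move=> e e0 e1; have y0 : 0 < (1 - e) * a by rewrite mulr_gt0 // subr_gt0.
  have ya : (1 - e) * a < a by rewrite -[ltRHS]mul1r ltr_pM2r //; lra.
  have [m0 m1 sm] := quantileK PF QF y0 ya.
  have := quantile_lt QG (ltW m0) m1; rewrite tE // sm => h.
  by rewrite ler_pdivlMr // ltW //; lra.
split => // x x0 xa; have [m0 m1 sm] := quantileK PF QF x0 xa.
rewrite dE; set m := F x / F a in m0 m1 sm *.
have tm : t m = d * x by rewrite tE // sm.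
by rewrite -tm -{1}sm (quantileE QG (ltW m0) m1) H_quantile.
Qed.

End with_quantiles.

(** The Prekopa-Leindler inequality for decreasing densities on a half-line, for
    geometric means of the heights: H is only required to grow at least as fast as
    the geometric means of the two densities. *)
Lemma line_inequality : tot <= top.
Proof.
have [s QF] := exists_quantile PF; have [t QG] := exists_quantile PG.
exact: (line_inequality_quantile QF QG).
Qed.

Lemma line_equality : top <= tot -> forall x, 0 < x -> x < a ->
  G (b / a * x) = F x / F a * G b /\
  H (gmean l x (b / a * x)) = F x / F a * tot.
Proof.
have [s QF] := exists_quantile PF; have [t QG] := exists_quantile PG.
by move=> /(line_equality_quantile QF QG)[].
Qed.

End prekopa_leindler_line.

(** * Unconditional convex bodies as solid bodies *)

Section solid_bodies.
Context (R : realType).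

Section one_dimension.
Context (n : nat).
Implicit Types (K L : set 'rV[R]_n) (x y : 'rV[R]_n).

Definition coord_closed K := forall x,
  (forall e : R, 0 < e -> exists2 y, K y & forall i, `|x 0 i - y 0 i| < e) -> K x.

(** The coordinatewise description of unconditional convex bodies.  All the bodies
    that occur below (slices, truncations, images, sections) are recognized by
    these five properties, and no topology is left in them. *)
Record solid_body K : Prop := SolidBody {
  solid_closed : coord_closed K;
  solid_bounded : exists M : R, forall x, K x -> forall i, `|x 0 i| <= M;
  solid_convex : forall x y (t : R), K x -> K y -> 0 <= t -> t <= 1 ->
    K (t *: x + (1 - t) *: y);
  solid_down : forall x y, K x -> (forall i, `|y 0 i| <= `|x 0 i|) -> K y;
  solid_cube : exists2 d : R, 0 < d & forall x, (forall i, `|x 0 i| <= d) -> K x }.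

Lemma closed_coordP K : closed K <-> coord_closed K.
Proof.
split=> [cK x h|cK x h].
  apply: cK => B /nbhs_ballP[e /= e0 eB].
  have [y Ky xy] := h _ e0; exists y; split => //; apply: eB; split => // i j.
  by rewrite (ord1 i); exact: xy.
apply: cK => e e0; have [y [Ky [_ xy]]] := h _ (nbhsx_ballx x e e0).
by exists y => // i; exact: xy.
Qed.

Lemma coord_le_norm x i : `|x 0 i| <= `|x|.
Proof.
rewrite [leRHS]/Num.norm /= mx_normrE; apply/bigmax_geP; right => /=.
by exists (ord0, i).
Qed.

Lemma convex_setP K : convex_set (K : set (convex_lmodType 'rV[R]_n)) <->
  (forall x y (t : R), K x -> K y -> 0 <= t -> t <= 1 -> K (t *: x + (1 - t) *: y)).
Proof.
split=> [cK x y t Kx Ky t0 t1|cK x y t /set_mem Kx /set_mem Ky].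
  pose T : {i01 R} := Itv01 t0 t1.
  by have /set_mem := cK x y T (mem_set Kx) (mem_set Ky).
apply: mem_set; exact: cK.
Qed.

Lemma reflect_coordK i : involutive (@reflect_coord R n i).
Proof.
move=> x; apply/rowP => j; rewrite !mxE; case: eqVneq => // _.
by rewrite opprK.
Qed.

Lemma unconditional_reflect K i x : unconditional K -> K x ->
  K (reflect_coord i x).
Proof. by move=> uK Kx; rewrite -(uK i); exists x. Qed.

(** A coordinate of a point may be replaced by any number of smaller absolute
    value, as this number is a convex combination of the coordinate and its
    opposite; the coordinates are replaced one after the other. *)
Lemma unconditional_down K : unconditional_convex_body K ->
  forall x y, K x -> (forall i, `|y 0 i| <= `|x 0 i|) -> K y.
Proof.
move=> [[_ /convex_setP cK _] uK] x y Kx yx.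
suff H m : (m <= n)%N ->
    K (\row_j (if (j < m)%N then y 0 j else x 0 j)).
  by have := H n (leqnn n); congr K; apply/rowP => j; rewrite mxE ltn_ord.
elim: m => [|m IH] mn.
  by move: Kx; congr K; apply/rowP => j; rewrite mxE.
have {IH}Kz := IH (ltnW mn); set z := (\row_j _) in Kz.
pose i := Ordinal mn.
have zi : z 0 i = x 0 i by rewrite mxE /= ltnn.
pose t := if x 0 i == 0 then 1 else (1 + y 0 i / x 0 i) / 2.
have yt : y 0 i = t * x 0 i + (1 - t) * - x 0 i.
  rewrite /t; case: eqVneq => [x0|x0].
    by move: (yx i); rewrite x0 normr0 normr_le0 => /eqP ->; ring.
  by field.
have t01 : 0 <= t <= 1.
  rewrite /t; case: eqVneq => [x0|x0]; first by rewrite ler01 lexx.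
  have : `|y 0 i / x 0 i| <= 1 by rewrite normf_div ler_pdivrMr ?normr_gt0 // mul1r.
  by rewrite ler_norml => /andP[h1 h2]; apply/andP; split; lra.
have /andP[t0 t1] := t01.
have := cK _ _ _ Kz (unconditional_reflect i uK Kz) t0 t1.
congr K; apply/rowP => j; rewrite !mxE.
have [->|ji] := eqVneq j i; first by rewrite /= ltnn ltnSn yt.
have -> : (j < m.+1)%N = (j < m)%N.
  rewrite ltnS leq_eqVlt; case: eqP => // e; case/eqP: ji; exact: val_inj.
by rewrite -mulrDl subrKC mul1r.
Qed.

Lemma solid_bodyP K : unconditional_convex_body K <-> solid_body K.
Proof.
split=> [uK|[clK [M bK] cK dK [d d0 qK]]].
  have dK := unconditional_down uK.
  have [[cK /convex_setP vK [p /nbhs_ballP[e /= e0 pe]]] _] := uK.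
  split => //.
  - apply/closed_coordP; apply: compact_closed => //; exact: norm_hausdorff.
  - have [M [_ hM]] := compact_bounded cK.
    exists (M + 1) => x Kx i; apply: le_trans (coord_le_norm x i) _.
    by apply: hM => //; rewrite ltrDl.
  - exists (e / 2); first by rewrite divr_gt0.
    move=> x xe.
    pose q : 'rV[R]_n := \row_i (if 0 <= p 0 i then p 0 i + e / 2 else p 0 i - e / 2).
    have Kq : K q.
      apply: pe; split => // i j; rewrite (ord1 i) /ball /= mxE.
      have e2 : e / 2 < e by lra.
      have e20 : 0 <= e / 2 by lra.
      by case: ifP => _; rewrite ?opprD ?opprB addrA subrr ?add0r ?sub0r ?normrN ger0_norm.
    apply: dK Kq _ => i; apply: le_trans (xe i) _; rewrite mxE.
    case: ifP => [p0|/negbT]; first by rewrite ger0_norm; lra.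
    by rewrite -ltNge => p0; rewrite ltr0_norm; lra.
split; first split.
- apply: bounded_closed_compact; last exact/closed_coordP.
  exists `|M|; split => // r Mr x Kx.
  suff : mx_norm x <= r by []; rewrite mx_normrE; apply/bigmax_leP; split => /=.
    by apply: le_trans (ltW Mr).
  move=> [i j] _ /=; rewrite (ord1 i); apply: le_trans (bK _ Kx j) _.
  by apply: le_trans (ler_norm _) (ltW Mr).
- exact/convex_setP.
- exists 0; apply/nbhs_ballP; exists d => //= x [_ hx]; apply: qK => i.
  by have := hx 0 i; rewrite /ball /= mxE sub0r normrN => /ltW.
- move=> i; apply/seteqP; split => [_ [x Kx <-]|x Kx].
    by apply: dK Kx _ => j; rewrite mxE; case: ifP => // _; rewrite normrN.
  exists (reflect_coord i x); last exact: reflect_coordK.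
  by apply: dK Kx _ => j; rewrite mxE; case: ifP => // _; rewrite normrN.
Qed.

Lemma solid0 K : solid_body K -> K 0.
Proof.
by move=> [_ _ _ _ [d d0 qK]]; apply: qK => i; rewrite mxE normr0 ltW.
Qed.

Lemma solid_scale K x (t : R) : solid_body K -> K x -> 0 <= t -> t <= 1 -> K (t *: x).
Proof.
move=> sK Kx t0 t1; apply: (solid_down sK Kx) => i; rewrite mxE normrM.
by rewrite ger0_norm // ler_piMl.
Qed.

Lemma solid_positive_bound K : solid_body K ->
  exists2 M : R, 0 < M & forall x, K x -> forall i, `|x 0 i| <= M.
Proof.
move=> [_ [M hM] _ _ _]; exists (`|M| + 1); first by rewrite ltr_wpDl.
by move=> x Kx i; apply: le_trans (hM _ Kx i) _; have := ler_norm M; lra.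
Qed.

(** The convex hull of a point and a cube contains a smaller cube around every point
    of the open segment from the centre of the cube to the point. *)
Lemma solid_midcube K x (d t : R) : solid_body K -> K x -> 0 < t -> t < 1 ->
  (forall y, (forall i, `|y 0 i| <= d) -> K y) ->
  forall y, (forall i, `|y 0 i - (1 - t) * x 0 i| <= t * d) -> K y.
Proof.
move=> sK Kx t0 t1 qK y hy.
have -> : y = (1 - t) *: x + (1 - (1 - t)) *: (t^-1 *: (y - (1 - t) *: x)).
  rewrite subKr scalerA divff ?lt0r_neq0 // scale1r.
  by rewrite addrC subrK.
apply: (solid_convex sK) => //; [|lra|lra].
apply: qK => i; rewrite !mxE normrM normfV (gtr0_norm t0).
by rewrite ler_pdivrMl.
Qed.

Definition cut_coord (i : 'I_n) (r : R) K : set 'rV[R]_n :=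
  [set x | K x /\ `|x 0 i| <= r].

Lemma solid_cut K i r : solid_body K -> 0 < r -> solid_body (cut_coord i r K).
Proof.
move=> sK r0; have [clK [M bK] cK dK [d d0 qK]] := sK; split.
- move=> x h; split.
    by apply: clK => e e0; have [y [Ky _] yx] := h _ e0; exists y.
  apply/ler_addgt0Pr => e e0; have [y [_ yr] yx] := h _ e0.
  have := ler_normD (x 0 i - y 0 i) (y 0 i); rewrite subrK.
  have := yx i; lra.
- by exists M => x [Kx _]; exact: bK.
- move=> x y t [Kx xr] [Ky yr] t0 t1; split; first exact: cK.
  rewrite !mxE; apply: le_trans (ler_normD _ _) _.
  rewrite !normrM (ger0_norm t0) (@ger0_norm _ (1 - t)) ?subr_ge0 //.
  have t1' : 0 <= 1 - t by lra.
  have := ler_wpM2l t0 xr; have := ler_wpM2l t1' yr; lra.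
- move=> x y [Kx xr] yx; split; first exact: dK Kx yx.
  exact: le_trans (yx i) xr.
- exists (Order.min d r); first by rewrite lt_min d0.
  move=> x hx; split.
    by apply: qK => j; apply: le_trans (hx j) _; rewrite ge_min lexx.
  by apply: le_trans (hx i) _; rewrite ge_min lexx orbT.
Qed.

End one_dimension.

(** Coordinate permutations, diagonal maps, and extension by 0, with one formula for
    all three. *)
Definition monomial_map (m n : nat) (d : 'I_n -> R) (sg : 'I_n -> option 'I_m)
    (x : 'rV[R]_m) : 'rV[R]_n :=
  \row_i (d i * (if sg i is Some j then x 0 j else 0)).

Lemma solid_preimage m n (d : 'I_n -> R) (sg : 'I_n -> option 'I_m)
    (K : set 'rV[R]_n) : (forall i, 0 < d i) ->
  (forall j, exists i, sg i = Some j) ->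
  solid_body K -> solid_body [set x | K (monomial_map d sg x)].
Proof.
move=> d0 sgS sK; have [clK [M bK] cK dK [q q0 qK]] := sK; split.
- move=> x h; apply: clK => e e0.
  pose D := \big[Order.max/1]_i d i.
  have D0 : 0 < D by apply: (@lt_le_trans _ _ 1) => //; exact: bigmax_ge_id.
  have eD0 : 0 < e / D by rewrite divr_gt0.
  have [y Ky xy] := h _ eD0; exists (monomial_map d sg y) => // i.
  rewrite !mxE -mulrBr normrM (gtr0_norm (d0 i)).
  case: (sg i) => [j|]; last by rewrite subrr normr0 mulr0.
  have dD : d i <= D by exact: le_bigmax.
  apply: (@le_lt_trans _ _ (D * `|x 0 j - y 0 j|)); first by rewrite ler_wpM2r.
  by rewrite mulrC -ltr_pdivlMr.
- exists (M * \big[Order.max/1]_i (d i)^-1) => x Kx j; have [i si] := sgS j.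
  have := bK _ Kx i; rewrite mxE si normrM (gtr0_norm (d0 i)) => h.
  have hM : 0 <= M by apply: le_trans h; rewrite mulr_ge0 // ltW.
  have -> : `|x 0 j| = d i * `|x 0 j| * (d i)^-1 by field; apply: lt0r_neq0.
  apply: ler_pM => //; first by rewrite mulr_ge0 // ltW.
    by rewrite invr_ge0 ltW.
  exact: (le_bigmax _ (fun i => (d i)^-1)).
- move=> x y t Kx Ky t0 t1; rewrite /mkset.
  have -> : monomial_map d sg (t *: x + (1 - t) *: y) =
      t *: monomial_map d sg x + (1 - t) *: monomial_map d sg y.
    by apply/rowP => i; rewrite !mxE; case: (sg i) => [j|]; rewrite ?mxE; ring.
  exact: cK.
- move=> x y Kx yx; apply: dK Kx _ => i; rewrite !mxE !normrM ler_wpM2l //.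
  by case: (sg i).
- pose D := \big[Order.max/1]_i d i.
  have D0 : 0 < D by apply: (@lt_le_trans _ _ 1) => //; exact: bigmax_ge_id.
  exists (q / D); first by rewrite divr_gt0.
  move=> x hx; apply: qK => i; rewrite !mxE normrM (gtr0_norm (d0 i)).
  have dD : d i <= D by exact: le_bigmax.
  case: (sg i) => [j|]; last by rewrite normr0 mulr0 ltW.
  apply: (@le_trans _ _ (D * `|x 0 j|)); first by rewrite ler_wpM2r.
  by rewrite mulrC -ler_pdivlMr.
Qed.

End solid_bodies.

(** * Lebesgue measure on tuples *)

Section lebesgue_facts.
Context (R : realType).
Local Notation borelR := (measurableTypeR R).

Definition row_of_tuple n (t : n.-tuple R) : 'rV[R]_n := \row_i tnth t i.

Definition tuple_measurable n (A : set 'rV[R]_n) : Prop :=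
  measurable ([set t | A (row_of_tuple t)] : set (n.-tuple borelR)).

Lemma measurable_box n (F : 'I_n -> set borelR) : (forall i, measurable (F i)) ->
  measurable ([set t | forall i, F i (tnth t i)] : set (n.-tuple borelR)).
Proof.
move=> mF; rewrite [X in measurable X](_ : _ =
    \bigcap_(i in [set: 'I_n]) ((@tnth n borelR)^~ i @^-1` F i)).
  apply: fin_bigcap_measurable => // i _.
  by rewrite -[X in measurable X]setTI; exact: measurable_tnth.
by apply/seteqP; split => t H i; [move=> _|]; apply: H.
Qed.

(** The complement of a closed set is the union of the boxes with rational centre
    and radius that it contains. *)
Lemma tuple_measurable_closed n (A : set 'rV[R]_n) :
  coord_closed A -> tuple_measurable A.
Proof.
move=> cA; rewrite /tuple_measurable -[X in measurable X]setCK; apply: measurableC.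
pose box (p : 'rV[rat]_n * rat) : set (n.-tuple borelR) :=
  [set t | forall i, `](ratr (p.1 0 i) - ratr p.2), (ratr (p.1 0 i) + ratr p.2)[%classic
     (tnth t i)].
pose D (p : 'rV[rat]_n * rat) : set (n.-tuple borelR) :=
  if `[< box p `<=` ~` [set t | A (row_of_tuple t)] >] then box p else set0.
rewrite [X in measurable X](_ : _ = \bigcup_p D p); last first.
  apply/seteqP; split => [t At|t [p _]]; last first.
    by rewrite /D; case: asboolP => // h; exact: h.
  have [e e0 he] : exists2 e : R, 0 < e &
      forall y, A y -> exists i, e <= `|row_of_tuple t 0 i - y 0 i|.
    apply: contrapT => h; apply: At; apply: cA => e e0.
    apply: contrapT => h2; apply: h; exists e => // y Ay.
    apply: contrapT => h3; apply: h2; exists y => // i; rewrite ltNge.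
    by apply/negP => h4; apply: h3; exists i.
  have [r re] : exists r : rat, 0 < (ratr r : R) < e / 2.
    have /rat_in_itvoo[r] : 0 < e / 2 by rewrite divr_gt0.
    by rewrite in_itv /= => h; exists r.
  have /andP[r0 r1] := re.
  have /choice[c hc] : forall i, exists c : rat,
      tnth t i - ratr r < ratr c < tnth t i + ratr r.
    move=> i; have /rat_in_itvoo[c] : tnth t i - ratr r < tnth t i + ratr r :> R by lra.
    by rewrite in_itv /= => h; exists c.
  exists (\row_i c i, r) => //.
  have bt : box (\row_i c i, r) t.
    by move=> i /=; rewrite mxE in_itv /=; have /andP[h1 h2] := hc i; apply/andP; split; lra.
  rewrite /D; case: asboolP => // -[]; rewrite -/box => t' bt' At'.
  have [i] := he _ At'; rewrite !mxE leNgt => /negP; apply.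
  have := bt' i; rewrite /= mxE in_itv /= => /andP[h1 h2].
  have /andP[h3 h4] := hc i.
  by rewrite ltr_norml; apply/andP; split; lra.
apply: countable_bigcupT_measurable; first exact: countableP.
move=> p; rewrite /D; case: ifP => _; last exact: measurable0.
apply: (@measurable_box n (fun i =>
  `](ratr (p.1 0 i) - ratr p.2), (ratr (p.1 0 i) + ratr p.2)[%classic)) => i.
exact: measurable_itv.
Qed.

(** The proof that f is measurable is an argument, so that the image measure can be
    named without declaring a new instance for every f. *)
Definition scaled_image_measure d1 d2 (T1 : measurableType d1)
    (T2 : measurableType d2) (m : {measure set T1 -> \bar R}) (f : T1 -> T2)
    (mf : measurable_fun setT f) (r : {nonneg R}) : {measure set T2 -> \bar R} :=
  mscale r
    (measure_function_pushforward__canonical__measure_function_Measure m mf).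

Lemma lebesgue_measure_scale (d : R) (B : set borelR) : 0 < d -> measurable B ->
  (d%:E * lebesgue_measure [set s | B (d * s)%R] = lebesgue_measure B)%E.
Proof.
move=> d0 mB; apply/esym.
have mf : measurable_fun setT ( *%R d : borelR -> borelR).
  exact: mulrl_measurable.
have : forall A, measurable A -> lebesgue_measure A =
    scaled_image_measure lebesgue_measure mf (NngNum (ltW d0)) A.
  apply: lebesgue_measure_unique => //= _ [[a b] _ <-] /=.
  rewrite /mscale /= /pushforward /=.
  have -> : *%R d @^-1` `]a, b] = `](a / d), (b / d)]%classic.
    apply/seteqP; split => x /=; rewrite !in_itv /= ltr_pdivrMr // ler_pdivlMr //;
    by rewrite [d * x]mulrC.
  rewrite !lebesgue_measure_itv /= !lte_fin ltr_pM2r ?invr_gt0 //.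
  case: ifP => _; last by rewrite mule0.
  by rewrite !EFinN -!EFinB -EFinM; congr EFin; field; apply: lt0r_neq0.
by move=> ->.
Qed.

(** The boxes are stable under intersection and generate the product
    sigma-algebra. *)
Lemma lebesgue_tuple_unique n (mu : {measure set (n.-tuple borelR) -> \bar R}) :
  (forall F : nat -> set borelR, (forall i, measurable (F i)) ->
    mu [set t | forall i : 'I_n, F i (tnth t i)] = (\prod_(i < n) lebesgue_measure (F i))%E) ->
  forall B, measurable B -> lebesgue_tuple R n B = mu B.
Proof.
move=> h.
pose C : set (set (n.-tuple borelR)) :=
  [set A | exists F : nat -> set borelR, (forall i, measurable (F i)) /\
    A = [set t | forall i : 'I_n, F i (tnth t i)]].
pose I (k : nat) : set borelR := `](- k%:R), k%:R]%classic.
pose g (k : nat) : set (n.-tuple borelR) :=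
  [set t | forall i : 'I_n, I k (tnth t i)].
have mI (F : nat -> set borelR) : (forall i, measurable (F i)) ->
    measurable ([set t | forall i : 'I_n, F i (tnth t i)] : set (n.-tuple borelR)).
  by move=> mF; exact: (@measurable_box n (fun i => F i)).
apply: (measure_unique C g).
- apply/seteqP; split.
    apply: smallest_sub; first exact: smallest_sigma_algebra.
    rewrite -bigcup_seq => A [i _ [B mB <-]]; apply: sub_sigma_algebra.
    exists (fun k : nat => if k == i :> nat then B else setT); split.
      by move=> k; case: ifP.
    apply/seteqP; split => t /=; first by move=> [_ Bt] j; case: eqP => // /val_inj ->.
    by move/(_ i); rewrite eqxx.
  apply: smallest_sub; first exact: sigma_algebra_measurable.
  by move=> _ [F [mF ->]]; exact: mI.
- move=> _ _ [F [mF ->]] [G [mG ->]]; exists (fun i => F i `&` G i); split.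
    by move=> i; exact: measurableI.
  apply/seteqP; split => t /=; first by move=> [h1 h2] i; split.
  by move=> h1; split => i; have [] := h1 i.
- move=> k; exists (fun _ => I k); split => // _; exact: measurable_itv.
- apply/seteqP; split => // t _.
  pose M := \big[Order.max/0]_i `|tnth t i|.
  have M0 : 0 <= M by exact: bigmax_ge_id.
  exists (Num.trunc M).+1 => // i; rewrite /I /= in_itv /=.
  have h1 : `|tnth t i| <= M by exact: (le_bigmax _ (fun i => `|tnth t i|)).
  have h2 := truncnS_gt M.
  have := le_lt_trans h1 h2; rewrite ltr_norml => /andP[-> /ltW ->] //.
- by move=> _ [F [mF ->]]; rewrite h //; exact: lebesgue_tuple_box.
- move=> k; suff : (lebesgue_tuple R n (g k) < +oo)%E by [].
  have -> : lebesgue_tuple R n (g k) =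
      (\prod_(i < n) lebesgue_measure (I k))%E.
    by apply: (@lebesgue_tuple_box R n (fun _ => I k)) => _; exact: measurable_itv.
  have [c ->] : exists c : R, lebesgue_measure (I k) = c%:E.
    rewrite /I lebesgue_measure_itv /= lte_fin; case: ifP => _; last by exists 0.
    by exists (k%:R - - k%:R); rewrite EFinB.
  by rewrite prodEFin ltry.
Qed.

End lebesgue_facts.

(** * Volumes of images and of slabs *)

Section volume_facts.
Context (R : realType).
Local Notation borelR := (measurableTypeR R).
Local Notation mu := (@lebesgue_measure R).

Lemma volumeE n (A : set 'rV[R]_n) :
  volume A = lebesgue_tuple R n [set t | A (row_of_tuple t)].
Proof. by []. Qed.

Lemma volume_ge0 n (A : set 'rV[R]_n) : (0 <= volume A)%E.
Proof. exact: measure_ge0. Qed.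

Lemma le_volume n (A B : set 'rV[R]_n) : tuple_measurable A -> tuple_measurable B ->
  A `<=` B -> (volume A <= volume B)%E.
Proof.
by move=> mA mB AB; apply: le_measure; rewrite ?inE // => t; exact: AB.
Qed.

Lemma volume_split n (A B : set 'rV[R]_n) : tuple_measurable A -> tuple_measurable B ->
  volume A = (volume (A `\` B) + volume (A `&` B))%E.
Proof. move=> mA mB; exact: (measureDI (lebesgue_tuple R n) mA mB). Qed.

(** Both sides are measures of A, and they agree on boxes. *)
Lemma volume_monomial n (d : 'I_n -> R) (s : {perm 'I_n}) (A : set 'rV[R]_n) :
  (forall i, 0 < d i) -> tuple_measurable A ->
  ((\prod_i d i)%:E * volume [set x | A (monomial_map d (fun i => Some (s i)) x)]
     = volume A)%E.
Proof.
move=> d0 mA.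
pose phi (t : n.-tuple borelR) : n.-tuple borelR := [tuple d i * tnth t (s i) | i < n].
have mphi : measurable_fun setT phi.
  apply/measurable_fun_tnthP => i.
  have -> : (tnth (T:=borelR))^~ i \o phi = *%R (d i) \o (tnth (T:=borelR))^~ (s i).
    by apply/funext => t /=; rewrite tnth_mktuple.
  apply: (@measurableT_comp _ _ _ _ borelR borelR ( *%R (d i))).
    exact: mulrl_measurable.
  exact: measurable_tnth.
have D0 : 0 <= \prod_i d i by apply: prodr_ge0 => i _; exact: ltW.
have := @lebesgue_tuple_unique R n
  (scaled_image_measure (lebesgue_tuple R n) mphi (NngNum D0)).
rewrite [RHS]volumeE => -> //.
  rewrite /scaled_image_measure /= /mscale /= /pushforward; congr (_ * _)%E.
  rewrite volumeE; congr (lebesgue_tuple R n _).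
  have E t : monomial_map d (fun i => Some (s i)) (row_of_tuple t) = row_of_tuple (phi t).
    by apply/rowP => i; rewrite !mxE tnth_mktuple.
  by apply/seteqP; split => t; rewrite /preimage /mkset E.
move=> F mF; rewrite /= /mscale /= /pushforward.
pose G (k : nat) : set borelR :=
  if insub k is Some j then
    [set r | F ((s^-1)%g j) (d ((s^-1)%g j) * r)] else setT.
have mG k : measurable (G k).
  rewrite /G; case: insub => // j.
  rewrite -[X in measurable X]setTI.
  exact: (@mulrl_measurable R setT (d ((s^-1)%g j)) measurableT _ (mF _)).
have -> : phi @^-1` [set t | forall i : 'I_n, F i (tnth t i)] =
    [set t | forall i : 'I_n, G i (tnth t i)].
  apply/seteqP; split => t /= h i.
    rewrite /G valK; have := h ((s^-1)%g i).
    by rewrite tnth_mktuple permKV.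
  by have := h (s i); rewrite /G valK permK tnth_mktuple.
have -> : lebesgue_tuple R n [set t | forall i : 'I_n, G i (tnth t i)] =
    (\prod_(i < n) mu (G i))%E by exact: lebesgue_tuple_box.
rewrite -prodEFin [X in (_ * X)%E](reindex_inj (@perm_inj _ s)) /= -big_split /=.
apply: eq_bigr => i _; rewrite /G valK permK.
exact: lebesgue_measure_scale.
Qed.

Definition row_cons n (r : R) (y : 'rV[R]_n) : 'rV[R]_n.+1 :=
  \row_i (if unlift ord0 i is Some j then y 0 j else r).

Definition slice n (A : set 'rV[R]_n.+1) (r : R) : set 'rV[R]_n :=
  [set y | A (row_cons r y)].

Lemma row_cons0 n r (y : 'rV[R]_n) : row_cons r y 0 ord0 = r.
Proof. by rewrite mxE unlift_none. Qed.

Lemma row_consS n r (y : 'rV[R]_n) i : row_cons r y 0 (lift ord0 i) = y 0 i.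
Proof. by rewrite mxE liftK. Qed.

Let pair_set n (A : set 'rV[R]_n.+1) : set (borelR * n.-tuple borelR) :=
  [set p | A (row_cons p.1 (row_of_tuple p.2))].

Let row_of_tuple_cons n (p : borelR * n.-tuple borelR) :
  row_of_tuple (tuple_of_pair p) = row_cons p.1 (row_of_tuple p.2).
Proof.
apply/rowP => i; case: (unliftP ord0 i) => [j ->|->].
  by rewrite row_consS !mxE /tuple_of_pair tnthS.
by rewrite row_cons0 !mxE.
Qed.

Let measurable_pair_set n (A : set 'rV[R]_n.+1) : tuple_measurable A ->
  measurable (pair_set A).
Proof.
move=> mA; have := @measurable_tuple_of_pair R n measurableT _ mA.
rewrite setTI; congr measurable.
by apply/seteqP; split => p /=; rewrite row_of_tuple_cons.
Qed.

Let xsection_pair n (A : set 'rV[R]_n.+1) r :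
  xsection (pair_set A) r = [set t | slice A r (row_of_tuple t)].
Proof.
by apply/seteqP; split => t; [move=> /set_mem|move=> h; apply/mem_set].
Qed.

Lemma slice_measurable n (A : set 'rV[R]_n.+1) r :
  tuple_measurable A -> tuple_measurable (slice A r).
Proof.
move=> mA; rewrite /tuple_measurable -(xsection_pair A r).
by apply: measurable_xsection; exact: measurable_pair_set.
Qed.

Lemma slice_measurable_fun n (A : set 'rV[R]_n.+1) (D : set borelR) :
  tuple_measurable A -> measurable D ->
  measurable_fun D ((fun r => volume (slice A r)) : borelR -> \bar R).
Proof.
move=> mA mD; apply: (@measurable_funS _ _ _ _ setT) => //.
have := measurable_fun_xsection (lebesgue_tuple R n) (measurable_pair_set mA).
by apply: eq_measurable_fun => r _ /=; rewrite xsection_pair.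
Qed.

(** Lebesgue measure in dimension n + 1 is the product of Lebesgue measure on the
    line with Lebesgue measure in dimension n: this is Fubini's theorem for the
    first coordinate. *)
Lemma volume_slices n (A : set 'rV[R]_n.+1) :
  volume A = (\int[mu]_r volume (slice A r))%E.
Proof.
rewrite volumeE /= /lebesgue_tuple_step /pushforward /product_measure1.
apply: eq_integral => r _ /=; rewrite volumeE -xsection_pair.
congr (lebesgue_tuple R n _).
by apply/seteqP; split => t; rewrite /xsection /= !inE /= row_of_tuple_cons.
Qed.

Definition slab n (A : set 'rV[R]_n.+1) (E : set R) : set 'rV[R]_n.+1 :=
  [set x | A x /\ E (x 0 ord0)].

Lemma volume_slab n (A : set 'rV[R]_n.+1) (E : set borelR) :
  volume (slab A E) = (\int[mu]_(r in E) volume (slice A r))%E.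
Proof.
rewrite volume_slices [RHS]integral_mkcond; apply: eq_integral => r _.
rewrite patchE; case: (boolP (r \in E)) => [/set_mem|/negP] rE.
  congr volume; apply/seteqP; split => y; rewrite /slice /slab /= row_cons0 //.
  by case.
rewrite (_ : slice _ _ = set0) ?/volume ?measure0 //.
rewrite /slice /slab /= -subset0 => y /=; rewrite row_cons0 => -[_ Er].
by apply: rE; exact/mem_set.
Qed.

Definition annulus (u v : R) : set R := [set r | u < `|r| <= v].

Lemma annulusE u v : 0 <= u -> annulus u v = `]u, v] `|` `[(- v), (- u)[.
Proof.
move=> u0; apply/seteqP; split => r; rewrite /annulus /= !in_itv /=.
  move=> /andP[h1 h2]; case: (leP 0 r) => r0.
    by left; rewrite -{1}(ger0_norm r0) h1 -(ger0_norm r0).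
  right; move: h1 h2; rewrite (ltr0_norm r0) => h1 h2; apply/andP; split; lra.
case=> /andP[h1 h2].
  have r0 : 0 <= r by lra.
  by rewrite (ger0_norm r0) h1.
have r0 : r <= 0 by lra.
by rewrite (ler0_norm r0); apply/andP; split; lra.
Qed.

Lemma measurable_annulus u v : 0 <= u -> measurable (annulus u v : set borelR).
Proof.
move=> u0; rewrite annulusE //; apply: measurableU; exact: measurable_itv.
Qed.

Lemma lebesgue_measure_annulus (u v : R) : 0 <= u -> u < v ->
  mu (annulus u v) = (2 * (v - u))%:E.
Proof.
move=> u0 uv; rewrite annulusE //.
pose I : set borelR := `]u, v]%classic; pose J : set borelR := `[(- v), (- u)[%classic.
have -> : mu (I `|` J) = (mu I + mu J)%E.
  apply: measureU; [exact: measurable_itv|exact: measurable_itv|].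
  apply/seteqP; split => // r; rewrite /I /J /= !in_itv /= => -[/andP[h1 h2] /andP[h3 h4]].
  lra.
rewrite /I /J !lebesgue_measure_itv /= !lte_fin uv ltrN2 uv -!EFinD.
by congr EFin; ring.
Qed.

Lemma slab_volume_lb n (A : set 'rV[R]_n.+1) u v (c : R) :
  tuple_measurable A -> 0 <= u -> u < v -> 0 <= c ->
  (forall r, u < `|r| -> `|r| <= v -> (c%:E <= volume (slice A r))%E) ->
  ((2 * (v - u) * c)%:E <= volume (slab A (annulus u v)))%E.
Proof.
move=> mA u0 uv c0 h; rewrite volume_slab.
have mE := measurable_annulus v u0.
rewrite mulrC EFinM -lebesgue_measure_annulus // -integral_cst //.
apply: ge0_le_integral => //.
  exact: slice_measurable_fun.
by move=> r /andP[r1 r2]; exact: h.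
Qed.

Lemma slab_volume_ub n (A : set 'rV[R]_n.+1) u v (c : R) :
  tuple_measurable A -> 0 <= u -> u < v -> 0 <= c ->
  (forall r, u < `|r| -> `|r| <= v -> (volume (slice A r) <= c%:E)%E) ->
  (volume (slab A (annulus u v)) <= (2 * (v - u) * c)%:E)%E.
Proof.
move=> mA u0 uv c0 h; rewrite volume_slab.
have mE := measurable_annulus v u0.
rewrite mulrC EFinM -lebesgue_measure_annulus // -integral_cst //.
apply: ge0_le_integral => //.
  exact: slice_measurable_fun.
by move=> r /andP[r1 r2]; exact: h.
Qed.

Lemma slab_volume0 n (A : set 'rV[R]_n.+1) : volume (slab A [set 0]) = 0%E.
Proof. by rewrite volume_slab integral_set1. Qed.

Definition box n (c : 'rV[R]_n) (w : 'I_n -> R) : set 'rV[R]_n :=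
  [set x | forall i, `|x 0 i - c 0 i| <= w i].

Lemma box_sidesP n (c : 'rV[R]_n) (w : 'I_n -> R) (F : nat -> set borelR) :
  (forall i : 'I_n, F i = `[(c 0 i - w i), (c 0 i + w i)]%classic) ->
  [set t | box c w (row_of_tuple t)] = [set t | forall i : 'I_n, F i (tnth t i)].
Proof.
move=> FE; apply/seteqP; split => t /= h i; have := h i;
by rewrite FE /= !mxE in_itv /= ler_distl.
Qed.

Let side n (c : 'rV[R]_n) (w : 'I_n -> R) (k : nat) : set borelR :=
  if insub k is Some j then `[(c 0 j - w j), (c 0 j + w j)]%classic else setT.

Let side_measurable n (c : 'rV[R]_n) (w : 'I_n -> R) k : measurable (side c w k).
Proof. by rewrite /side; case: insub => // j; exact: measurable_itv. Qed.

Let sideE n (c : 'rV[R]_n) (w : 'I_n -> R) (i : 'I_n) :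
  side c w i = `[(c 0 i - w i), (c 0 i + w i)]%classic.
Proof. by rewrite /side valK. Qed.

Lemma tuple_measurable_box n (c : 'rV[R]_n) (w : 'I_n -> R) :
  tuple_measurable (box c w).
Proof.
rewrite /tuple_measurable (box_sidesP (sideE c w)).
exact: (@measurable_box R n (fun i => side c w i) (fun i => side_measurable c w i)).
Qed.

Lemma volume_box n (c : 'rV[R]_n) (w : 'I_n -> R) : (forall i, 0 <= w i) ->
  volume (box c w) = (\prod_i (2 * w i))%:E.
Proof.
move=> w0; rewrite volumeE (box_sidesP (sideE c w)).
have -> : lebesgue_tuple R n [set t | forall i : 'I_n, side c w i (tnth t i)] =
    (\prod_(i < n) mu (side c w i))%E.
  by apply: lebesgue_tuple_box => i; exact: side_measurable.
rewrite -prodEFin; apply: eq_bigr => i _; rewrite sideE lebesgue_measure_itv /= lte_fin.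
case: ifP => [_|/negbT]; first by rewrite -EFinD; congr EFin; ring.
rewrite -leNgt => h; have -> : w i = 0 by have := w0 i; lra.
by rewrite mulr0.
Qed.

End volume_facts.

(** * Slices and truncations of solid bodies *)

Section body_volume.
Context (R : realType).

Definition vol n (A : set 'rV[R]_n) : R := fine (volume A).

Definition coord_bounded n (A : set 'rV[R]_n) :=
  exists M : R, forall x, A x -> forall i, `|x 0 i| <= M.

Lemma bounded_volume n (A : set 'rV[R]_n) : tuple_measurable A -> coord_bounded A ->
  volume A = (vol A)%:E.
Proof.
move=> mA [M hM]; rewrite /vol fineK // ge0_fin_numE ?volume_ge0 //.
apply: (@le_lt_trans _ _ (volume (box 0 (fun _ : 'I_n => `|M|)))).
  apply: le_volume => //; first exact: tuple_measurable_box.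
  by move=> x Ax i; rewrite mxE subr0; apply: le_trans (hM _ Ax i) (ler_norm _).
by rewrite volume_box ?ltry.
Qed.

Lemma vol_ge0 n (A : set 'rV[R]_n) : 0 <= vol A.
Proof. exact/fine_ge0/volume_ge0. Qed.

Lemma solid_measurable n (K : set 'rV[R]_n) : solid_body K -> tuple_measurable K.
Proof. by move=> sK; apply: tuple_measurable_closed; exact: solid_closed sK. Qed.

Lemma solid_volume n (K : set 'rV[R]_n) : solid_body K -> volume K = (vol K)%:E.
Proof.
by move=> sK; apply: bounded_volume; [exact: solid_measurable|exact: solid_bounded sK].
Qed.

Lemma solid_vol_gt0 n (K : set 'rV[R]_n) : solid_body K -> 0 < vol K.
Proof.
move=> sK; have [d d0 qK] := solid_cube sK.
rewrite -lte_fin -solid_volume //.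
apply: (@lt_le_trans _ _ (volume (box 0 (fun _ : 'I_n => d)))).
  rewrite volume_box ?lte_fin; last by move=> _; exact: ltW.
  by apply: prodr_gt0 => i _; rewrite mulr_gt0.
apply: le_volume; [exact: tuple_measurable_box|exact: solid_measurable|].
by move=> x hx; apply: qK => i; have := hx i; rewrite mxE subr0.
Qed.

Lemma cut_measurable n (A : set 'rV[R]_n) i r :
  tuple_measurable A -> tuple_measurable (cut_coord i r A).
Proof.
move=> mA.
have mE : tuple_measurable [set x : 'rV[R]_n | `|x 0 i| <= r].
  apply: tuple_measurable_closed => x h; apply/ler_addgt0Pr => e e0.
  have [y /= yr yx] := h _ e0.
  have := ler_normD (x 0 i - y 0 i) (y 0 i); rewrite subrK.
  have := yx i; lra.
by have := measurableI _ _ mA mE; congr measurable.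
Qed.

Definition half_axis n (K : set 'rV[R]_n) (i : 'I_n) (a : R) : Prop :=
  0 < a /\ forall s, 0 <= s -> (K (s *: delta_mx 0 i) <-> s <= a).

Lemma axisE n (i : 'I_n) (s : R) j :
  (s *: delta_mx 0 i : 'rV[R]_n) 0 j = s * (j == i)%:R.
Proof. by rewrite !mxE eqxx. Qed.

Lemma axis_of_cube n (K : set 'rV[R]_n) i (d : R) : 0 < d ->
  (forall x : 'rV[R]_n, (forall j, `|x 0 j| <= d) -> K x) -> K (d *: delta_mx 0 i).
Proof.
move=> d0 qK; apply: qK => j; rewrite axisE normrM gtr0_norm // ler_piMr ?(ltW d0) //.
by case: eqP => _; rewrite ?normr1 ?normr0.
Qed.

Lemma half_axis_ge n (K : set 'rV[R]_n) i a (d : R) : half_axis K i a -> 0 < d ->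
  (forall x : 'rV[R]_n, (forall j, `|x 0 j| <= d) -> K x) -> d <= a.
Proof. by move=> [_ hE] d0 qK; apply/hE; [exact: ltW|exact: axis_of_cube]. Qed.

Lemma exists_half_axis n (K : set 'rV[R]_n) i : solid_body K -> exists a, half_axis K i a.
Proof.
move=> sK; have [clK [M bK] _ dK [d d0 qK]] := sK.
pose E := [set s : R | 0 <= s /\ K (s *: delta_mx 0 i)].
have Ed : E d by split; [exact: ltW|exact: axis_of_cube].
have supE : has_sup E.
  split; [by exists d|exists M => s [s0 Ks]].
  by have := bK _ Ks i; rewrite axisE eqxx mulr1 ger0_norm.
have da : d <= sup E by apply: ub_le_sup Ed; case: supE.
exists (sup E); split; first exact: lt_le_trans da.
move=> s s0; split => [Ks|sa]; first by apply: ub_le_sup; [case: supE|split].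
apply: clK => e e0; have [s' [s'0 Ks'] hs'] := sup_adherent e0 supE.
have [ss'|s's] := leP s s'.
  exists (s *: delta_mx 0 i); last by move=> j; rewrite subrr normr0.
  apply: dK Ks' _ => j; rewrite !axisE !normrM !ger0_norm //.
  by rewrite ler_wpM2r.
exists (s' *: delta_mx 0 i) => // j; rewrite !axisE -mulrBl normrM.
case: eqP => _; last by rewrite normr0 mulr0.
rewrite normr1 mulr1 ger0_norm ?subr_ge0 ?ltW //; lra.
Qed.

Lemma half_axis_le n (K : set 'rV[R]_n) i a x : solid_body K -> half_axis K i a ->
  K x -> `|x 0 i| <= a.
Proof.
move=> sK [_ hE] Kx; apply/hE => //; apply: (solid_down sK Kx) => j.
by rewrite !mxE /=; case: eqP => [->|_]; rewrite ?mulr1 ?mulr0 ?normr0 ?normr_id.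
Qed.

(** A truncation in one coordinate does not shorten the other axes; this is why the
    dilation factors found for the different coordinates do not interact. *)
Lemma half_axis_cut n (K : set 'rV[R]_n) i j r a : 0 < r -> i != j ->
  half_axis K i a -> half_axis (cut_coord j r K) i a.
Proof.
move=> r0 ij [a0 hE]; split => // s s0; rewrite -hE //; split => [[]//|Ks].
by split => //; rewrite !mxE eq_sym (negbTE ij) andbF mulr0 normr0 ltW.
Qed.

End body_volume.

Section slices.
Context (R : realType) (n : nat).
Implicit Types (K L Z : set 'rV[R]_n.+1).

Lemma row_cons_comb (s s' t t' : R) (y y' : 'rV[R]_n) :
  row_cons (t * s + t' * s') (t *: y + t' *: y') = t *: row_cons s y + t' *: row_cons s' y'.
Proof.
apply/rowP => i; case: (unliftP ord0 i) => [j ->|->].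
  by rewrite row_consS 4!mxE [in RHS]mxE !row_consS [in RHS]mxE row_consS.
by rewrite row_cons0 [in RHS]mxE [in RHS]mxE row_cons0 [in RHS]mxE row_cons0.
Qed.

Lemma row_cons_le (s s' : R) (y y' : 'rV[R]_n) : `|s| <= `|s'| ->
  (forall i, `|y 0 i| <= `|y' 0 i|) ->
  forall i, `|row_cons s y 0 i| <= `|row_cons s' y' 0 i|.
Proof.
by move=> ss yy i; case: (unliftP ord0 i) => [j ->|->]; rewrite ?row_consS ?row_cons0.
Qed.

Lemma slice_noninc K s s' : solid_body K -> `|s| <= `|s'| -> slice K s' `<=` slice K s.
Proof.
by move=> sK ss y Ky; apply: (solid_down sK Ky); exact: row_cons_le.
Qed.

Lemma slice_bounded K s : coord_bounded K -> coord_bounded (slice K s).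
Proof.
by case=> M hM; exists M => y Ky i; have := hM _ Ky (lift ord0 i); rewrite row_consS.
Qed.

Lemma half_axis_row_cons K a s : half_axis K ord0 a -> 0 <= s -> s <= a ->
  K (row_cons s 0).
Proof.
move=> [_ hE] s0 sa; have /hE := sa; move=> /(_ s0); congr K.
apply/rowP => i; case: (unliftP ord0 i) => [j ->|->].
  by rewrite row_consS !mxE /= mulr0.
by rewrite row_cons0 !mxE eqxx mulr1.
Qed.

(** For the cube: some cube around a point (s', 0) of the axis with |s| < s' lies in
    the body, and s' may then be lowered to s. *)
Lemma slice_solid K a s : solid_body K -> half_axis K ord0 a -> `|s| < a ->
  solid_body (slice K s).
Proof.
move=> sK hA sa; have [clK bK cK dK [d d0 qK]] := sK; have a0 := proj1 hA.
split.
- move=> y h; apply: clK => e e0; have [y' Ky' yy] := h _ e0.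
  exists (row_cons s y') => // i; case: (unliftP ord0 i) => [j ->|->].
    by rewrite !row_consS.
  by rewrite !row_cons0 subrr normr0.
- exact: slice_bounded.
- move=> y y' t Ky Ky' t0 t1; rewrite /slice /mkset.
  have := cK _ _ _ Ky Ky' t0 t1; rewrite -row_cons_comb.
  by rewrite -mulrDl subrKC mul1r.
- by move=> y y' Ky yy; apply: dK Ky _; exact: row_cons_le.
- pose t := (1 - `|s| / a) / 2.
  have sa1 : `|s| / a < 1 by rewrite ltr_pdivrMr // mul1r.
  have sa0 : 0 <= `|s| / a by rewrite divr_ge0 // ltW.
  have t0 : 0 < t by rewrite /t; lra.
  have t1 : t < 1 by rewrite /t; lra.
  exists (t * d); first exact: mulr_gt0.
  move=> y hy; have Ka := half_axis_row_cons hA (ltW a0) (lexx a).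
  have Ky : K (row_cons ((1 - t) * a) y).
    apply: (solid_midcube sK Ka t0 t1 qK) => i; case: (unliftP ord0 i) => [j ->|->].
      by rewrite !row_consS mxE mulr0 subr0.
    by rewrite !row_cons0 subrr normr0 mulr_ge0 // ltW.
  apply: dK Ky _; apply: row_cons_le => //.
  have sta : `|s| <= (1 - t) * a by rewrite -ler_pdivrMr // /t; lra.
  by rewrite [X in _ <= X]ger0_norm // (le_trans _ sta).
Qed.

Lemma slice_measurable_solid K s : solid_body K -> tuple_measurable (slice K s).
Proof. by move=> sK; apply: slice_measurable; exact: solid_measurable. Qed.

Lemma slice_volume K s : solid_body K -> volume (slice K s) = (vol (slice K s))%:E.
Proof.
move=> sK; apply: bounded_volume; first exact: slice_measurable_solid.
exact/slice_bounded/(solid_bounded sK).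
Qed.

(** The cone over the slice at height s with apex at the end of the axis lies in the
    body, and its slice at height s' is a homothetic copy with ratio
    (a - s') / (a - s). *)
Lemma slice_ratio K a s s' : solid_body K -> half_axis K ord0 a ->
  0 <= s -> s < s' -> s' < a ->
  ((a - s') / (a - s)) ^+ n * vol (slice K s) <= vol (slice K s').
Proof.
move=> sK hA s0 ss sa; set q := (a - s') / (a - s).
have q0 : 0 < q by rewrite divr_gt0; lra.
have q1 : q <= 1 by rewrite ler_pdivrMr ?mul1r; lra.
have iq0 : 0 < q^-1 by rewrite invr_gt0.
have mS := @slice_measurable_solid K s sK.
have := @volume_monomial R n (fun _ => q^-1) 1%g _ (fun _ => iq0) mS.
set A := [set x | _] => hA'.
have AE x : A x = slice K s (q^-1 *: x).
  rewrite /A /mkset; congr (slice K s _); apply/rowP => i.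
  by rewrite !mxE perm1.
have AS : A `<=` slice K s'.
  move=> x; rewrite AE => Ax; rewrite /slice /mkset.
  have a0 := ltW (proj1 hA).
  have := solid_convex sK Ax (half_axis_row_cons hA a0 (lexx a)) (ltW q0) q1.
  rewrite -row_cons_comb scaler0 addr0 scalerA divff ?lt0r_neq0 // scale1r.
  congr (K (row_cons _ x)); rewrite /q; field; lra.
have mA : tuple_measurable A.
  apply: tuple_measurable_closed => x h; rewrite AE.
  have ssol : solid_body (slice K s).
    by apply: (slice_solid sK hA); rewrite ger0_norm; lra.
  apply: (solid_closed ssol) => e e0.
  have [y Ay xy] := h (e * q) (mulr_gt0 e0 q0).
  exists (q^-1 *: y); first by rewrite -AE.
  move=> i; rewrite !mxE -mulrBr normrM gtr0_norm // ltr_pdivrMl // mulrC.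
  exact: xy.
have bA : coord_bounded A.
  have [M hM] := slice_bounded s' (solid_bounded sK).
  by exists M => x /AS; exact: hM.
have volA : vol A = q ^+ n * vol (slice K s).
  move: hA'; rewrite (bounded_volume mA bA) (slice_volume s sK) -EFinM => -[] <-.
  rewrite prodr_const card_ord mulrA -exprMn divff ?lt0r_neq0 //.
  by rewrite expr1n mul1r.
rewrite -volA -lee_fin -(bounded_volume mA bA) -(slice_volume s' sK).
by apply: le_volume => //; exact: slice_measurable_solid.
Qed.

Lemma slab_cut (A : set 'rV[R]_n.+1) u v : 0 <= u -> u < v ->
  tuple_measurable A ->
  volume (cut_coord ord0 v A) =
    (volume (slab A (annulus u v)) + volume (cut_coord ord0 u A))%E.
Proof.
move=> u0 uv mA.
rewrite (volume_split (cut_measurable ord0 v mA) (cut_measurable ord0 u mA)).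
congr (_ + _)%E; congr volume; apply/seteqP; split => x.
- move=> [[Ax xv] h]; split => //; rewrite /annulus /= xv andbT ltNge.
  by apply/negP => xu; apply: h.
- move=> [Ax /andP[ux xv]]; split => // -[_]; by rewrite leNgt ux.
- by case.
- by move=> [Ax xu]; split => //; split => //; lra.
Qed.

Lemma cut_vol_diff (A : set 'rV[R]_n.+1) u v : 0 <= u -> u < v ->
  tuple_measurable A -> (volume A < +oo)%E ->
  volume (slab A (annulus u v)) =
    (vol (cut_coord ord0 v A) - vol (cut_coord ord0 u A))%:E.
Proof.
move=> u0 uv mA fA.
have fin r : volume (cut_coord ord0 r A) = (vol (cut_coord ord0 r A))%:E.
  rewrite /vol fineK // ge0_fin_numE ?volume_ge0 //.
  apply: le_lt_trans fA; apply: le_volume => //; last by move=> x [].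
  exact: cut_measurable.
have := slab_cut u0 uv mA; rewrite !fin; case: (volume (slab _ _)) => //= r.
by rewrite -EFinD => -[->]; rewrite addrK.
Qed.

Lemma cut_profile K a : solid_body K -> half_axis K ord0 a ->
  profile n a (fun s => vol (cut_coord ord0 s K)) (fun s => 2 * vol (slice K s)).
Proof.
move=> sK hA; have mK := solid_measurable sK.
have fK : (volume K < +oo)%E by rewrite solid_volume // ltry.
split.
- exact: (proj1 hA).
- have -> : cut_coord ord0 0 K = slab K [set 0].
    apply/seteqP; split => x [Kx /=]; first by rewrite normr_le0 => /eqP.
    by move=> h; split => //; rewrite h normr0.
  by rewrite /vol slab_volume0.
- by move=> s; rewrite mulr_ge0 // vol_ge0.
- move=> s s0 sa; rewrite mulr_gt0 // solid_vol_gt0 //.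
  by apply: (slice_solid sK hA); rewrite ger0_norm.
- move=> s s' s0 ss; rewrite -lee_fin -cut_vol_diff //.
  rewrite -mulrA [_ * (s' - s)]mulrC mulrA; apply: slab_volume_lb => //.
    exact: vol_ge0.
  move=> r r1 r2; rewrite -(slice_volume s' sK).
  apply: le_volume; try exact: slice_measurable_solid.
  by apply: slice_noninc => //; rewrite (ger0_norm (_ : 0 <= s')) //; lra.
- move=> s s' s0 ss; rewrite -lee_fin -cut_vol_diff //.
  rewrite -mulrA [_ * (s' - s)]mulrC mulrA; apply: slab_volume_ub => //.
    exact: vol_ge0.
  move=> r r1 r2; rewrite -(slice_volume s sK).
  apply: le_volume; try exact: slice_measurable_solid.
  by apply: slice_noninc => //; rewrite (ger0_norm s0) ltW.
- move=> s s' s0 ss sa; rewrite mulrCA ler_pM2l //; exact: slice_ratio.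
Qed.

Lemma cut_half_axis K a : solid_body K -> half_axis K ord0 a ->
  cut_coord ord0 a K = K.
Proof.
move=> sK hA; apply/seteqP; split => x; first by case.
by move=> Kx; split => //; exact: half_axis_le hA Kx.
Qed.

End slices.

(** * The inequality for coordinatewise geometric means *)

Section prekopa_leindler.
Context (R : realType) (l : R) (l0 : 0 < l) (l1 : l < 1).

Definition contains_gmeans n (K L Z : set 'rV[R]_n) : Prop :=
  forall x y z : 'rV[R]_n, K x -> L y ->
    (forall i, `|z 0 i| = gmean l `|x 0 i| `|y 0 i|) -> Z z.

Lemma contains_gmeans_slice n (K L Z : set 'rV[R]_n.+1) s t r :
  contains_gmeans K L Z -> `|r| = gmean l `|s| `|t| ->
  contains_gmeans (slice K s) (slice L t) (slice Z r).
Proof.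
move=> hZ hr x y z Kx Ly hz; apply: (hZ _ _ _ Kx Ly) => i.
by case: (unliftP ord0 i) => [j ->|->]; rewrite ?row_consS ?row_cons0.
Qed.

Lemma contains_gmeans_cut n (K L Z : set 'rV[R]_n) i s t :
  contains_gmeans K L Z -> 0 <= s -> 0 <= t ->
  contains_gmeans (cut_coord i s K) (cut_coord i t L)
    (cut_coord i (gmean l s t) Z).
Proof.
move=> hZ s0 t0 x y z [Kx xs] [Ly yt] hz; split; first exact: (hZ x y z Kx Ly hz).
by rewrite hz; exact: gmean_le.
Qed.

Section slicing_step.
Context (n : nat).
Hypothesis IH : forall K L Z : set 'rV[R]_n, solid_body K -> solid_body L ->
  tuple_measurable Z -> contains_gmeans K L Z ->
  ((gmean l (vol K) (vol L))%:E <= volume Z)%E.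
Context (K L Z : set 'rV[R]_n.+1) (a b : R).
Hypotheses (sK : solid_body K) (sL : solid_body L) (mZ : tuple_measurable Z).
Hypotheses (hA : half_axis K ord0 a) (hB : half_axis L ord0 b).
Hypotheses (hZ : contains_gmeans K L Z) (fZ : (volume Z < +oo)%E).

(** A height r below the geometric mean of x and y is the geometric mean of some
    x' <= x and y' <= y.  The slice of Z at height r contains the geometric means of
    the slices of K and L at heights x' and y', which are larger than those at x
    and y; the inequality in dimension n applies to them. *)
Lemma slab_gmean_lb x y v : 0 < x -> x < a -> 0 < y -> y < b ->
  0 <= v -> v < gmean l x y ->
  (gmean l x y - v) * gmean l (2 * vol (slice K x)) (2 * vol (slice L y)) <=
  vol (cut_coord ord0 (gmean l x y) Z) - vol (cut_coord ord0 v Z).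
Proof.
move=> x0 xa y0 yb v0 vu.
rewrite gmeanZ ?vol_ge0 // -lee_fin -cut_vol_diff //.
rewrite mulrA [_ * 2]mulrC; apply: slab_volume_lb => //; first exact: gmean_ge0.
move=> r vr ru.
have [x' [y' [/andP[x'0 x'x] /andP[y'0 y'y] e]]] :
    exists x' y', [/\ 0 < x' <= x, 0 < y' <= y & gmean l x' y' = `|r|].
  move: ru; rewrite le_eqVlt => /predU1P[->|ru].
    by exists x, y; rewrite x0 y0 !lexx.
  have r0 : 0 < `|r| by lra.
  have hr : 0 < `|r| < gmean l x y by rewrite r0.
  have [x' [y' [/andP[h1 h2] /andP[h3 h4] h5]]] := gmean_between x0 y0 hr.
  by exists x', y'; split => //; rewrite ?h1 ?h3 ltW.
have nx' : `|x'| = x' by rewrite gtr0_norm.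
have ny' : `|y'| = y' by rewrite gtr0_norm.
have sKx : solid_body (slice K x') by apply: (slice_solid sK hA); rewrite nx'; lra.
have sLy : solid_body (slice L y') by apply: (slice_solid sL hB); rewrite ny'; lra.
have hc : contains_gmeans (slice K x') (slice L y') (slice Z r).
  by apply: contains_gmeans_slice; rewrite ?nx' ?ny'.
apply: le_trans (IH sKx sLy (slice_measurable r mZ) hc).
rewrite lee_fin; apply: gmean_le; rewrite ?vol_ge0 //.
  rewrite -lee_fin -!slice_volume //; apply: le_volume; try exact: slice_measurable_solid.
  by apply: slice_noninc => //; rewrite nx' (gtr0_norm x0).
rewrite -lee_fin -!slice_volume //; apply: le_volume; try exact: slice_measurable_solid.
by apply: slice_noninc => //; rewrite ny' (gtr0_norm y0).
Qed.

Let H v := vol (cut_coord ord0 v Z).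

Let H_ge0 v : 0 <= v -> 0 <= H v.
Proof. by move=> _; exact: vol_ge0. Qed.

Let H_le v : 0 <= v -> H v <= vol Z.
Proof.
move=> _; have h : (volume (cut_coord ord0 v Z) <= volume Z)%E.
  by apply: le_volume => //; [exact: cut_measurable|move=> x []].
by apply: fine_le => //; rewrite ge0_fin_numE ?volume_ge0 // (le_lt_trans h).
Qed.

Let PF := cut_profile sK hA.
Let PG := cut_profile sL hB.

Lemma slicing_inequality : gmean l (vol K) (vol L) <= vol Z.
Proof.
have := line_inequality l0 l1 PF PG H_ge0 H_le slab_gmean_lb.
by rewrite !cut_half_axis.
Qed.

Lemma slicing_equality x : vol Z <= gmean l (vol K) (vol L) -> 0 < x -> x < a ->
  vol (cut_coord ord0 (b / a * x) L) = vol (cut_coord ord0 x K) / vol K * vol L /\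
  vol (cut_coord ord0 (gmean l x (b / a * x)) Z) =
    vol (cut_coord ord0 x K) / vol K * gmean l (vol K) (vol L).
Proof.
move=> hle x0 xa.
have := line_equality l0 l1 PF PG H_ge0 H_le slab_gmean_lb.
rewrite (cut_half_axis sK hA) (cut_half_axis sL hB) => h; exact: (h hle x x0 xa).
Qed.

End slicing_step.

(** By induction on the dimension, slicing along the first coordinate: the volumes
    of the slices satisfy the one-dimensional inequality. *)
Theorem prekopa_leindler n (K L Z : set 'rV[R]_n) : solid_body K -> solid_body L ->
  tuple_measurable Z -> contains_gmeans K L Z ->
  ((gmean l (vol K) (vol L))%:E <= volume Z)%E.
Proof.
elim: n K L Z => [|n IH] K L Z sK sL mZ hZ.
  have full (A : set 'rV[R]_0) : A 0 -> volume A = 1%:E.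
    by move=> A0; rewrite volumeE /= diracE mem_set //= (_ : row_of_tuple _ = 0) //;
      apply/rowP => -[].
  have Z0 : Z 0 by apply: (hZ 0 0 0 (solid0 sK) (solid0 sL)) => -[].
  rewrite /vol !full //=; try exact: solid0.
  by rewrite gmean_id.
have [a hA] := exists_half_axis ord0 sK; have [b hB] := exists_half_axis ord0 sL.
have [fZ|] := ltP (volume Z) +oo%E; last by rewrite leye_eq => /eqP ->; rewrite leey.
have := slicing_inequality IH sK sL mZ hA hB hZ fZ.
by rewrite -lee_fin /vol fineK // ge0_fin_numE ?volume_ge0.
Qed.

End prekopa_leindler.

(** * The equality case for coordinatewise geometric means *)

Section body_tools.
Context (R : realType) (n : nat).
Implicit Types (K L W Z : set 'rV[R]_n).

Lemma solid_of_shrink K x : solid_body K ->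
  (forall t, 0 < t -> t < 1 -> K ((1 - t) *: x)) -> K x.
Proof.
move=> sK h; apply: (solid_closed sK) => e e0.
pose t := Order.min 2^-1 (e / (`|x| + 1)).
have x1 : 0 < `|x| + 1 by rewrite ltr_wpDl.
have t0 : 0 < t by rewrite lt_min divr_gt0 // invr_gt0 ltr0n.
have t1 : t < 1 by rewrite gt_min; apply/orP; left; lra.
exists ((1 - t) *: x); first exact: h.
move=> i; rewrite mxE; have -> : x 0 i - (1 - t) * x 0 i = t * x 0 i by ring.
rewrite normrM (gtr0_norm t0).
have te : t * (`|x| + 1) <= e.
  by rewrite -ler_pdivlMr // ge_min lexx orbT.
apply: (@lt_le_trans _ _ (t * (`|x| + 1))) => //.
by rewrite ltr_pM2l // ltr_pwDr // coord_le_norm.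
Qed.

Lemma solid_setI K L : solid_body K -> solid_body L -> solid_body (K `&` L).
Proof.
move=> [clK [M bK] cK dK [d d0 qK]] [clL _ cL dL [e e0 qL]]; split.
- by move=> x h; split; [apply: clK|apply: clL] => r r0;
    have [y [Ky Ly] xy] := h _ r0; exists y.
- by exists M => x [Kx _]; exact: bK.
- by move=> x y t [Kx Lx] [Ky Ly] t0 t1; split; [exact: cK|exact: cL].
- by move=> x y [Kx Lx] xy; split; [exact: dK Kx xy|exact: dL Lx xy].
- exists (Order.min d e); first by rewrite lt_min d0.
  by move=> x hx; split; [apply: qK|apply: qL] => i; apply: le_trans (hx i) _;
    rewrite ge_min lexx ?orbT.
Qed.

Lemma box0P (w : 'I_n -> R) x : box 0 w x <-> forall i, `|x 0 i| <= w i.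
Proof. by split => h i; have := h i; rewrite mxE subr0. Qed.

Lemma solid_box (w : 'I_n -> R) : (forall i, 0 < w i) -> solid_body (box 0 w).
Proof.
move=> w0; split.
- move=> z h; apply/box0P => i; apply/ler_addgt0Pr => e e0.
  have [y /box0P yw zy] := h _ e0.
  have := ler_normD (z 0 i - y 0 i) (y 0 i); rewrite subrK.
  have := zy i; have := yw i; lra.
- exists (\big[Order.max/0]_i w i) => z /box0P hz i.
  by apply: le_trans (hz i) _; exact: le_bigmax.
- move=> z y t /box0P hz /box0P hy t0 t1; apply/box0P => i; rewrite !mxE.
  apply: le_trans (ler_normD _ _) _.
  rewrite !normrM (ger0_norm t0) (@ger0_norm _ (1 - t)) ?subr_ge0 //.
  have t1' : 0 <= 1 - t by lra.
  have := ler_wpM2l t0 (hz i); have := ler_wpM2l t1' (hy i); lra.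
- by move=> z y /box0P hz zy; apply/box0P => i; apply: le_trans (zy i) (hz i).
- exists (\big[Order.min/1]_i w i); first by apply: lt_bigmin.
  move=> z hz; apply/box0P => i; apply: le_trans (hz i) _.
  exact: bigmin_le_cond.
Qed.

(** A point of Z outside W would have a neighbourhood outside W, and this
    neighbourhood contains a box of Z, of positive volume. *)
Lemma contained_of_volume W Z : solid_body W -> solid_body Z -> W `<=` Z ->
  vol Z <= vol W -> Z `<=` W.
Proof.
move=> sW sZ WZ hv z Zz; apply: contrapT => Wz.
have [e e0 he] : exists2 e : R, 0 < e & forall y, W y -> exists i, e <= `|z 0 i - y 0 i|.
  apply: contrapT => h; apply: Wz; apply: (solid_closed sW) => e e0.
  apply: contrapT => h2; apply: h; exists e => // y Wy.
  apply: contrapT => h3; apply: h2; exists y => // i; rewrite ltNge.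
  by apply/negP => h4; apply: h3; exists i.
have [d d0 qZ] := solid_cube sZ.
(* The box around (1 - t) z of radius t d stays within distance e of z. *)
pose t := Order.min 2^-1 (e / (2 * (`|z| + d))).
have zd : 0 < `|z| + d by rewrite ltr_wpDl.
have t0 : 0 < t by rewrite lt_min invr_gt0 ltr0n divr_gt0 // mulr_gt0.
have t1 : t < 1 by rewrite gt_min; apply/orP; left; lra.
pose B := box ((1 - t) *: z) (fun _ : 'I_n => t * d).
have BZ : B `<=` Z.
  move=> y hy; apply: (solid_midcube sZ Zz t0 t1 qZ) => i.
  by have := hy i; rewrite mxE.
have BW y : B y -> ~ W y.
  move=> By Wy; have [i] := he y Wy; rewrite leNgt => /negP; apply.
  have := By i; rewrite mxE => hb.
  have te : t * (2 * (`|z| + d)) <= e.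
    by rewrite -ler_pdivlMr ?mulr_gt0 // ge_min lexx orbT.
  have -> : z 0 i - y 0 i = t * z 0 i - (y 0 i - (1 - t) * z 0 i) by ring.
  apply: le_lt_trans (ler_normB _ _) _; rewrite normrM (gtr0_norm t0).
  have h1 : t * `|z 0 i| <= t * `|z| by rewrite ler_pM2l // coord_le_norm.
  have h2 : 0 < t * (`|z| + d) by rewrite mulr_gt0.
  lra.
have td : 0 < t * d by rewrite mulr_gt0.
have volB : (0 < volume B)%E.
  rewrite volume_box ?lte_fin; last by move=> _; exact: ltW.
  by apply: prodr_gt0 => i _; rewrite mulr_gt0.
have := volume_split (solid_measurable sZ) (solid_measurable sW).
rewrite (setIidr WZ) (solid_volume sZ) (solid_volume sW) => hsplit.
have hB : (volume B <= volume (Z `\` W))%E.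
  apply: le_volume; first exact: tuple_measurable_box.
    have := measurableD (solid_measurable sZ) (solid_measurable sW).
    by congr measurable.
  by move=> y By; split; [exact: BZ|exact: BW].
have := lt_le_trans volB hB.
move: hsplit; case: (volume (_ `\` _)) => //= r [hr]; rewrite lte_fin.
lra.
Qed.

End body_tools.

Section equality_case.
Context (R : realType) (l : R) (l0 : 0 < l) (l1 : l < 1).

(** Equality is inherited by suitable truncations of the three sets, which is what allows one
    to treat the coordinates one at a time. *)
Record gmean_equality n (K L Z : set 'rV[R]_n) : Prop := GmeanEquality {
  equality_left : solid_body K;
  equality_right : solid_body L;
  equality_measurable : tuple_measurable Z;
  equality_contains : contains_gmeans l K L Z;
  equality_volume : volume Z = (gmean l (vol K) (vol L))%:E }.

Lemma cut_equality0 n (K L Z : set 'rV[R]_n.+1) a b x :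
  gmean_equality K L Z -> half_axis K ord0 a -> half_axis L ord0 b ->
  0 < x -> x < a ->
  vol (cut_coord ord0 (b / a * x) L) * vol K = vol (cut_coord ord0 x K) * vol L /\
  gmean_equality (cut_coord ord0 x K) (cut_coord ord0 (b / a * x) L)
    (cut_coord ord0 (gmean l x (b / a * x)) Z).
Proof.
move=> [sK sL mZ cZ vZ] hA hB x0 xa.
have fZ : (volume Z < +oo)%E by rewrite vZ ltry.
have a0 := proj1 hA; have b0 := proj1 hB.
have y0 : 0 < b / a * x by rewrite mulr_gt0 // divr_gt0.
have vZ' : vol Z = gmean l (vol K) (vol L) by rewrite /vol vZ.
have vZle : vol Z <= gmean l (vol K) (vol L) by rewrite vZ'.
have [e1 e2] := slicing_equality l0 l1 (@prekopa_leindler R l l0 l1 n) sK sL mZ hA hB cZ fZ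
  vZle x0 xa.
have K0 := solid_vol_gt0 sK; have L0 := solid_vol_gt0 sL.
split; first by rewrite e1; field; exact: lt0r_neq0.
have mcut := cut_measurable ord0 (gmean l x (b / a * x)) mZ.
split.
- exact: solid_cut.
- exact: solid_cut.
- exact: mcut.
- by apply: contains_gmeans_cut => //; exact: ltW.
- rewrite -[LHS]fineK; last first.
    rewrite ge0_fin_numE ?volume_ge0 //; apply: le_lt_trans fZ.
    by apply: le_volume => // z [].
  rewrite -/(vol _) e2 e1 -gmeanZ ?divr_ge0 ?vol_ge0 //.
  by rewrite (divfK (lt0r_neq0 K0)).
Qed.

Definition permute n (s : {perm 'I_n}) (A : set 'rV[R]_n) : set 'rV[R]_n :=
  [set x | A (monomial_map (fun _ => 1) (fun i => Some (s i)) x)].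

Lemma permuteE n (s : {perm 'I_n}) (x : 'rV[R]_n) i :
  monomial_map (fun _ => 1) (fun i => Some (s i)) x 0 i = x 0 (s i).
Proof. by rewrite mxE mul1r. Qed.

Lemma permuteK n (s : {perm 'I_n}) (A : set 'rV[R]_n) : permute s^-1 (permute s A) = A.
Proof.
apply/seteqP; split => x; rewrite /permute /mkset; congr A; apply/rowP => i;
by rewrite !permuteE permK.
Qed.

Lemma permute_volume n (s : {perm 'I_n}) (A : set 'rV[R]_n) : tuple_measurable A ->
  volume (permute s A) = volume A.
Proof.
move=> mA; have := volume_monomial s (fun i : 'I_n => @ltr01 R) mA.
by rewrite big1_eq mul1e.
Qed.

Lemma permute_vol n (s : {perm 'I_n}) (A : set 'rV[R]_n) : tuple_measurable A ->
  vol (permute s A) = vol A.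
Proof. by move=> mA; rewrite /vol permute_volume. Qed.

Lemma permute_solid n (s : {perm 'I_n}) (K : set 'rV[R]_n) :
  solid_body K -> solid_body (permute s K).
Proof.
apply: solid_preimage => // j; exists ((s^-1)%g j); by rewrite permKV.
Qed.

Lemma permute_measurable n (s : {perm 'I_n}) (A : set 'rV[R]_n) :
  tuple_measurable A -> tuple_measurable (permute s A).
Proof.
move=> mA.
pose phi (t : n.-tuple (measurableTypeR R)) : n.-tuple (measurableTypeR R) :=
  [tuple tnth t (s i) | i < n].
have mphi : measurable_fun setT phi.
  apply/measurable_fun_tnthP => i.
  have -> : (tnth (T:=measurableTypeR R))^~ i \o phi = (tnth (T:=measurableTypeR R))^~ (s i).
    by apply/funext => t /=; rewrite tnth_mktuple.
  exact: measurable_tnth.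
have := mphi measurableT _ mA; rewrite setTI; congr measurable.
apply/seteqP; split => t; rewrite /permute /preimage /mkset; congr A;
by apply/rowP => i; rewrite !mxE tnth_mktuple mul1r.
Qed.

Lemma permute_cut n (s : {perm 'I_n}) (A : set 'rV[R]_n) i r :
  permute s (cut_coord i r A) = cut_coord (s i) r (permute s A).
Proof.
by apply/seteqP; split => x; rewrite /permute /cut_coord /mkset /= permuteE.
Qed.

Lemma permute_half_axis n (s : {perm 'I_n}) (A : set 'rV[R]_n) i a :
  half_axis A i a -> half_axis (permute s A) (s i) a.
Proof.
move=> [a0 hA]; split => // r r0; rewrite -hA // /permute /mkset.
rewrite (_ : monomial_map _ _ _ = r *: delta_mx 0 i) //.
by apply/rowP => j; rewrite permuteE !mxE (inj_eq perm_inj).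
Qed.

Lemma permute_equality n (s : {perm 'I_n}) (K L Z : set 'rV[R]_n) :
  gmean_equality K L Z -> gmean_equality (permute s K) (permute s L) (permute s Z).
Proof.
move=> [sK sL mZ cZ vZ]; split.
- exact: permute_solid.
- exact: permute_solid.
- exact: permute_measurable.
- move=> x y z Kx Ly hz; apply: (cZ _ _ _ Kx Ly) => i.
  by rewrite !permuteE hz.
- rewrite permute_volume // !permute_vol //; exact: solid_measurable.
Qed.

(** Exchanging the coordinate i with the first one reduces to slicing along the first
    coordinate. *)
Lemma cut_equality n (i : 'I_n) (K L Z : set 'rV[R]_n) a b x :
  gmean_equality K L Z -> half_axis K i a -> half_axis L i b ->
  0 < x -> x < a ->
  vol (cut_coord i (b / a * x) L) * vol K = vol (cut_coord i x K) * vol L /\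
  gmean_equality (cut_coord i x K) (cut_coord i (b / a * x) L)
    (cut_coord i (gmean l x (b / a * x)) Z).
Proof.
case: n i K L Z => [[]//|n] i K L Z eqKLZ hA hB x0 xa.
pose s : {perm 'I_n.+1} := tperm i ord0.
have si : s i = ord0 by rewrite tpermL.
have sV : (s^-1 = s)%g by rewrite tpermV.
have ss A : permute s (permute s A) = A by rewrite -{1}sV permuteK.
have hA' : half_axis (permute s K) ord0 a by rewrite -si; exact: permute_half_axis.
have hB' : half_axis (permute s L) ord0 b by rewrite -si; exact: permute_half_axis.
have [e1 e2] := cut_equality0 (permute_equality s eqKLZ) hA' hB' x0 xa.
have mK := solid_measurable (equality_left eqKLZ).
have mL := solid_measurable (equality_right eqKLZ).
split.
  move: e1; rewrite -si -!permute_cut !permute_vol //; exact: cut_measurable.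
by have := permute_equality s e2; rewrite -si -!permute_cut !ss.
Qed.

Section all_coordinates.
Context (n : nat) (K L Z : set 'rV[R]_n) (a b : 'I_n -> R).
Hypothesis eqKLZ : gmean_equality K L Z.
Hypotheses (hA : forall i, half_axis K i (a i)) (hB : forall i, half_axis L i (b i)).

Let D i := b i / a i.

Let D0 i : 0 < D i.
Proof. by rewrite divr_gt0 // (proj1 (hA _), proj1 (hB _)). Qed.

(** Truncating in all coordinates successively: the ratio of the volumes of K and L
    is kept at each step, and so are the lengths of the axes that have not yet been
    used. *)
Lemma cut_equality_all (x : 'rV[R]_n) :
  (forall i, 0 < x 0 i) -> (forall i, x 0 i < a i) ->
  vol (L `&` box 0 (fun i => D i * x 0 i)) * vol K = vol (K `&` box 0 (x 0)) * vol L.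
Proof.
move=> x0 xa.
pose cuts (w : 'I_n -> R) (s : seq 'I_n) (A : set 'rV[R]_n) :=
  foldr (fun i B => cut_coord i (w i) B) A s.
have cutsE w A : cuts w (enum 'I_n) A = A `&` box 0 w.
  have H s : cuts w s A = [set y | A y /\ forall i, i \in s -> `|y 0 i| <= w i].
    elim: s => [|i s IH] /=; first by apply/seteqP; split => y //; case.
    rewrite IH; apply/seteqP; split => y.
      move=> [[Ay h] yi]; split => // j; rewrite inE => /predU1P[->//|]; exact: h.
    move=> [Ay h]; split; last by apply: h; rewrite mem_head.
    by split => // j js; apply: h; rewrite inE js orbT.
  rewrite H; apply/seteqP; split => y [Ay h]; split => //.
    by apply/box0P => i; apply: h; rewrite mem_enum.
  by move=> i _; exact: (proj1 (box0P w y) h).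
rewrite -!cutsE.
suff H s : uniq s ->
    exists Z', [/\ gmean_equality (cuts (x 0) s K)
         (cuts (fun i => D i * x 0 i) s L) Z',
      vol (cuts (fun i => D i * x 0 i) s L) * vol K = vol (cuts (x 0) s K) * vol L,
      (forall i, i \notin s -> half_axis (cuts (x 0) s K) i (a i)) &
      (forall i, i \notin s -> half_axis (cuts (fun i => D i * x 0 i) s L) i (b i))].
  by have [Z' []] := H _ (enum_uniq 'I_n).
elim: s => [_|i s IH /= /andP[is_ us]].
  by exists Z; split; [exact: eqKLZ|exact: mulrC|move=> i _; exact: hA|move=> i _; exact: hB].
have [Z' [eqs vs hAs hBs]] := IH us.
have [v' eq'] := cut_equality eqs (hAs _ is_) (hBs _ is_) (x0 i) (xa i).
set K' := cuts _ _ _ in v' eq' vs eqs hAs *; set L' := cuts _ _ _ in v' eq' vs eqs hBs *.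
exists (cut_coord i (gmean l (x 0 i) (D i * x 0 i)) Z'); split; first exact: eq'.
- have K'0 := solid_vol_gt0 (equality_left eqs).
  apply: (mulIf (lt0r_neq0 K'0)); rewrite mulrAC v' -!mulrA; congr (_ * _).
  by rewrite vs mulrC.
- move=> j; rewrite inE negb_or => /andP[ji js]; apply: half_axis_cut => //.
  exact: hAs.
- move=> j; rewrite inE negb_or => /andP[ji js]; apply: half_axis_cut => //.
    by rewrite mulr_gt0.
  exact: hBs.
Qed.

Let sK := equality_left eqKLZ.
Let sL := equality_right eqKLZ.

Let vol_box_dilated (y : 'rV[R]_n) : (forall i, 0 < y 0 i) ->
  vol (box 0 (fun i => D i * y 0 i)) = (\prod_i D i) * vol (box 0 (y 0)).
Proof.
move=> y0; have Dy i : 0 < D i * y 0 i by rewrite mulr_gt0.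
rewrite /vol (volume_box _ (fun i => ltW (Dy i))) (volume_box _ (fun i => ltW (y0 i))) /=.
by rewrite -big_split /=; apply: eq_bigr => i _; ring.
Qed.

Let setI_box (A : set 'rV[R]_n) (w : 'I_n -> R) (y : 'rV[R]_n) : solid_body A -> A y ->
  (forall i, w i <= `|y 0 i|) -> A `&` box 0 w = box 0 w.
Proof.
move=> sA Ay wy; apply/setIidPr => z /box0P hz; apply: (solid_down sA Ay) => i.
exact: le_trans (hz i) (wy i).
Qed.

(** For a small cube the two truncations are boxes, whose volumes are known. *)
Lemma equality_det : vol L = (\prod_i D i) * vol K.
Proof.
have [dK dK0 qK] := solid_cube sK; have [dL dL0 qL] := solid_cube sL.
have dKa i : dK <= a i by exact: half_axis_ge (hA i) dK0 qK.
(* The cube of radius r lies in K, and its image under the diagonal map in L. *)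
pose M := \big[Order.max/1]_i D i.
have M1 : 1 <= M by exact: bigmax_ge_id.
pose r := Order.min (dK / 2) (dL / M).
have r0 : 0 < r by rewrite lt_min !divr_gt0 // (lt_le_trans ltr01).
have rK : r < dK by rewrite gt_min; apply/orP; left; lra.
pose y : 'rV[R]_n := \row_i r.
have y0 i : 0 < y 0 i by rewrite mxE.
have ya i : y 0 i < a i by rewrite mxE (lt_le_trans rK).
have Ky : K y by apply: qK => i; rewrite mxE gtr0_norm // ltW.
have Ly : L (\row_i (D i * y 0 i)).
  apply: qL => i; rewrite !mxE (gtr0_norm (mulr_gt0 (D0 i) r0)).
  have hr : r * M <= dL.
    by rewrite -ler_pdivlMr ?(lt_le_trans ltr01) // ge_min lexx orbT.
  apply: le_trans hr; by rewrite mulrC ler_pM2l //; exact: le_bigmax.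
have := cut_equality_all y0 ya.
have Dyn k : D k * y 0 k <= `|(\row_i (D i * y 0 i)) 0 k|.
  by rewrite mxE; exact: ler_norm.
rewrite (setI_box sK Ky (fun i => ler_norm (y 0 i))) (setI_box sL Ly Dyn).
rewrite vol_box_dilated // => h.
have P0 : 0 < vol (box 0 (y 0)) by apply: solid_vol_gt0; exact: solid_box.
by apply: (mulfI (lt0r_neq0 P0)); rewrite -h; ring.
Qed.

(** If x is a point of K with positive coordinates, the truncation of K at x is the
    whole box with corner x; by the ratio of the volumes, the truncation of L at
    the image of x then has the volume of the whole box, hence is the whole box,
    and contains its corner. *)
Lemma equality_diagonal_le x : K x -> L (\row_i (D i * x 0 i)).
Proof.
have K0 := solid_vol_gt0 sK.
have pos (y : 'rV[R]_n) : K y -> (forall i, 0 < y 0 i) -> (forall i, y 0 i < a i) ->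
    L (\row_i (D i * y 0 i)).
  move=> Ky y0 ya; have Dy i : 0 < D i * y 0 i by rewrite mulr_gt0.
  have sB := solid_box Dy; have sW := solid_setI sL sB.
  have [] // : (L `&` box 0 (fun i => D i * y 0 i)) (\row_i (D i * y 0 i)).
  apply: (contained_of_volume sW sB); first by move=> z [].
    rewrite -(ler_pM2r K0) (cut_equality_all y0 ya) vol_box_dilated // equality_det.
    rewrite (setI_box sK Ky (fun i => ler_norm (y 0 i))).
    by rewrite le_eqVlt; apply/orP; left; apply/eqP; ring.
  by apply/box0P => i; rewrite mxE gtr0_norm.
have [dK dK0 qK] := solid_cube sK.
have dKa i : dK <= a i by exact: half_axis_ge (hA i) dK0 qK.
move=> Kx; apply: (solid_of_shrink sL) => t t0 t1.
(* A point of K with positive coordinates and strictly below the ends of the axes,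
   whose image dominates that of (1 - t) x. *)
pose y : 'rV[R]_n := \row_i ((1 - t) * `|x 0 i| + t * (dK / 2)).
have td : 0 < t * (dK / 2) by rewrite mulr_gt0 // divr_gt0.
have h1t : 0 <= 1 - t by lra.
have y0 i : 0 < y 0 i by rewrite mxE ltr_wpDl // mulr_ge0.
have Ky : K y.
  apply: (solid_midcube sK _ t0 t1 qK (x := \row_i `|x 0 i|)).
    by apply: (solid_down sK Kx) => i; rewrite mxE normr_id.
  move=> i; rewrite !mxE addrC addKr gtr0_norm // ler_pM2l //; lra.
have ya i : y 0 i < a i.
  rewrite mxE; have h1 := half_axis_le sK (hA i) Kx; have h2 := dKa i.
  have := ler_wpM2l h1t h1.
  have : t * (dK / 2) < t * a i by rewrite ltr_pM2l //; lra.
  lra.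
apply: (solid_down sL (pos y Ky y0 ya)) => i; rewrite !mxE !normrM.
rewrite (ger0_norm h1t) [X in _ <= _ * X]gtr0_norm; last by have := y0 i; rewrite mxE.
by rewrite mulrCA ler_wpM2l //; lra.
Qed.

End all_coordinates.

Definition diag_image n (d : 'I_n -> R) (K : set 'rV[R]_n) : set 'rV[R]_n :=
  [set x | K (\row_i ((d i)^-1 * x 0 i))].

Lemma diag_image_preimage n (d : 'I_n -> R) (K : set 'rV[R]_n) :
  diag_image d K =
  [set x | K (monomial_map (fun i => (d i)^-1) (fun i => Some ((1%g : {perm 'I_n}) i)) x)].
Proof.
apply/seteqP; split => x; rewrite /diag_image /mkset; congr K; apply/rowP => i;
by rewrite !mxE perm1.
Qed.

Lemma diag_image_solid n (d : 'I_n -> R) (K : set 'rV[R]_n) : (forall i, 0 < d i) ->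
  solid_body K -> solid_body (diag_image d K).
Proof.
move=> d0 sK; rewrite diag_image_preimage; apply: solid_preimage => //.
  by move=> i; rewrite invr_gt0.
by move=> j; exists j; rewrite perm1.
Qed.

Lemma diag_image_vol n (d : 'I_n -> R) (K : set 'rV[R]_n) : (forall i, 0 < d i) ->
  solid_body K -> vol (diag_image d K) = (\prod_i d i) * vol K.
Proof.
move=> d0 sK; have d0' i : 0 < (d i)^-1 by rewrite invr_gt0.
have := volume_monomial 1%g d0' (solid_measurable sK).
rewrite -diag_image_preimage (solid_volume (diag_image_solid d0 sK)) (solid_volume sK).
rewrite -EFinM => -[<-]; rewrite mulrA -big_split /= big1 ?mul1r // => i _.
by rewrite divff // lt0r_neq0.
Qed.

(** L contains the image of K under the diagonal map with factors b i / a i, and both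
    have the same volume. *)
Theorem gmean_equality_diagonal n (K L Z : set 'rV[R]_n) : gmean_equality K L Z ->
  exists2 d : 'I_n -> R, (forall i, 0 < d i) & L = diag_image d K.
Proof.
move=> eqKLZ; have sK := equality_left eqKLZ; have sL := equality_right eqKLZ.
have /choice[a hA] := fun i => exists_half_axis i sK.
have /choice[b hB] := fun i => exists_half_axis i sL.
pose d i := b i / a i.
have d0 i : 0 < d i by rewrite divr_gt0 // (proj1 (hA _), proj1 (hB _)).
exists d => //; have sD := diag_image_solid d0 sK.
have DL : diag_image d K `<=` L.
  move=> x Dx; have := equality_diagonal_le eqKLZ hA hB Dx; congr L.
  by apply/rowP => i; rewrite !mxE mulrA divff ?mul1r // lt0r_neq0 // d0.
apply/seteqP; split => //; apply: (contained_of_volume sD sL DL).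
by rewrite diag_image_vol // (equality_det eqKLZ hA hB).
Qed.

End equality_case.

(** * Support functions and the 0-convex combination *)

Section support_functions.
Context (R : realType) (n : nat).
Implicit Types (K L : set 'rV[R]_n) (x y u v : 'rV[R]_n).

Definition abs_row x : 'rV[R]_n := \row_i `|x 0 i|.

Lemma dotvC x y : dotv x y = dotv y x.
Proof. by apply: eq_bigr => i _; rewrite mulrC. Qed.

Lemma dotvZl c x y : dotv (c *: x) y = c * dotv x y.
Proof. by rewrite /dotv mulr_sumr; apply: eq_bigr => i _; rewrite mxE mulrA. Qed.

Lemma dotvDl x y u : dotv (x + y) u = dotv x u + dotv y u.
Proof. by rewrite /dotv -big_split; apply: eq_bigr => i _; rewrite mxE mulrDl. Qed.

Lemma dotv_le_abs x y : dotv x y <= dotv (abs_row x) (abs_row y).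
Proof.
by apply: ler_sum => i _; rewrite !mxE -normrM ler_norm.
Qed.

Lemma dotv_delta x i : dotv x (delta_mx 0 i) = x 0 i.
Proof.
rewrite /dotv (bigD1 i) //= big1 => [|j ji]; rewrite !mxE eqxx; last first.
  by rewrite /= (negbTE ji) mulr0.
by rewrite eqxx mulr1 addr0.
Qed.

Lemma abs_row_solid K x : solid_body K -> K (abs_row x) <-> K x.
Proof.
by move=> sK; split=> Kx; apply: (solid_down sK Kx) => i; rewrite !mxE normr_id.
Qed.

Lemma lipschitz_row_continuous (f : 'rV[R]_n -> R) (C : R) : 0 < C ->
  (forall u v, `|f u - f v| <= C * `|u - v|) -> continuous f.
Proof.
move=> C0 hC u; apply/(@cvgrPdist_lt _ _ _ (nbhs u)) => e e0.
apply/nbhs_ballP; exists (e / C); first by rewrite /= divr_gt0.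
move=> v; rewrite mx_norm_ball /ball_ /= => uv.
by apply: le_lt_trans (hC u v) _; rewrite mulrC -ltr_pdivlMr.
Qed.

Lemma dotv_le_norm x u : dotv x u <= (\sum_i `|x 0 i|) * `|u|.
Proof.
rewrite mulr_suml; apply: ler_sum => i _; apply: le_trans (ler_norm _) _.
by rewrite normrM ler_wpM2l // coord_le_norm.
Qed.

Lemma dotv_continuous x : continuous (dotv x).
Proof.
apply: (@lipschitz_row_continuous _ (\sum_i `|x 0 i| + 1)).
  by rewrite ltr_wpDl // sumr_ge0.
have le u v : dotv x u - dotv x v <= (\sum_i `|x 0 i| + 1) * `|u - v|.
  rewrite lerBlDr [dotv x u]dotvC -[u in dotv u](subrK v) dotvDl ![dotv _ x]dotvC lerD2r.
  apply: le_trans (dotv_le_norm _ _) _.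
  by rewrite ler_wpM2r // lerDl.
by move=> u v; rewrite ler_norml le andbT lerNl opprB [`|u - v|]distrC le.
Qed.

Section body.
Context (K : set 'rV[R]_n) (sK : solid_body K).

Let hasK u : has_sup [set dotv u y | y in K].
Proof.
have [M hM] := solid_bounded sK; split; first by exists (dotv u 0), 0 => //; exact: solid0.
exists (\sum_i `|u 0 i| * M) => _ [y Ky <-]; apply: ler_sum => i _.
apply: le_trans (ler_norm _) _; rewrite normrM; apply: ler_wpM2l => //.
exact: hM.
Qed.

Lemma support_ge u y : K y -> dotv u y <= support_function K u.
Proof. by move=> Ky; apply: ub_le_sup; [case: (hasK u)|exists y]. Qed.

Lemma support_le u c : (forall y, K y -> dotv u y <= c) -> support_function K u <= c.
Proof.
move=> h; apply: ge_sup; first by case: (hasK u).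
by move=> _ [y Ky <-]; exact: h.
Qed.

Lemma support_ge0 u : 0 <= support_function K u.
Proof.
apply: le_trans (support_ge u (solid0 sK)).
by rewrite /dotv big1 // => i _; rewrite mxE mulr0.
Qed.

Lemma support_gt0 u : u != 0 -> 0 < support_function K u.
Proof.
move=> /rV0Pn[i ui]; have [d d0 qK] := solid_cube sK.
pose y := (d * Num.sg (u 0 i)) *: delta_mx 0 i : 'rV[R]_n.
have Ky : K y.
  apply: qK => j; rewrite !mxE /= !normrM normr_sg ui mulr1 (gtr0_norm d0).
  by case: eqP; rewrite ?normr1 ?normr0 ?mulr1 ?mulr0 // ltW.
apply: lt_le_trans (support_ge u Ky).
rewrite dotvC dotvZl dotvC dotv_delta -mulrA -normrEsg mulr_gt0 //.
by rewrite normr_gt0.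
Qed.

Lemma support_scale c u : 0 <= c -> support_function K (c *: u) = c * support_function K u.
Proof.
have le c' v : 0 <= c' -> support_function K (c' *: v) <= c' * support_function K v.
  move=> c0; apply: support_le => y Ky; rewrite dotvZl ler_wpM2l //.
  exact: support_ge.
move=> c0; apply/eqP; rewrite eq_le le //=.
have [->|cn] := eqVneq c 0; first by rewrite mul0r support_ge0.
have {}c0 : 0 < c by rewrite lt0r cn.
rewrite -ler_pdivlMl //.
have := le c^-1 (c *: u); rewrite scalerA mulVf ?lt0r_neq0 // scale1r invr_ge0.
by move/(_ (ltW c0)).
Qed.

(** A body that is stable under changes of signs has a support function with the same
    property. *)
Lemma support_abs u : support_function K (abs_row u) = support_function K u.
Proof.
apply/eqP; rewrite eq_le; apply/andP; split; apply: support_le => y Ky.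
  pose z : 'rV[R]_n := \row_i (Num.sg (u 0 i) * y 0 i).
  have Kz : K z.
    apply: (solid_down sK Ky) => i; rewrite mxE normrM normr_sg.
    by case: (u 0 i != 0); rewrite ?mul1r ?mul0r.
  apply: le_trans (support_ge u Kz); rewrite le_eqVlt; apply/orP; left; apply/eqP.
  by apply: eq_bigr => i _; rewrite !mxE mulrA [u 0 i * _]mulrC -normrEsg.
apply: le_trans (dotv_le_abs _ _) _; apply: support_ge.
exact/(abs_row_solid _ sK).
Qed.

Lemma support_mono u v : (forall i, `|v 0 i| <= `|u 0 i|) ->
  support_function K v <= support_function K u.
Proof.
move=> vu; rewrite -(support_abs u); apply: support_le => y Ky.
apply: le_trans (dotv_le_abs _ _) _.
apply: (@le_trans _ _ (dotv (abs_row u) (abs_row y))).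
  by apply: ler_sum => i _; rewrite !mxE ler_wpM2r.
exact/support_ge/(abs_row_solid _ sK).
Qed.

Lemma support_lipschitz : exists2 C : R, 0 < C &
  forall u v, `|support_function K u - support_function K v| <= C * `|u - v|.
Proof.
have [M M0 hM] := solid_positive_bound sK.
exists (n%:R * M + 1); first by rewrite ltr_wpDl // mulr_ge0 // ltW.
have le u v : support_function K u - support_function K v <= (n%:R * M + 1) * `|u - v|.
  rewrite lerBlDr; apply: support_le => y Ky.
  have -> : dotv u y = dotv (u - v) y + dotv v y by rewrite -dotvDl subrK.
  apply: lerD; last exact: support_ge.
  apply: (@le_trans _ _ (\sum_(i < n) `|u - v| * M)).
    apply: ler_sum => i _; apply: le_trans (ler_norm _) _; rewrite normrM.
    by apply: ler_pM => //; [exact: coord_le_norm|exact: hM].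
  rewrite sumr_const card_ord -mulr_natl.
  have : 0 <= `|u - v| by [].
  by set w := `|u - v|; lra.
by move=> u v; rewrite ler_norml le andbT lerNl opprB [`|u - v|]distrC le.
Qed.

Lemma support_continuous : continuous (support_function K).
Proof.
have [C C0 hC] := support_lipschitz.
exact: lipschitz_row_continuous hC.
Qed.

End body.

Lemma support_diag (d : 'I_n -> R) K u : (forall i, 0 < d i) ->
  support_function (diag_image d K) u = support_function K (\row_i (d i * u 0 i)).
Proof.
move=> d0; rewrite /support_function; congr sup; apply/seteqP; split => _ [y Ky <-].
  exists (\row_i ((d i)^-1 * y 0 i)) => //; apply: eq_bigr => i _; rewrite !mxE.
  by field; exact: lt0r_neq0.
exists (\row_i (d i * y 0 i)).
  rewrite /diag_image /mkset; move: Ky; congr K; apply/rowP => i; rewrite !mxE.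
  by rewrite mulrA mulVf ?mul1r // lt0r_neq0.
by apply: eq_bigr => i _; rewrite !mxE; ring.
Qed.

End support_functions.

Section zero_combination.
Context (R : realType) (l : R) (l0 : 0 < l) (l1 : l < 1) (n : nat).
Context (K L : set 'rV[R]_n) (sK : solid_body K) (sL : solid_body L).
Implicit Types (x y u : 'rV[R]_n).

Local Notation Z := (zero_convex_combination l K L).
Local Notation hK := (support_function K).
Local Notation hL := (support_function L).

(** Both sides of the defining inequality are positively homogeneous, so it passes
    from unit vectors to all vectors. *)
Lemma zero_combinationP x : Z x <-> forall u, dotv x u <= gmean l (hK u) (hL u).
Proof.
split=> [Zx u|h u _]; last exact: h.
have [->|u0] := eqVneq u 0.
  by rewrite /dotv big1 ?gmean_ge0 // => i _; rewrite mxE mulr0.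
have uu : 0 < dotv u u.
  have /rV0Pn[i ui] := u0; rewrite /dotv (bigD1 i) //= ltr_wpDr //.
    by apply: sumr_ge0 => j _; rewrite -expr2 sqr_ge0.
  by rewrite -expr2 lt0r sqrf_eq0 ui sqr_ge0.
set r := Num.sqrt (dotv u u); have r0 : 0 < r by rewrite sqrtr_gt0.
have := Zx (r^-1 *: u); rewrite /unit_sphere /= -/(dotv _ _).
have -> : dotv (r^-1 *: u) (r^-1 *: u) = 1.
  rewrite dotvZl dotvC dotvZl mulrA -expr2 exprVn /r sqr_sqrtr ?ltW //.
  by rewrite mulVf // lt0r_neq0.
rewrite sqrtr1 => /(_ erefl); rewrite -/(gmean _ _ _).
rewrite !support_scale ?invr_ge0 ?(ltW r0) // gmeanZ ?support_ge0 ?invr_ge0 ?(ltW r0) //.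
by rewrite dotvC dotvZl dotvC ler_pM2l ?invr_gt0.
Qed.

(** By Hoelder's inequality, applied to the terms of the two scalar products. *)
Lemma zero_combination_contains : contains_gmeans l K L Z.
Proof.
move=> x y z Kx Ly hz; apply/zero_combinationP => u.
apply: le_trans (dotv_le_abs _ _) _.
have -> : dotv (abs_row z) (abs_row u) =
    \sum_i gmean l (`|u 0 i| * `|x 0 i|) (`|u 0 i| * `|y 0 i|).
  by apply: eq_bigr => i _; rewrite !mxE hz gmeanZ // mulrC.
apply: le_trans (gmean_sum_le l0 l1 _ _) _ => [i|i|]; rewrite ?mulr_ge0 //.
have E (v w : 'rV[R]_n) : \sum_i `|v 0 i| * `|w 0 i| = dotv (abs_row v) (abs_row w).
  by apply: eq_bigr => i _; rewrite !mxE.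
have E0 (v w : 'rV[R]_n) : 0 <= \sum_i `|v 0 i| * `|w 0 i| :> R.
  by apply: sumr_ge0 => i _; rewrite mulr_ge0.
apply: gmean_le => //.
  rewrite E -(support_abs sK); apply: support_ge => //.
  exact/(abs_row_solid _ sK).
rewrite E -(support_abs sL); apply: support_ge => //.
exact/(abs_row_solid _ sL).
Qed.

Lemma zero_combination_solid : solid_body Z.
Proof.
split.
- move=> x h; apply/zero_combinationP => u; apply/ler_addgt0Pr => e e0.
  pose C := \sum_i `|u 0 i| + 1.
  have C0 : 0 < C by rewrite ltr_wpDl // sumr_ge0.
  have [y /zero_combinationP Zy xy] := h _ (divr_gt0 e0 C0).
  have -> : dotv x u = dotv y u + dotv (x - y) u by rewrite -dotvDl subrKC.
  apply: lerD; first exact: Zy.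
  apply: (@le_trans _ _ (\sum_i (e / C) * `|u 0 i|)).
    apply: ler_sum => i _; apply: le_trans (ler_norm _) _; rewrite normrM.
    by rewrite !mxE ler_wpM2r // ltW.
  by rewrite -mulr_sumr mulrAC ler_pdivrMr // ler_pM2l // /C lerDl.
- exists (\sum_i gmean l (hK (delta_mx 0 i)) (hL (delta_mx 0 i))).
  move=> x /zero_combinationP Zx i.
  apply: (@le_trans _ _ (gmean l (hK (delta_mx 0 i)) (hL (delta_mx 0 i)))); last first.
    rewrite (bigD1 i) //= lerDl.
    by apply: sumr_ge0 => v _; exact: gmean_ge0.
  rewrite ler_norml -{2}dotv_delta Zx andbT lerNl -dotv_delta.
  have := Zx (- delta_mx 0 i).
  rewrite -(support_abs sK (- _)) -(support_abs sL (- _)).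
  have -> : abs_row (- delta_mx 0 i) = delta_mx 0 i :> 'rV[R]_n.
    by apply/rowP => j; rewrite !mxE normrN /= normr_nat.
  by rewrite dotvC -scaleN1r dotvZl mulN1r dotvC.
- move=> x y t /zero_combinationP Zx /zero_combinationP Zy t0 t1.
  apply/zero_combinationP => u; rewrite dotvDl !dotvZl.
  have t1' : 0 <= 1 - t by lra.
  have := ler_wpM2l t0 (Zx u); have := ler_wpM2l t1' (Zy u); lra.
- move=> x y /zero_combinationP Zx yx; apply/zero_combinationP => u.
  apply: le_trans (dotv_le_abs _ _) _.
  pose v : 'rV[R]_n := \row_i (Num.sg (x 0 i) * `|u 0 i|).
  have vu i : `|v 0 i| <= `|u 0 i|.
    rewrite mxE normrM normr_sg normr_id.
    by case: (x 0 i != 0); rewrite ?mul1r ?mul0r.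
  apply: (@le_trans _ _ (dotv x v)).
    apply: ler_sum => i _; rewrite !mxE mulrA [x 0 i * _]mulrC -normrEsg.
    by rewrite ler_wpM2r.
  by apply: le_trans (Zx v) _; apply: gmean_le; rewrite ?support_ge0 // support_mono.
- have [d d0 qK] := solid_cube sK; have [e e0 qL] := solid_cube sL.
  exists (Order.min d e); first by rewrite lt_min d0.
  move=> x hx; have Kx : K x.
    by apply: qK => i; apply: le_trans (hx i) _; rewrite ge_min lexx.
  have Lx : L x.
    by apply: qL => i; apply: le_trans (hx i) _; rewrite ge_min lexx orbT.
  apply: (zero_combination_contains Kx Lx) => i.
  by rewrite gmean_id.
Qed.

End zero_combination.

(** * Level sets of a diagonal map in the equality case *)

Section tight_constraints.
Context (R : realType) (l : R) (n : nat).

(** If all constraints were slack at w, then by compactness of the unit sphere (here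
    that of the sup norm) they would be slack by a uniform amount, and a slightly
    larger multiple of w would satisfy them. *)
Lemma tight_constraint (K L : set 'rV[R]_n) (w : 'rV[R]_n) :
  solid_body K -> solid_body L ->
  (forall e, 0 < e -> ~ zero_convex_combination l K L ((1 + e) *: w)) ->
  exists2 u, u != 0 & gmean l (support_function K u) (support_function L u) <= dotv w u.
Proof.
move=> sK sL hw; apply: contrapT => hno.
have slack u : u != 0 ->
    dotv w u < gmean l (support_function K u) (support_function L u).
  by move=> u0; rewrite ltNge; apply/negP => h; apply: hno; exists u.
pose S := [set u : 'rV[R]_n | `|u| = 1].
have S0 u : S u -> u != 0.
  by move=> Su; apply/eqP => u0; move: Su; rewrite u0 /S /= normr0 => /esym/eqP; rewrite oner_eq0.
pose phi (u : 'rV[R]_n) :=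
  expR (l * ln (support_function K u) + (1 - l) * ln (support_function L u)) - dotv w u.
have phiE u : S u ->
    phi u = gmean l (support_function K u) (support_function L u) - dotv w u.
  move=> /S0 u0; rewrite /phi -ln_gmean ?support_gt0 // lnK // posrE.
  by rewrite gmean_gt0 ?support_gt0.
have cS : compact S.
  apply: bounded_closed_compact.
    by exists 1; split => // r r1 u; rewrite /S /= => ->; exact: ltW.
  have -> : S = Num.norm @^-1` [set 1 : R] by [].
  by apply: closed_comp; [move=> u _; exact: norm_continuous|exact: closed_eq].
have phic : {within S, continuous phi}.
  apply: continuous_in_subspaceT => u /set_mem Su; have u0 := S0 u Su.
  have lnc (A : set 'rV[R]_n) : solid_body A ->
      ln (support_function A v) @[v --> u] --> ln (support_function A u).
    move=> sA; apply: (@cvg_comp _ _ _ (support_function A) (@ln R) _ _ _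
      (@support_continuous _ _ _ sA u)).
    exact/continuous_ln/support_gt0.
  pose psi v := l * ln (support_function K v) + (1 - l) * ln (support_function L v).
  have psic : psi v @[v --> u] --> psi u.
    exact: (cvgD (cvgM (cvg_cst _) (lnc K sK)) (cvgM (cvg_cst _) (lnc L sL))).
  have expc : expR (psi v) @[v --> u] --> expR (psi u).
    by apply: (@cvg_comp _ _ _ psi (@expR R) _ _ _ psic); exact: continuous_expR.
  exact: (cvgB expc (@dotv_continuous _ _ w u)).
have [S1|S1] := pselect (S !=set0); last first.
  apply: (hw 1) => //; apply/zero_combinationP => // u.
  have [->|u0] := eqVneq u 0.
    by rewrite /dotv big1 ?gmean_ge0 // => i _; rewrite !mxE mulr0.
  exfalso; apply: S1; exists (`|u|^-1 *: u); rewrite /S /= normrZ normfV normr_id.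
  by rewrite mulVf // normr_eq0.
have [c /set_mem Sc cmin] := compact_EVT_min S1 cS phic.
have m0 : 0 < phi c by rewrite phiE // subr_gt0; exact/slack/S0.
pose C := \sum_i `|w 0 i| + 1.
have C0 : 0 < C by rewrite ltr_wpDl // sumr_ge0.
(* On unit vectors the scalar product with w is at most C, so enlarging w by the
   factor 1 + phi c / C consumes at most the minimal slack phi c. *)
have e0 : 0 < phi c / C by rewrite divr_gt0.
apply: (hw _ e0); apply/zero_combinationP => // u.
have [->|u0] := eqVneq u 0.
  by rewrite /dotv big1 ?gmean_ge0 // => i _; rewrite !mxE mulr0.
have r0 : 0 < `|u| by rewrite normr_gt0.
pose v := `|u|^-1 *: u.
have Sv : S v by rewrite /S /v /= normrZ normfV normr_id mulVf // normr_eq0.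
have -> : u = `|u| *: v by rewrite scalerA divff ?scale1r // normr_eq0.
rewrite (support_scale sK _ (ltW r0)) (support_scale sL _ (ltW r0)).
rewrite gmeanZ ?support_ge0 ?(ltW r0) //.
rewrite dotvC dotvZl dotvC ler_pM2l //.
have wv : dotv w v <= C.
  apply: le_trans (dotv_le_norm _ _) _.
  by rewrite [`|v|]Sv mulr1 /C lerDl.
have := cmin v (mem_set Sv); rewrite (phiE v) // => h.
rewrite dotvZl mulrDl mul1r.
have h' : phi c / C * dotv w v <= phi c by rewrite mulrAC ler_pdivrMr // ler_pM2l.
by apply: le_trans (lerD (lexx _) h') _; rewrite addrC -lerBrDr.
Qed.

End tight_constraints.

Lemma solid_exit (R : realType) n (K : set 'rV[R]_n) q : solid_body K -> ~ K q ->
  exists theta, [/\ 0 < theta, theta < 1, K (theta *: q) &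
    forall e, 0 < e -> ~ K ((1 + e) *: (theta *: q))].
Proof.
move=> sK Kq; pose E := [set t : R | 0 <= t /\ K (t *: q)].
have [d d0 qK] := solid_cube sK.
have E1 t : E t -> t < 1.
  move=> [t0 Kt]; rewrite ltNge; apply/negP => t1; apply: Kq.
  have t0' : 0 < t by lra.
  have := solid_scale sK Kt (t := t^-1); rewrite scalerA mulVf ?lt0r_neq0 // scale1r.
  by apply; rewrite ?invr_ge0 // invf_le1.
have r0 : 0 < d / (`|q| + 1) by rewrite divr_gt0 // ltr_wpDl.
have Er : E (d / (`|q| + 1)).
  split; first exact: ltW.
  apply: qK => i; rewrite mxE normrM (gtr0_norm r0) mulrAC.
  rewrite ler_pdivrMr ?ltr_wpDl // ler_pM2l //.
  by apply: le_trans (coord_le_norm q i) _; rewrite lerDl.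
have supE : has_sup E by split; [eexists; exact: Er|exists 1 => t /E1/ltW].
pose th := sup E.
have th0 : 0 < th by apply: lt_le_trans r0 _; apply: ub_le_sup Er; case: supE.
have Kth : K (th *: q).
  apply: (solid_of_shrink sK) => t t0 t1.
  have tth : 0 < t * th by rewrite mulr_gt0.
  have [s [s0 Ks] hs] := sup_adherent tth supE.
  apply: (solid_down sK Ks) => i; rewrite !mxE mulrA !normrM ler_wpM2r //.
  rewrite -normrM !ger0_norm ?mulr_ge0 ?(ltW th0) ?subr_ge0 ?(ltW t1) //.
  rewrite -/th in hs; lra.
exists th; split => //; first exact: (E1 th (conj (ltW th0) Kth)).
move=> e e0 Ke; have : (1 + e) * th <= th.
  apply: ub_le_sup; first by case: supE.
  by split; [rewrite mulr_ge0 ?(ltW th0) //; lra|rewrite -scalerA].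
have : 0 < e * th by rewrite mulr_gt0.
lra.
Qed.

Section level_sets.
Context (R : realType) (l : R) (l0 : 0 < l) (l1 : l < 1) (n : nat).
Context (K : set 'rV[R]_n) (d : 'I_n -> R).
Hypotheses (sK : solid_body K) (d0 : forall i, 0 < d i).
Hypothesis hZ : zero_convex_combination l K (diag_image d K) `<=`
  diag_image (fun i => d i `^ (1 - l)) K.

(** Put w = d^(1 - l) x.  A constraint u of the 0-convex combination that is tight at
    w yields the vector v = d^(1 - l) |u|.  Hoelder's inequality bounds the scalar
    product of v with any point of K by the right-hand side of the constraint u,
    hence by the scalar product with x: v is a normal vector of K at x.  At the
    point x itself Hoelder's inequality is an equality, so d is constant on the
    support of v. *)
Lemma normal_in_level x : K x -> (forall i, 0 < x 0 i) ->
  (forall e, 0 < e -> ~ K ((1 + e) *: x)) ->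
  exists v : 'rV[R]_n, [/\ forall i, 0 <= v 0 i, exists i, 0 < v 0 i,
    forall i j, 0 < v 0 i -> 0 < v 0 j -> d i = d j &
    forall y, K y -> dotv v y <= dotv v x].
Proof.
move=> Kx x0 hx; pose m i := d i `^ (1 - l).
have m0 i : 0 < m i by exact: powR_gt0.
pose w : 'rV[R]_n := \row_i (m i * x 0 i).
have hw e : 0 < e -> ~ zero_convex_combination l K (diag_image d K) ((1 + e) *: w).
  move=> e0 /hZ; rewrite /diag_image /mkset => Ke; apply: (hx e e0).
  move: Ke; congr K; apply/rowP => i; rewrite !mxE -/(m i).
  by field; exact: lt0r_neq0.
have [u u0 hu] := tight_constraint sK (diag_image_solid d0 sK) hw.
pose p i := `|u 0 i| * x 0 i; pose q i := d i * `|u 0 i| * x 0 i.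
have p0 i : 0 <= p i by rewrite mulr_ge0 // ltW.
have q0 i : 0 <= q i by rewrite !mulr_ge0 // ltW.
have gE (y : R) i : 0 <= y ->
    gmean l (`|u 0 i| * y) (d i * `|u 0 i| * y) = m i * `|u 0 i| * y.
  move=> y0; rewrite -mulrA -{1}[`|_| * y]mul1r gmeanM ?mulr_ge0 ?(ltW (d0 i)) //.
  by rewrite /gmean powR1 mul1r -/(gmean _ _ _) gmean_id ?mulr_ge0 // -/(m i) mulrA.
have hKu : \sum_i p i <= support_function K u.
  rewrite -(support_abs sK); apply: le_trans (support_ge sK _ Kx).
  by apply: ler_sum => i _; rewrite !mxE.
have abs_d : abs_row (\row_i (d i * u 0 i)) = \row_i (d i * `|u 0 i|) :> 'rV[R]_n.
  by apply/rowP => i; rewrite !mxE normrM gtr0_norm.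
have hLu : \sum_i q i <= support_function K (\row_i (d i * u 0 i)).
  rewrite -(support_abs sK) abs_d; apply: le_trans (support_ge sK _ Kx).
  by apply: ler_sum => i _; rewrite !mxE.
rewrite (support_diag _ _ d0) in hu.
pose v : 'rV[R]_n := \row_i (m i * `|u 0 i|).
have wu : dotv w u <= dotv v x.
  apply: ler_sum => i _; rewrite !mxE mulrAC ler_wpM2r ?(ltW (x0 i)) //.
  by rewrite ler_pM2l // ler_norm.
have vx : dotv v x = \sum_i gmean l (p i) (q i).
  by apply: eq_bigr => i _; rewrite mxE gE // ltW.
exists v; split.
- by move=> i; rewrite mxE mulr_ge0 // ltW.
- by have /rV0Pn[i ui] := u0; exists i; rewrite mxE mulr_gt0 // normr_gt0.
- have pq : forall i j, 0 < p i -> 0 < p j -> q i / p i = q j / p j.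
    apply: (gmean_sum_eq l0 l1 p0 q0).
      by move=> i; rewrite /p /q -mulrA (pmulr_rgt0 _ (d0 i)).
    rewrite -vx; apply: le_trans wu; apply: le_trans hu.
    by apply: gmean_le => //; apply: sumr_ge0.
  have vp i : 0 < v 0 i -> 0 < p i /\ q i / p i = d i.
    rewrite mxE (pmulr_rgt0 _ (m0 i)) => ui.
    have pi : 0 < p i by rewrite /p mulr_gt0.
    by split => //; rewrite /q -[d i * _ * _]mulrA -/(p i) mulfK // lt0r_neq0.
  by move=> i j /vp[pi <-] /vp[pj <-]; exact: pq.
- move=> y Ky; apply: (@le_trans _ _ (dotv v (abs_row y))).
    apply: ler_sum => i _; rewrite !mxE; apply: ler_wpM2l; last exact: ler_norm.
    by rewrite mulr_ge0 // ltW.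
  have -> : dotv v (abs_row y) =
      \sum_i gmean l (`|u 0 i| * `|y 0 i|) (d i * `|u 0 i| * `|y 0 i|).
    by apply: eq_bigr => i _; rewrite !mxE gE.
  apply: le_trans wu; apply: le_trans hu.
  have Kay : K (abs_row y) by exact/(abs_row_solid _ sK).
  apply: le_trans (gmean_sum_le l0 l1 _ _) _ => [i|i|].
  + by rewrite mulr_ge0.
  + by rewrite !mulr_ge0 // ltW.
  apply: gmean_le => //; try by apply: sumr_ge0 => i _; rewrite !mulr_ge0 // ltW.
    rewrite -(support_abs sK); apply: le_trans (support_ge sK _ Kay).
    by apply: ler_sum => i _; rewrite !mxE.
  rewrite -(support_abs sK) abs_d; apply: le_trans (support_ge sK _ Kay).
  by apply: ler_sum => i _; rewrite !mxE.
Qed.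

(** Otherwise the segment from 0 to a perturbation q' of q with positive coordinates
    leaves K at a point x, where K has a normal vector v supported in one level set
    of d.  But v only sees the coordinates of q' in this level set, and these are
    the coordinates of a point of K, so the scalar product of v with q' is at most
    the one with x. *)
Lemma level_product (q : 'rV[R]_n) :
  (forall i, exists2 z, K z & forall j, d j = d i -> z 0 j = q 0 j) -> K q.
Proof.
move=> hq; apply: (solid_of_shrink sK) => t t0 t1.
have [c c0 qK] := solid_cube sK.
(* A perturbation that stays in K on points of K and makes all coordinates positive. *)
pose shift (z : 'rV[R]_n) : 'rV[R]_n := \row_i ((1 - t) * `|z 0 i| + t * c).
have Kshift z : K z -> K (shift z).
  move=> Kz; apply: (solid_midcube sK _ t0 t1 qK (x := abs_row z)).
    exact/(abs_row_solid _ sK).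
  by move=> i; rewrite !mxE addrC addKr gtr0_norm // mulr_gt0.
have h1t : 0 <= 1 - t by lra.
have tc : 0 < t * c by rewrite mulr_gt0.
have shift0 z i : 0 < shift z 0 i by rewrite mxE ltr_wpDl // mulr_ge0.
suff Kq' : K (shift q).
  apply: (solid_down sK Kq') => i; rewrite [X in _ <= X]gtr0_norm // !mxE normrM.
  by rewrite ger0_norm // lerDl ltW.
apply: contrapT => nK; have [th [th0 th1 Kth hth]] := solid_exit sK nK.
have x0 i : 0 < (th *: shift q) 0 i by rewrite mxE mulr_gt0.
have [v [v0 [i0 vi0] vd vn]] := normal_in_level Kth x0 hth.
have [z Kz zq] := hq i0.
have := vn _ (Kshift z Kz).
have -> : dotv v (shift z) = dotv v (shift q).
  apply: eq_bigr => j _; have := v0 j; rewrite le_eqVlt => /predU1P[<-|vj].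
    by rewrite !mul0r.
  by rewrite !mxE zq //; exact: vd.
rewrite dotvC [X in _ <= X]dotvC dotvZl => h.
have : 0 < dotv (shift q) v.
  rewrite /dotv (bigD1 i0) //= ltr_wpDr //; last exact: mulr_gt0.
  by apply: sumr_ge0 => j _; rewrite mulr_ge0 // ltW.
by move=> hp; move: h; rewrite ler_pMl // leNgt th1.
Qed.

End level_sets.

(** * Separation and Cartesian decompositions *)

Section separation.
Context (R : realType) (n : nat).

(** The separating vector points from the nearest point y of K to p. *)
Lemma support_separates (K : set 'rV[R]_n) p : solid_body K -> ~ K p ->
  exists u, support_function K u < dotv u p.
Proof.
move=> sK Kp; pose phi (y : 'rV[R]_n) := \sum_i (p 0 i - y 0 i) * (p 0 i - y 0 i).
have phiE y : phi y = dotv (p - y) (p - y) by apply: eq_bigr => i _; rewrite !mxE.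
have phic : continuous phi.
  apply: (@continuous_big _ _ +%R 0 xpredT); first exact: add_continuous.
  move=> i _ y.
  have c : p 0 i - (z : 'rV[R]_n) 0 i @[z --> y] --> p 0 i - y 0 i.
    exact: (cvgB (cvg_cst (p 0 i)) (@coord_continuous _ _ _ 0 i y)).
  exact: (cvgM c c).
have [[cK _ _] _] := (solid_bodyP K).2 sK.
have K0 : K !=set0 by exists 0; exact: solid0.
have [y /set_mem Ky ymin] := compact_EVT_min K0 cK (continuous_subspaceT phic).
have pos : 0 < dotv (p - y) (p - y).
  have : p - y != 0.
    by apply/eqP => /eqP; rewrite subr_eq0 => /eqP py; apply: Kp; rewrite py.
  move=> /rV0Pn[i ui]; rewrite /dotv (bigD1 i) //= ltr_wpDr //.
    by apply: sumr_ge0 => j _; rewrite -expr2 sqr_ge0.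
  by rewrite -expr2 lt0r sqrf_eq0 ui sqr_ge0.
exists (p - y); apply: (@le_lt_trans _ _ (dotv (p - y) y)); last first.
  have -> : dotv (p - y) p = dotv (p - y) (p - y) + dotv (p - y) y.
    by rewrite /dotv -big_split; apply: eq_bigr => i _; rewrite !mxE /=; ring.
  by rewrite ltrDr.
apply: support_le => // z Kz.
have qf t : dotv (p - y - t *: (z - y)) (p - y - t *: (z - y)) =
    dotv (p - y) (p - y) - 2 * t * (dotv (p - y) z - dotv (p - y) y)
      + t ^+ 2 * dotv (z - y) (z - y).
  rewrite /dotv -sumrB !mulr_sumr -sumrB -big_split /=.
  by apply: eq_bigr => i _; rewrite !mxE; ring.
rewrite -subr_le0; set c := dotv (p - y) z - _ in qf *; set q := dotv (z - y) (z - y) in qf *.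
have q0 : 0 <= q by apply: sumr_ge0 => i _; rewrite -expr2 sqr_ge0.
(* The point t z + (1 - t) y of K is not closer to p than y is. *)
have step t : 0 < t -> t <= 1 -> 2 * c <= t * q.
  move=> t0 t1; have Kt : K (t *: z + (1 - t) *: y) by apply: solid_convex => //; exact: ltW.
  have := ymin _ (mem_set Kt); rewrite !phiE.
  have -> : p - (t *: z + (1 - t) *: y) = p - y - t *: (z - y).
    by apply/rowP => i; rewrite !mxE; ring.
  rewrite qf => h; rewrite -(ler_pM2l t0); lra.
rewrite leNgt; apply/negP => c0.
have q1 : 0 < q + 1 by lra.
pose t := Order.min 1 (c / (q + 1)).
have t0 : 0 < t by rewrite lt_min ltr01 divr_gt0.
have t1 : t <= 1 by rewrite ge_min lexx.
have tq : t * (q + 1) <= c by rewrite -ler_pdivlMr // ge_min lexx orbT.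
by have := step t t0 t1; lra.
Qed.

End separation.

Section separators.
Context (R : realType) (n : nat).
Implicit Types (K : set 'rV[R]_n) (S I : {set 'I_n}) (x y : 'rV[R]_n).

Definition splice S x y : 'rV[R]_n := \row_i (if i \in S then x 0 i else y 0 i).

(** The index sets S such that K is the product of its projections to the coordinates
    in S and to the remaining ones.  Unlike the factors of a product, they all live
    in the same space, and they form a Boolean algebra. *)
Definition separator K S : Prop := forall x y, K x -> K y -> K (splice S x y).

Lemma separatorC K S : separator K S -> separator K (~: S)%SET.
Proof.
move=> h x y Kx Ky; have := h _ _ Ky Kx; congr K; apply/rowP => i.
by rewrite !mxE finset.in_setC; case: (i \in S).
Qed.

Lemma separatorI K S T : separator K S -> separator K T -> separator K (S :&: T)%SET.
Proof.
move=> hS hT x y Kx Ky; have := hS _ _ (hT _ _ Kx Ky) Ky; congr K; apply/rowP => i.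
by rewrite !mxE finset.in_setI; case: (i \in S).
Qed.

Lemma separatorT K : separator K [set: 'I_n]%SET.
Proof.
move=> x y Kx _; move: Kx; congr K; apply/rowP => i.
by rewrite mxE finset.in_setT.
Qed.

(** Extension by 0, written as a monomial map so that sections of solid bodies are
    solid by [solid_preimage]. *)
Definition embed I (y : 'rV[R]_#|I|) : 'rV[R]_n :=
  monomial_map (fun _ => 1) (fun i => [pick k | enum_val k == i]) y.

(** For a solid body the section by a coordinate subspace is also the projection, and
    a factor of a product is recovered as a section of it. *)
Definition coord_section I K : set 'rV[R]_#|I| := [set y | K (embed y)].
Arguments coord_section I K : clear implicits.

Lemma embed_val I (y : 'rV[R]_#|I|) k : embed y 0 (enum_val k) = y 0 k.
Proof.
rewrite mxE mul1r; case: pickP => [j /eqP/enum_val_inj -> //|/(_ k)].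
by rewrite eqxx.
Qed.

Lemma embed_out I (y : 'rV[R]_#|I|) i : i \notin I -> embed y 0 i = 0.
Proof.
move=> iI; rewrite mxE; case: pickP => [j /eqP ji|]; last by rewrite mulr0.
by move: iI; rewrite -ji enum_valP.
Qed.

Lemma enum_val_ex I i : i \in I -> exists k : 'I_#|I|, i = enum_val k.
Proof. by move=> iI; exists (enum_rank_in iI i); rewrite enum_rankK_in. Qed.

Lemma proj_embed I (y : 'rV[R]_#|I|) : proj_coords I (embed y) = y.
Proof. by apply/rowP => k; rewrite mxE embed_val. Qed.

Lemma proj_embed_disjoint I (J : {set 'I_n}) (y : 'rV[R]_#|I|) : fintype.disjoint (mem I) (mem J) ->
  proj_coords J (embed y) = 0.
Proof.
move=> IJ; apply/rowP => k; rewrite mxE [RHS]mxE embed_out //.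
by rewrite (disjointFl IJ) // enum_valP.
Qed.

Lemma embed_projE I x i : embed (proj_coords I x) 0 i = if i \in I then x 0 i else 0.
Proof.
case: ifPn => [iI|]; last exact: embed_out.
by have [k ->] := enum_val_ex iI; rewrite embed_val mxE.
Qed.

Lemma section_solid I K : solid_body K -> solid_body (coord_section I K).
Proof.
apply: solid_preimage => // k; exists (enum_val k).
case: pickP => [j /eqP/enum_val_inj -> //|/(_ k)]; by rewrite eqxx.
Qed.

Lemma section_proj I K x : solid_body K -> K x -> coord_section I K (proj_coords I x).
Proof.
move=> sK Kx; apply: (solid_down sK Kx) => i; rewrite embed_projE.
by case: ifP => // _; rewrite normr0.
Qed.

Lemma splice_proj S K x y : solid_body K -> separator K S ->
  coord_section S K (proj_coords S x) -> K y -> K (splice S x y).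
Proof.
move=> sK hS Sx Ky; have := hS _ _ Sx Ky; congr K; apply/rowP => i.
by rewrite mxE [RHS]mxE embed_projE; case: (i \in S).
Qed.

(** The blocks of P are spliced in one after the other. *)
Lemma product_of_separators (P : {set {set 'I_n}}) K : solid_body K ->
  finset.partition P [set: 'I_n]%SET -> (forall I, I \in P -> separator K I) ->
  K = cartesian_product P (fun I => coord_section I K).
Proof.
move=> sK /and3P[/eqP covP _ _] sepP; apply/seteqP; split => x.
  by move=> Kx I _; exact: section_proj.
move=> hx.
(* The coordinates of x in the first few blocks, completed by 0, form a point of K. *)
suff H (s : seq {set 'I_n}) : {subset s <= P} ->
    K (\row_i (if has (fun I : {set 'I_n} => i \in I) s then x 0 i else 0)).
  have sP : {subset enum P <= P} by move=> I; rewrite mem_enum.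
  have := H _ sP; congr K; apply/rowP => i; rewrite mxE.
  have : i \in finset.cover P by rewrite covP finset.in_setT.
  move=> /bigcupP[I IP iI]; suff -> : has (fun I : {set 'I_n} => i \in I) (enum P) by [].
  by apply/hasP; exists I; rewrite ?mem_enum.
elim: s => [_|I s IH sP].
  have := solid0 sK; congr K; apply/rowP => i; by rewrite !mxE.
have IP : I \in P by apply: sP; rewrite mem_head.
have {IH}Ks := IH (fun J js => sP J (mem_behead (s := I :: s) js)).
have := splice_proj sK (sepP I IP) (hx I IP) Ks; congr K; apply/rowP => i.
by rewrite !mxE /=; case: (i \in I).
Qed.

Section product.
Context (P : {set {set 'I_n}}) (F : forall I : {set 'I_n}, set 'rV[R]_#|I|) (K : set 'rV[R]_n).
Arguments F I : clear implicits.
Hypotheses (hP : finset.partition P [set: 'I_n]%SET).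
Hypotheses (sF : forall I, I \in P -> solid_body (F I)).
Hypothesis KE : K = cartesian_product P F.

Let disj (I J : {set 'I_n}) : I \in P -> J \in P -> I != J -> fintype.disjoint (mem I) (mem J).
Proof. by move=> IP JP IJ; have /and3P[_ /finset.trivIsetP tP _] := hP; exact: tP. Qed.

Lemma product_section I : I \in P -> F I = coord_section I K.
Proof.
move=> IP; apply/seteqP; split => y.
  rewrite /coord_section KE => Fy J JP /=.
  have [<-|IJ] := eqVneq I J; first by rewrite proj_embed.
  by rewrite proj_embed_disjoint ?disj //; apply: solid0; exact: sF.
by rewrite /coord_section KE => /(_ I IP); rewrite proj_embed.
Qed.

Lemma product_separator I : I \in P -> separator K I.
Proof.
move=> IP x y; rewrite KE => Fx Fy J JP.
have [IJ|IJ] := eqVneq I J.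
  have -> : proj_coords J (splice I x y) = proj_coords J x; last exact: Fx.
  by apply/rowP => k; rewrite !mxE IJ enum_valP.
have -> : proj_coords J (splice I x y) = proj_coords J y; last exact: Fy.
apply/rowP => k; rewrite !mxE.
by rewrite (disjointFl (disj IP JP IJ)) // enum_valP.
Qed.

End product.

End separators.
Arguments coord_section {R n} I K.

Lemma irreducible_separator (R : realType) n (K : set 'rV[R]_n) (S : {set 'I_n}) :
  solid_body K -> irreducible K -> separator K S -> S != finset.set0 ->
  S = [set: 'I_n]%SET.
Proof.
move=> sK irr sepS S0; apply/eqP; apply: contrapT => /negP ST; apply: irr.
have SC0 : (~: S)%SET != finset.set0.
  by apply: contra ST => /eqP SC; rewrite -(finset.setCK S) SC finset.setC0.
have SSC : S != (~: S)%SET.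
  apply: contra S0 => /eqP e; apply/eqP; rewrite -(finset.setIid S) {2}e.
  by rewrite finset.setICr.
pose P : {set {set 'I_n}} := [set S; (~: S)%SET]%SET.
have hP : finset.partition P [set: 'I_n]%SET.
  apply/and3P; split.
  - apply/eqP/finset.setP => i; rewrite finset.in_setT; apply/finset.bigcupP.
    have [iS|iS] := boolP (i \in S); first by exists S; rewrite ?finset.in_set2 ?eqxx.
    by exists (~: S)%SET; rewrite ?finset.in_set2 ?eqxx ?orbT // finset.in_setC.
  - apply/finset.trivIsetP => A B; rewrite !finset.in_set2 => /orP[]/eqP-> /orP[]/eqP->;
      rewrite ?eqxx // => _.
      by rewrite -finset.setI_eq0 finset.setICr.
    by rewrite -finset.setI_eq0 finset.setIC finset.setICr.
  - by rewrite finset.in_set2 negb_or eq_sym S0 eq_sym SC0.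
exists P, (fun I => coord_section I K); split => //.
- by rewrite finset.cards2 SSC.
- by move=> I _; apply/solid_bodyP; exact: section_solid.
- apply: product_of_separators => // I; rewrite finset.in_set2 => /orP[]/eqP-> //.
  exact: separatorC.
Qed.

(** * Irreducible factors and the equality case *)

Section decomposition.
Context (R : realType) (n : nat).

(** The blocks are the atoms of the Boolean algebra of separators.  A nontrivial
    factorization of the section over an atom I would give a separator strictly
    between the empty set and I. *)
Lemma irreducible_decomposition (K : set 'rV[R]_n) : solid_body K ->
  exists P : {set {set 'I_n}},
    [/\ finset.partition P [set: 'I_n]%SET,
        forall I, I \in P -> separator K I,
        forall I, I \in P -> irreducible (coord_section I K) &
        K = cartesian_product P (fun I => coord_section I K)].
Proof.
move=> sK.
pose r (i j : 'I_n) := `[< forall S, separator K S -> (i \in S) = (j \in S) >].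
have rP i j : reflect (forall S, separator K S -> (i \in S) = (j \in S)) (r i j).
  exact: asboolP.
have eqr : {in [set: 'I_n]%SET & &, equivalence_rel r}.
  move=> i j k _ _ _; split; first by apply/rP.
  move=> /rP rij; apply/rP/rP => h S sS; [rewrite -rij|rewrite rij] => //; exact: h.
pose P := finset.equivalence_partition r [set: 'I_n]%SET.
have hP : finset.partition P [set: 'I_n]%SET by exact: equivalence_partitionP.
have [/eqP covP tP n0P] := and3P hP.
have memP I i j : I \in P -> i \in I -> (j \in I) = r i j.
  move=> IP iI; rewrite -(finset.def_pblock tP IP iI).
  by rewrite finset.pblock_equivalence_partition ?finset.in_setT.
have sepP I : I \in P -> separator K I.
  move=> IP; have /finset.set0Pn[i iI] : I != finset.set0.
    by apply: contraNneq n0P => <-.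
  pose A := [set S : {set 'I_n} | `[< separator K S >] && (i \in S)]%SET.
  have -> : I = (\bigcap_(S in A) S)%SET.
    apply/finset.setP => j; rewrite (memP I i j IP iI); apply/rP/finset.bigcapP.
      by move=> h S; rewrite finset.inE => /andP[/asboolP sS iS]; rewrite -(h S sS).
    move=> h S sS; case: (boolP (i \in S)) => iS.
      by apply/esym/h; rewrite finset.inE iS andbT; apply/asboolP.
    apply/esym/negbTE; rewrite -finset.in_setC; apply: h.
    rewrite finset.inE finset.in_setC iS andbT; apply/asboolP; exact: separatorC.
  apply: (big_ind (separator K)); first exact: separatorT.
    by move=> S T; exact: separatorI.
  by move=> S; rewrite finset.inE => /andP[/asboolP].
exists P; split => //; last exact: product_of_separators.
move=> I IP [P' [F' [hP' P'1 sF' secE]]].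
have sF J : J \in P' -> solid_body (F' J) by move=> /sF'/solid_bodyP.
have sS := section_solid I sK.
have [/eqP covP' tP' n0P'] := and3P hP'.
have [J [J' [JP J'P JJ']]] : exists J J', [/\ J \in P', J' \in P' & J != J'].
  by have /card_gt1P[J [J' [? ? ?]]] := P'1; exists J, J'.
have /finset.set0Pn[k kJ] : J != finset.set0 by apply: contraNneq n0P' => <-.
have /finset.set0Pn[k' k'J'] : J' != finset.set0 by apply: contraNneq n0P' => <-.
have k'J : k' \notin J.
  have /finset.trivIsetP tP'' := tP'.
  by rewrite (disjointFl (tP'' _ _ JP J'P JJ')).
have sepJ : separator (coord_section I K) J by exact: (product_separator hP' secE JP).
(* The set of coordinates of the block J of the section. *)
pose S : {set 'I_n} := [set enum_val k | k in J]%SET.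
have memS (m : 'I_#|I|) : (enum_val m \in S) = (m \in J).
  apply/finset.imsetP/idP => [[m' m'J /enum_val_inj -> //]|mJ].
  by exists m.
have sepS : separator K S.
  move=> x y Kx Ky.
  have hw := sepJ _ _ (section_proj I sK Kx) (section_proj I sK Ky).
  have := sepP I IP _ _ hw Ky; congr K; apply/rowP => i; rewrite mxE [RHS]mxE.
  case: ifPn => iI; last first.
    case: ifPn => // /finset.imsetP[m _ im]; move: iI; rewrite im enum_valP //.
  by have [m ->] := enum_val_ex iI; rewrite embed_val mxE memS !mxE.
have /rP rkk' : r (enum_val k) (enum_val k').
  by rewrite -(memP I _ _ IP (enum_valP k)) enum_valP.
by have := rkk' S sepS; rewrite !memS kJ (negbTE k'J).
Qed.

End decomposition.

Section log_brunn_minkowski.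
Context (R : realType) (l : R) (l0 : 0 < l) (l1 : l < 1) (n : nat).
Implicit Types (K L : set 'rV[R]_n) (d : 'I_n -> R).

Lemma prod_powR d (r : R) : (forall i, 0 < d i) ->
  \prod_i d i `^ r = (\prod_i d i) `^ r.
Proof.
move=> d0; suff [] : \prod_i d i `^ r = (\prod_i d i) `^ r /\ 0 <= \prod_i d i by [].
elim/big_ind2 : _ => [|x1 x2 y1 y2 [-> ?] [-> ?]|i _]; first by rewrite powR1.
  by rewrite powRM // mulr_ge0.
by rewrite ltW.
Qed.

Lemma interpolated_body_vol K d : (forall i, 0 < d i) -> solid_body K ->
  vol (diag_image (fun i => d i `^ (1 - l)) K) = gmean l (vol K) (vol (diag_image d K)).
Proof.
move=> d0 sK; have D0 : 0 <= \prod_i d i by apply: prodr_ge0 => i _; exact: ltW.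
rewrite !diag_image_vol //; last by move=> i; exact: powR_gt0.
rewrite prod_powR // -{2}[vol K]mul1r gmeanM ?vol_ge0 //.
by rewrite gmean_id ?vol_ge0 // /gmean powR1 mul1r.
Qed.

(** The coordinatewise geometric mean of |y| and d |y| is d^(1 - l) |y|. *)
Lemma interpolated_body_sub K d : (forall i, 0 < d i) -> solid_body K ->
  diag_image (fun i => d i `^ (1 - l)) K `<=` zero_convex_combination l K (diag_image d K).
Proof.
move=> d0 sK x Kx; have sL := diag_image_solid d0 sK.
pose y : 'rV[R]_n := \row_i ((d i `^ (1 - l))^-1 * x 0 i).
have Ly : diag_image d K (\row_i (d i * y 0 i)).
  rewrite /diag_image /mkset; move: Kx; congr K; apply/rowP => i; rewrite !mxE.
  by rewrite mulrA mulVf ?mul1r // lt0r_neq0.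
apply: (zero_combination_contains l0 l1 sK sL (Kx : K y) Ly) => i.
have m0 : 0 < d i `^ (1 - l) by exact: powR_gt0.
rewrite [X in gmean _ _ `|X|]mxE normrM (gtr0_norm (d0 i)) -{1}[`|y 0 i|]mul1r.
rewrite gmeanM ?(ltW (d0 i)) // gmean_id // /gmean powR1 mul1r mxE normrM normfV.
by rewrite (gtr0_norm m0) mulrA divff ?mul1r // lt0r_neq0.
Qed.

(** The interpolated body d^(1 - l) K always has the right volume and lies in the
    0-convex combination of K and d K, so equality means that the two coincide. *)
Lemma zero_combination_equalityP K L : solid_body K -> solid_body L ->
  volume (zero_convex_combination l K L) = (gmean l (vol K) (vol L))%:E <->
  exists2 d, (forall i, 0 < d i) & L = diag_image d K /\
    zero_convex_combination l K L `<=` diag_image (fun i => d i `^ (1 - l)) K.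
Proof.
move=> sK sL; have sZ := zero_combination_solid l0 l1 sK sL.
split=> [volZ|[d d0 [LE ZW]]].
  have eqKLZ : gmean_equality l K L (zero_convex_combination l K L).
    split => //; first exact: solid_measurable.
    exact: zero_combination_contains.
  have [d d0 LE] := gmean_equality_diagonal l0 l1 eqKLZ.
  exists d => //; split => //.
  have sW : solid_body (diag_image (fun i => d i `^ (1 - l)) K).
    by apply: diag_image_solid => // i; exact: powR_gt0.
  apply: (contained_of_volume sW sZ).
    by rewrite LE; exact: interpolated_body_sub.
  by rewrite interpolated_body_vol // -LE /vol volZ.
have -> : zero_convex_combination l K L = diag_image (fun i => d i `^ (1 - l)) K.
  apply/seteqP; split => //; rewrite LE; exact: interpolated_body_sub.
rewrite solid_volume ?interpolated_body_vol -?LE //.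
by apply: diag_image_solid => // i; exact: powR_gt0.
Qed.

Lemma level_separator K d c : (forall i, 0 < d i) -> solid_body K ->
  zero_convex_combination l K (diag_image d K) `<=`
    diag_image (fun i => d i `^ (1 - l)) K ->
  separator K [set i | d i == c]%SET.
Proof.
move=> d0 sK ZW x y Kx Ky; apply: (level_product l0 l1 sK d0 ZW) => i.
have [dc|dc] := eqVneq (d i) c.
  exists x => // j dji; by rewrite mxE finset.inE dji dc eqxx.
by exists y => // j dji; rewrite mxE finset.inE dji (negbTE dc).
Qed.

(** The level sets of d are separators of K, hence of the irreducible section over I,
    which has no proper ones. *)
Lemma irreducible_factor_level K d (I : {set 'I_n}) : (forall i, 0 < d i) ->
  solid_body K ->
  zero_convex_combination l K (diag_image d K) `<=`
    diag_image (fun i => d i `^ (1 - l)) K ->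
  irreducible (coord_section I K) ->
  forall i j, i \in I -> j \in I -> d i = d j.
Proof.
move=> d0 sK ZW irr i j iI jI.
have [k ik] := enum_val_ex iI; have [m jm] := enum_val_ex jI.
pose S : {set 'I_#|I|} := [set q | d (enum_val q) == d i]%SET.
have sepS : separator (coord_section I K) S.
  move=> x y Kx Ky; have := level_separator (d i) d0 sK ZW Kx Ky.
  rewrite /coord_section /mkset; congr K; apply/rowP => q; rewrite mxE finset.inE.
  have [qI|qI] := boolP (q \in I); last by rewrite !embed_out // if_same.
  by have [q' ->] := enum_val_ex qI; rewrite !embed_val mxE finset.inE.
have S0 : S != finset.set0.
  by apply/finset.set0Pn; exists k; rewrite finset.inE -ik.
have ST := irreducible_separator (section_solid I sK) irr sepS S0.
have : m \in S by rewrite ST finset.in_setT.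
by rewrite finset.inE -jm => /eqP.
Qed.

(** On vectors supported in a block I the map d is a multiplication by a constant c,
    so the constraint reads x . v <= c^(1 - l) h(v); by separation, the block I of
    d^(l - 1) x lies in the section of K over I. *)
Lemma zero_combination_product K (P : {set {set 'I_n}}) d :
  solid_body K -> finset.partition P [set: 'I_n]%SET ->
  K = cartesian_product P (fun I => coord_section I K) -> (forall i, 0 < d i) ->
  (forall I i j, I \in P -> i \in I -> j \in I -> d i = d j) ->
  zero_convex_combination l K (diag_image d K) `<=` diag_image (fun i => d i `^ (1 - l)) K.
Proof.
move=> sK hP KE d0 dP x Zx; have sL := diag_image_solid d0 sK.
rewrite /diag_image /mkset KE => I IP; apply: contrapT => nK.
have [/eqP covP tP n0P] := and3P hP.
have /finset.set0Pn[i0 i0I] : I != finset.set0 by apply: contraNneq n0P => <-.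
set y := \row_i _ in nK; pose p := embed (proj_coords I y).
have [u hu] := support_separates sK (nK : ~ K p).
pose v : 'rV[R]_n := \row_i (if i \in I then u 0 i else 0).
have m0 : 0 < d i0 `^ (1 - l) by exact: powR_gt0.
have vu : support_function K v <= support_function K u.
  by apply: support_mono => // i; rewrite mxE; case: ifP; rewrite ?normr0.
have Dv : \row_i (d i * v 0 i) = d i0 *: v.
  apply/rowP => i; rewrite !mxE; case: ifPn => iI; last by rewrite !mulr0.
  by rewrite (dP I i i0).
have := (zero_combinationP l sK sL x).1 Zx v.
rewrite support_diag // Dv support_scale ?(ltW (d0 i0)) //.
rewrite -{1}[support_function K v]mul1r gmeanM ?support_ge0 ?(ltW (d0 i0)) //.
rewrite gmean_id ?support_ge0 // /gmean powR1 mul1r.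
have -> : dotv x v = d i0 `^ (1 - l) * dotv u p.
  rewrite /dotv mulr_sumr; apply: eq_bigr => i _; rewrite /p embed_projE !mxE.
  case: ifPn => iI; last by rewrite !mulr0.
  by rewrite (dP I i i0) //; field; exact: lt0r_neq0.
rewrite ler_pM2l // => h; have := lt_le_trans hu h.
by rewrite ltNge vu.
Qed.

End log_brunn_minkowski.

Theorem theorem1p2 (R : realType) (n : nat) (K L : set 'rV[R]_n) (lambda : R)
    (hK : unconditional_convex_body K) (hL : unconditional_convex_body L)
    (lambda_gt0 : 0 < lambda) (lambda_lt1 : lambda < 1) :
  (volume K `^ lambda * volume L `^ (1 - lambda)
     <= volume (zero_convex_combination lambda K L))%E /\
  (volume (zero_convex_combination lambda K L)
     = (volume K `^ lambda * volume L `^ (1 - lambda))%E <->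
   forall (P : {set {set 'I_n}}) (F : forall I : {set 'I_n}, set 'rV[R]_#|I|),
     finset.partition P [set: 'I_n]%SET ->
     (forall I, I \in P -> unconditional_convex_body (F I) /\ irreducible (F I)) ->
     K = cartesian_product P F ->
     exists c : {set 'I_n} -> R,
       (forall I, I \in P -> 0 < c I) /\
       L = cartesian_product P (fun I => dilate (c I) (F I))).
Proof.
have /solid_bodyP sK := hK; have /solid_bodyP sL := hL.
have volE : (volume K `^ lambda * volume L `^ (1 - lambda))%E =
    (gmean lambda (vol K) (vol L))%:E.
  by rewrite (solid_volume sK) (solid_volume sL) !poweR_EFin -EFinM.
have sZ := zero_combination_solid lambda_gt0 lambda_lt1 sK sL.
rewrite volE; split.
  apply: prekopa_leindler => //; first exact: solid_measurable.
  exact: zero_combination_contains.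
apply: (iff_trans (zero_combination_equalityP lambda_gt0 lambda_lt1 sK sL)).
split=> [[d d0 [LE ZW]] P F hP hF KE|hPF].
  have [/eqP covP tP n0P] := and3P hP.
  have sF I : I \in P -> solid_body (F I) by move=> /hF[/solid_bodyP].
  have FE I : I \in P -> F I = coord_section I K by move=> IP; exact: (product_section hP sF KE).
  have dP I i j : I \in P -> i \in I -> j \in I -> d i = d j.
    move=> IP; apply: (irreducible_factor_level lambda_gt0 lambda_lt1 d0 sK).
      by rewrite -LE.
    by rewrite -FE //; have [] := hF I IP.
  (* By irreducibility d is constant on each block. *)
  exists (fun I : {set 'I_n} => if [pick i in I] is Some i then d i else 1); split.
    by move=> I _; case: pickP.
  apply/seteqP; split => x.
    rewrite LE /diag_image /mkset KE => hx I IP; case: pickP => [i iI|nI]; last first.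
      case/negP: n0P; rewrite (_ : finset.set0 = I) //; apply/esym/finset.setP => i.
      by rewrite nI finset.in_set0.
    exists ((d i)^-1 *: proj_coords I x).
      have := hx I IP; congr (F I); apply/rowP => k; rewrite !mxE.
      by rewrite (dP I i (enum_val k)) // enum_valP.
    by rewrite scalerA divff ?scale1r // lt0r_neq0.
  rewrite LE /diag_image /mkset KE => hx I IP; have := hx I IP.
  case: pickP => [i iI|nI]; last first.
    case/negP: n0P; rewrite (_ : finset.set0 = I) //; apply/esym/finset.setP => i.
    by rewrite nI finset.in_set0.
  move=> [y Fy yx]; move: Fy; congr (F I); apply/rowP => k.
  have := congr1 (fun z : 'rV[R]__ => z 0 k) yx; rewrite !mxE => <-.
  rewrite (dP I (enum_val k) i) ?enum_valP // mulrA mulVf ?mul1r //.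
  by rewrite lt0r_neq0.
have [P [hP sepP irrP KE]] := irreducible_decomposition sK.
have [/eqP covP tP n0P] := and3P hP.
have [|c [c0 LE]] := hPF P (fun I => coord_section I K) hP _ KE.
  by move=> I IP; split; [apply/solid_bodyP; exact: section_solid|exact: irrP].
pose d i := c (finset.pblock P i).
have blockP i : finset.pblock P i \in P.
  by apply: finset.pblock_mem; rewrite covP finset.in_setT.
have d0 i : 0 < d i by apply: c0; exact: blockP.
have dI I i : I \in P -> i \in I -> d i = c I.
  by move=> IP iI; rewrite /d (finset.def_pblock tP IP iI).
have dP I i j : I \in P -> i \in I -> j \in I -> d i = d j.
  by move=> IP iI jI; rewrite (dI I i) // (dI I j).
have LD : L = diag_image d K.
  rewrite LE; apply/seteqP; split => x.
    move=> hx; rewrite /diag_image /mkset KE => I IP; have [y Fy yx] := hx I IP.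
    move: Fy; congr (coord_section I K); apply/rowP => k.
    have := congr1 (fun z : 'rV[R]__ => z 0 k) yx; rewrite !mxE => <-.
    rewrite (dI I) ?enum_valP // mulrA mulVf ?mul1r //.
    by rewrite lt0r_neq0 // c0.
  rewrite /diag_image /mkset {1}KE => hx I IP.
  exists ((c I)^-1 *: proj_coords I x).
    have := hx I IP; congr (coord_section I K); apply/rowP => k; rewrite !mxE.
    by rewrite (dI I) // enum_valP.
  by rewrite scalerA divff ?scale1r // lt0r_neq0 // c0.
exists d => //; split => //; rewrite LD.
exact: (zero_combination_product sK hP KE d0 dP).
Qed.
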